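(* Let $(\Omega_j,\mathcal{M}_j,\mu_j)$ $(j=1,2)$ be $\sigma$-finite measure spaces. Let $E_j$ $(j=1,2)$ be unbounded invertible operators on $L^2(\mu_j)$ such that $E_j^{-1}\in S_{p_j}(L^2(\mu_j))$ for some $0<p_j<\infty$. Let $K\in L^2(\mu_2\otimes\mu_1)$ and let $T$ be the integral operator from $L^2(\mu_1)$ to $L^2(\mu_2)$ defined by $$(Tf)(x)=\int_{\Omega_1}K(x,y)f(y)\,d\mu_1(y).$$ Then the following holds: (i) If $(E_2)_x(E_1)_yK\in L^2(\mu_2\otimes\mu_1)$, then $T\in S_r(L^2(\mu_1),L^2(\mu_2))$ for all $0<r<\infty$ such that $$\frac1r\le\frac12+\frac1{p_1}+\frac1{p_2},$$ and moreover $$\|T\|_{S_r}\le\|E_1^{-1}\|_{S_{p_1}}\|E_2^{-1}\|_{S_{p_2}}\|(E_2)_x(E_1)_yK\|_{L^2(\mu_2\otimes\mu_1)}.$$ (ii) If $(E_2)_xK\in L^2(\mu_2\otimes\mu_1)$, then $T\in S_r(L^2(\mu_1),L^2(\mu_2))$ for all $0<r<\infty$ such that $$\frac1r\le\frac12+\frac1{p_2},$$ and moreover $$\|T\|_{S_r}\le\|E_2^{-1}\|_{S_{p_2}}\|(E_2)_xK\|_{L^2(\mu_2\otimes\mu_1)}.$$ (iii) If $(E_1)_yK\in L^2(\mu_2\otimes\mu_1)$, then $T\in S_r(L^2(\mu_1),L^2(\mu_2))$ for all $0<r<\infty$ such that $$\frac1r\le\frac12+\frac1{p_1},$$ and moreover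 $$\|T\|_{S_r}\le\|E_1^{-1}\|_{S_{p_1}}\|(E_1)_yK\|_{L^2(\mu_2\otimes\mu_1)}.$$
   Context: $L^2(\mu_j)=L^2(\Omega_j,\mu_j)$ is the complex Hilbert space of square integrable functions. All operators are linear. An unbounded operator means a densely defined operator (not assumed self-adjoint, nor bounded); an invertible operator is a densely defined operator having a bounded inverse, i.e. a closed and bijective one. Schatten classes: for a compact operator $T:H_1\to H_2$ between complex Hilbert spaces, the singular values $s_1(T)\ge s_2(T)\ge\cdots\ge0$ are the eigenvalues, counted with multiplicity, of $|T|=(T^*T)^{1/2}$. For $0<p<\infty$, $S_p(H_1,H_2)$ is the set of compact $T$ with $\|T\|_{S_p}:=\big(\sum_k s_k(T)^p\big)^{1/p}<\infty$ (a quasinorm if $p<1$); $S_p(H)=S_p(H,H)$. Action on variables: a kernel $K(x,y)$ has $x\in\Omega_2$ and $y\in\Omega_1$. $(E_2)_xK$ denotes the function obtained by applying $E_2$ to $K(\cdot,y)\in L^2(\mu_2)$ for almost every $y$, and $(E_1)_yK$ the function obtained by applying $E_1$ to $K(x,\cdot)\in L^2(\mu_1)$ for almost every $x$; saying that such an expression belongs to a function space includes that it is well defined. *)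

(* Defs.v *)
From HB Require Import structures.
From mathcomp Require Import all_boot all_order all_algebra.
From mathcomp Require Import ring_quotient sesquilinear complex.
From mathcomp Require Import all_classical all_reals all_analysis measurable_realfun.
From mathcomp Require Import ring.

Set Implicit Arguments.
Unset Strict Implicit.
Unset Printing Implicit Defensive.

Import Order.TTheory GRing.Theory Num.Theory.
Import numFieldNormedType.Exports.
Import ComplexField.

Local Open Scope classical_set_scope.
Local Open Scope ring_scope.
Local Open Scope complex_scope.

Section complex_functions.
Context d (T : measurableType d) (R : realType).
Variable mu : {measure set T -> \bar R}.
Implicit Types f g : T -> R[i].

Definition cmeasurable f : Prop :=
  measurable_fun [set: T] (@complex.Re R \o f) /\
  measurable_fun [set: T] (@complex.Im R \o f).

Definition cabs f : T -> R := fun x => Normc.normc (f x).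

Definition cL2norm f : \bar R := 'N[mu]_(2%:E)[EFin \o cabs f].

Definition memL2 f : Prop := cmeasurable f /\ (cL2norm f < +oo)%E.

Definition cintegral f : R[i] :=
  (\int[mu]_x complex.Re (f x)) +i* (\int[mu]_x complex.Im (f x)).

Lemma cabsE f x : cabs f x ^+ 2 = complex.Re (f x) ^+ 2 + complex.Im (f x) ^+ 2.
Proof.
by rewrite /cabs; case: (f x) => a b /=; rewrite sqr_sqrtr// addr_ge0// sqr_ge0.
Qed.

Lemma cabs_ge0 f x : 0 <= cabs f x.
Proof. by rewrite /cabs; case: (f x) => a b /=; rewrite sqrtr_ge0. Qed.

Lemma measurable_cabs f : cmeasurable f -> measurable_fun [set: T] (cabs f).
Proof.
move=> [mr mi].
rewrite (_ : cabs f = @Num.sqrt R \o (((@complex.Re R \o f) \* (@complex.Re R \o f)) \+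
    ((@complex.Im R \o f) \* (@complex.Im R \o f)))); last first.
  by apply/funext => x; rewrite /cabs /=; case: (f x) => a b /=; rewrite !expr2.
apply: measurableT_comp.
  by apply: continuous_measurable_fun; exact: sqrt_continuous.
by apply: measurable_funD; apply: measurable_funM.
Qed.

Lemma cabs_Lfun f : memL2 f -> cabs f \in Lfun mu 2%:E.
Proof.
by move=> [mf nf]; rewrite inE; apply/andP; split; rewrite inE//=;
  exact: measurable_cabs.
Qed.

Lemma le_Lfun2 (f g : T -> R) : measurable_fun [set: T] f ->
  (forall x, `|f x| <= `|g x|) -> g \in Lfun mu 2%:E -> f \in Lfun mu 2%:E.
Proof.
move=> mf fg /[dup] gL.
rewrite inE => /andP[/[!inE]/= mg gfin]; apply/andP; split; rewrite inE//=.
apply: le_lt_trans gfin; rewrite unlock /=.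
apply: gt0_ler_poweR; rewrite ?invr_ge0//.
- by rewrite in_itv/= leey andbT integral_ge0.
- by rewrite in_itv/= leey andbT integral_ge0.
apply: ge0_le_integral => //.
- apply/measurable_EFinP.
  apply: (measurableT_comp (measurable_powR _)) => //.
  exact: measurableT_comp.
- apply/measurable_EFinP.
  apply: (measurableT_comp (measurable_powR _)) => //.
  exact: measurableT_comp.
- by move=> x _; rewrite lee_fin ge0_ler_powR.
Qed.

Lemma normr_Re_cabs f x : `|complex.Re (f x)| <= cabs f x.
Proof.
rewrite -(@ler_pXn2r _ 2)// ?nnegrE ?cabs_ge0//.
by rewrite cabsE real_normK ?num_real// lerDl sqr_ge0.
Qed.

Lemma normr_Im_cabs f x : `|complex.Im (f x)| <= cabs f x.
Proof.
rewrite -(@ler_pXn2r _ 2)// ?nnegrE ?cabs_ge0//.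
by rewrite cabsE real_normK ?num_real// lerDr sqr_ge0.
Qed.

Lemma memL2P f : memL2 f <->
  ((@complex.Re R \o f) \in Lfun mu 2%:E) /\ ((@complex.Im R \o f) \in Lfun mu 2%:E).
Proof.
split.
  move=> /[dup] fL [[mr mi] nf]; split; apply: (le_Lfun2 _ _ (cabs_Lfun fL)) => // x.
    by rewrite [leRHS]ger0_norm ?cabs_ge0//; exact: normr_Re_cabs.
  by rewrite [leRHS]ger0_norm ?cabs_ge0//; exact: normr_Im_cabs.
move=> [rL iL].
have mf : cmeasurable f.
  by split; [move: rL|move: iL]; rewrite inE => /andP[/[!inE]].
split => //.
have p1 : (1 <= 2%:E :> \bar R)%E by rewrite lee_fin ler1n.
have Labs (g : T -> R) : g \in Lfun mu 2%:E -> (fun x => `|g x|) \in Lfun mu 2%:E.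
  move=> gL; apply: (le_Lfun2 _ _ gL) => [|x]; last by rewrite normr_id.
  move: gL; rewrite inE => /andP[/[!inE]/= mg _].
  exact: measurableT_comp.
suff : cabs f \in Lfun mu 2%:E by rewrite inE => /andP[_ /[!inE]].
have [_ /(_ _ _ (Labs _ rL) (Labs _ iL)) sL] := @Lfun_addr_closed _ _ _ mu _ p1.
apply: (le_Lfun2 _ _ sL) => [|x]; first exact: measurable_cabs.
rewrite ger0_norm ?cabs_ge0// ger0_norm ?addr_ge0//=.
rewrite -(@ler_pXn2r _ 2)// ?nnegrE ?cabs_ge0 ?addr_ge0//.
rewrite cabsE sqrrD !real_normK ?num_real// lerD2r lerDl.
by rewrite mulrn_wge0// mulr_ge0.
Qed.

Lemma ReD (u v : R[i]) : complex.Re (u + v) = complex.Re u + complex.Re v.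
Proof. by case: u v => [a b] [c e]. Qed.
Lemma ImD (u v : R[i]) : complex.Im (u + v) = complex.Im u + complex.Im v.
Proof. by case: u v => [a b] [c e]. Qed.
Lemma ReM (u v : R[i]) : complex.Re (u * v) =
  complex.Re u * complex.Re v - complex.Im u * complex.Im v.
Proof. by case: u v => [a b] [c e]. Qed.
Lemma ImM (u v : R[i]) : complex.Im (u * v) =
  complex.Re u * complex.Im v + complex.Im u * complex.Re v.
Proof. by case: u v => [a b] [c e]. Qed.
Lemma ReC (u : R[i]) : complex.Re (Num.conj u) = complex.Re u.
Proof. by case: u. Qed.
Lemma ImC (u : R[i]) : complex.Im (Num.conj u) = - complex.Im u.
Proof. by case: u. Qed.

Definition L2pred : {pred T -> R[i]} := mem [set f | memL2 f].

Lemma L2pred_submod_closed : submod_closed L2pred.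
Proof.
have p1 : (1 <= 2%:E :> \bar R)%E by rewrite lee_fin ler1n.
have [L0 LD] := @Lfun_submod_closed _ _ _ mu _ p1.
split.
  by rewrite inE /=; apply/memL2P; split; rewrite (_ : _ \o _ = 0).
move=> a f g; rewrite !inE /= => /memL2P[fr fi] /memL2P[gr gi].
apply/memL2P; split.
  rewrite (_ : _ \o _ = complex.Re a *: (@complex.Re R \o f) +
     ((- complex.Im a) *: (@complex.Im R \o f) + (@complex.Re R \o g))).
    by apply: (LD) => //; exact: (LD).
  by apply/funext => x /=; rewrite ReD ReM -addrA -mulNr.
rewrite (_ : _ \o _ = complex.Re a *: (@complex.Im R \o f) +
     (complex.Im a *: (@complex.Re R \o f) + (@complex.Im R \o g))).
  by apply: (LD) => //; exact: (LD).
by apply/funext => x /=; rewrite ImD ImM -addrA.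
Qed.

End complex_functions.

Section L2fun.
Context d (T : measurableType d) (R : realType).
Variable mu : {measure set T -> \bar R}.

HB.instance Definition _ := GRing.isSubmodClosed.Build _ _ (L2pred mu)
  (L2pred_submod_closed mu).

Record L2fun := MkL2fun { L2fun_val :> T -> R[i]; _ : L2fun_val \in L2pred mu }.

HB.instance Definition _ := [isSub for L2fun_val].
HB.instance Definition _ := [Choice of L2fun by <:].
HB.instance Definition _ := [SubChoice_isSubLmodule of L2fun by <:].

Lemma L2funP (f : L2fun) : memL2 mu f.
Proof. by case: f => f /= /[!inE]. Qed.

Definition L2null : {pred L2fun} := mem [set f : L2fun | f = 0 %[ae mu]].

Lemma L2null_zmod_closed : zmod_closed L2null.
Proof.
split; first by rewrite inE /=; exact/aeW.
move=> f g /[!inE] /= f0 g0.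
by apply: filterS2 f0 g0 => x /(_ I) + /(_ I); rewrite /= => fx gx _ /=;
  rewrite !fctE /= fx gx subrr.
Qed.
HB.instance Definition _ := GRing.isZmodClosed.Build _ L2null L2null_zmod_closed.

Definition L2 : Type := @Quotient.quot L2fun L2null.
HB.instance Definition _ := GRing.Zmodule.on L2.
HB.instance Definition _ := EqQuotient.on L2.

Definition fun_of_L2 (u : L2) : T -> R[i] := repr u.
Coercion fun_of_L2 : L2 >-> Funclass.

Local Open Scope quotient_scope.

Lemma L2_eqP (f g : L2fun) :
  \pi_L2 f = \pi_L2 g <-> (f : T -> R[i]) = g %[ae mu].
Proof.
split.
  move/eqP; rewrite -Quotient.idealrBE inE /=.
  apply: filterS => x /(_ I); rewrite fctE => fg _.
  by apply/eqP; rewrite -subr_eq0; apply/eqP.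
move=> fg; apply/eqP; rewrite -Quotient.idealrBE inE /=.
by apply: filterS fg => x /(_ I) fg _; rewrite fctE fg subrr.
Qed.

Lemma reprL2 (f : L2fun) : fun_of_L2 (\pi_L2 f) = f %[ae mu].
Proof. by apply/L2_eqP; rewrite reprK. Qed.

Lemma L2_piD (f g : L2fun) : \pi_L2 (f + g) = \pi_L2 f + \pi_L2 g.
Proof. exact: Quotient.pi_add. Qed.

Lemma L2_pi0 : \pi_L2 0 = 0.
Proof. by apply: (addrI (\pi_L2 0)); rewrite -L2_piD !addr0. Qed.

Definition L2scale (a : R[i]) (u : L2) : L2 := \pi_L2 (a *: (repr u : L2fun)).

Lemma L2_piZ a (f : L2fun) : \pi_L2 (a *: f) = L2scale a (\pi_L2 f).
Proof.
apply/L2_eqP; apply: filterS (reprL2 f) => x /(_ I) fx _.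
by rewrite /= -[LHS]/(a * f x) -[RHS]/(a * fun_of_L2 (\pi_L2 f) x) fx.
Qed.

Lemma L2_surj (u : L2) : {f : L2fun | u = \pi_L2 f}.
Proof. by exists (repr u); rewrite reprK. Qed.

Fact L2scaleA a b u : L2scale a (L2scale b u) = L2scale (a * b) u.
Proof. by have [f ->] := L2_surj u; rewrite -!L2_piZ scalerA. Qed.

Fact L2scale1 : left_id 1 L2scale.
Proof. by move=> u; have [f ->] := L2_surj u; rewrite -!L2_piZ scale1r. Qed.

Fact L2scaleDr : right_distributive L2scale +%R.
Proof.
move=> a u v; have [f ->] := L2_surj u; have [g ->] := L2_surj v.
by rewrite -L2_piD -!L2_piZ -L2_piD scalerDr.
Qed.

Fact L2scaleDl u : {morph L2scale^~ u : a b / a + b}.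
Proof.
by move=> a b; have [f ->] := L2_surj u; rewrite -!L2_piZ -L2_piD scalerDl.
Qed.

HB.instance Definition _ := GRing.Zmodule_isLmodule.Build R[i] L2
  L2scaleA L2scale1 L2scaleDr L2scaleDl.

Lemma L2memP (u : L2) : memL2 mu u.
Proof. exact: L2funP. Qed.

Lemma L2_aeP (u v : L2) : u = v <-> (u : T -> R[i]) = v %[ae mu].
Proof. by rewrite -L2_eqP !reprK. Qed.

Lemma L2_ae0 : fun_of_L2 0 = (fun=> 0) %[ae mu].
Proof. by rewrite -L2_pi0; exact: reprL2. Qed.

Lemma L2_aeD (u v : L2) : fun_of_L2 (u + v) = (fun x => u x + v x) %[ae mu].
Proof.
have [f ->] := L2_surj u; have [g ->] := L2_surj v; rewrite -L2_piD.
apply: filterS3 (reprL2 (f + g)) (reprL2 f) (reprL2 g).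
by move=> x /(_ I) -> /(_ I) -> /(_ I) ->.
Qed.

Lemma L2_aeZ a (u : L2) : fun_of_L2 (a *: u) = (fun x => a * u x) %[ae mu].
Proof. exact: reprL2. Qed.

(* The class of [f]; the value 0 when [f] is not square integrable is junk. *)
Definition toL2 (f : T -> R[i]) : L2 :=
  if insub f : option L2fun is Some g then \pi_L2 g else 0.

Lemma toL2E f : memL2 mu f -> (toL2 f : T -> R[i]) = f %[ae mu].
Proof.
move=> fL; have fP : f \in L2pred mu by rewrite inE.
by rewrite /toL2 insubT; exact: reprL2.
Qed.

Lemma toL2K (u : L2) : toL2 u = u.
Proof. by apply/L2_aeP/toL2E/L2memP. Qed.

Lemma eq_toL2 f g : memL2 mu f -> memL2 mu g ->
  toL2 f = toL2 g <-> f = g %[ae mu].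
Proof.
move=> fL gL; rewrite L2_aeP; move: (toL2E fL) (toL2E gL) => ef eg; split => h.
  by apply: filterS3 ef eg h => x /(_ I) <- /(_ I) <- /(_ I) <-.
by apply: filterS3 ef eg h => x /(_ I) -> /(_ I) -> /(_ I) ->.
Qed.

End L2fun.

Section complex_integral.
Context d (T : measurableType d) (R : realType).
Variable mu : {measure set T -> \bar R}.
Implicit Types f g : T -> R[i].

Definition cintegrable f : Prop :=
  mu.-integrable [set: T] (EFin \o (@complex.Re R \o f)) /\
  mu.-integrable [set: T] (EFin \o (@complex.Im R \o f)).

Lemma cintegral_linear a f g : cintegrable f -> cintegrable g ->
  cintegral mu (fun x => a * f x + g x) = a * cintegral mu f + cintegral mu g.
Proof.
move=> [fr fi] [gr gi]; rewrite /cintegral.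
have intZ (k : R) (h : T -> R) : mu.-integrable setT (EFin \o h) ->
    mu.-integrable setT (EFin \o (fun x => k * h x)).
  move=> ih; apply: (eq_integrable _ (fun x => k%:E * (EFin \o h) x)%E) => //.
  exact: integrableZl.
have intD (h k : T -> R) : mu.-integrable setT (EFin \o h) ->
    mu.-integrable setT (EFin \o k) ->
    mu.-integrable setT (EFin \o (fun x => h x + k x)).
  move=> ih ik; apply: (eq_integrable _ ((EFin \o h) \+ (EFin \o k))%E) => //.
  exact: integrableD.
rewrite (@eq_Rintegral _ _ _ _ _ (fun x =>
   complex.Re a * complex.Re (f x) +
   (- complex.Im a * complex.Im (f x) + complex.Re (g x)))); last first.
  by move=> x _; rewrite ReD ReM -addrA -mulNr.
rewrite [X in _ +i* X = _](@eq_Rintegral _ _ _ _ _ (fun x =>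
   complex.Re a * complex.Im (f x) +
   (complex.Im a * complex.Re (f x) + complex.Im (g x)))); last first.
  by move=> x _; rewrite ImD ImM -addrA.
rewrite (@RintegralD _ _ _ mu _ (fun x => complex.Re a * complex.Re (f x))
  (fun x => - complex.Im a * complex.Im (f x) + complex.Re (g x)))//; last 2 first.
- exact: (intZ _ (@complex.Re R \o f)).
- by apply: (intD (fun x => _ * complex.Im (f x)) (@complex.Re R \o g)) => //;
    exact: (intZ _ (@complex.Im R \o f)).
rewrite (@RintegralD _ _ _ mu _ (fun x => complex.Re a * complex.Im (f x))
  (fun x => complex.Im a * complex.Re (f x) + complex.Im (g x)))//; last 2 first.
- exact: (intZ _ (@complex.Im R \o f)).
- by apply: (intD (fun x => _ * complex.Re (f x)) (@complex.Im R \o g)) => //;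
    exact: (intZ _ (@complex.Re R \o f)).
rewrite (@RintegralD _ _ _ mu _ (fun x => - complex.Im a * complex.Im (f x))
  (fun x => complex.Re (g x)))//; last first.
  exact: (intZ _ (@complex.Im R \o f)).
rewrite (@RintegralD _ _ _ mu _ (fun x => complex.Im a * complex.Re (f x))
  (fun x => complex.Im (g x)))//; last first.
  exact: (intZ _ (@complex.Re R \o f)).
rewrite !RintegralZl//.
case: a => a b /=.
by rewrite -[RHS]/((_ - _ + _) +i* (_ + _ + _)) -!addrA mulNr.
Qed.

Lemma ae_eq_cintegral f g : cmeasurable f -> cmeasurable g ->
  f = g %[ae mu] -> cintegral mu f = cintegral mu g.
Proof.
move=> [fr fi] [gr gi] fg; rewrite /cintegral /Rintegral.
congr (fine _ +i* fine _); apply: ae_eq_integral => //.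
- exact/measurable_EFinP.
- exact/measurable_EFinP.
- by apply: filterS fg => x /(_ I) -> _.
- exact/measurable_EFinP.
- exact/measurable_EFinP.
- by apply: filterS fg => x /(_ I) -> _.
Qed.

Lemma memL2_mul_conj f g : memL2 mu f -> memL2 mu g ->
  cintegrable (fun x => f x * Num.conj (g x)).
Proof.
move=> /memL2P[fr fi] /memL2P[gr gi].
have [L0 LD] := @Lfun_submod_closed _ _ _ mu 1%E (lexx _).
have rr := Lfun2_mul_Lfun1 fr gr; have ii := Lfun2_mul_Lfun1 fi gi.
have ri := Lfun2_mul_Lfun1 fr gi; have ir := Lfun2_mul_Lfun1 fi gr.
split; apply/Lfun1_integrable.
  rewrite (_ : _ \o _ = 1 *: ((@complex.Re R \o f) \* (@complex.Re R \o g)) +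
      ((@complex.Im R \o f) \* (@complex.Im R \o g))); first exact: (LD).
  apply/funext => x.
  by rewrite /= scale1r ReM ReC ImC mulrN opprK.
rewrite (_ : _ \o _ = (-1) *: ((@complex.Re R \o f) \* (@complex.Im R \o g)) +
    ((@complex.Im R \o f) \* (@complex.Re R \o g))); first exact: (LD).
apply/funext => x.
by rewrite /= scaleN1r ImM ReC ImC mulrN.
Qed.

Lemma cintegrable_measurable f : cintegrable f -> cmeasurable f.
Proof.
by move=> [/measurable_int/measurable_EFinP ? /measurable_int/measurable_EFinP ?].
Qed.

Lemma cL2norm_sqr f : memL2 mu f ->
  cintegral mu (fun x => f x * Num.conj (f x)) = (fine (cL2norm mu f) ^+ 2)%:C.
Proof.
move=> fL; rewrite /cintegral.
have -> : \int[mu]_x complex.Im (f x * Num.conj (f x)) = 0.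
  rewrite (@eq_Rintegral _ _ _ _ _ (fun x => 0)).
    by rewrite /Rintegral integral0.
  move=> x _.
  by rewrite ImM ReC ImC mulrN mulrC addNr.
congr (_ +i* _); rewrite /Rintegral.
rewrite -powR_mulrn ?fine_ge0 ?Lnorm_ge0// -fine_poweR.
rewrite /cL2norm powR_Lnorm//; congr fine; apply: eq_integral => x _.
rewrite [RHS]/= ger0_norm ?cabs_ge0// powR_mulrn ?cabs_ge0// cabsE.
by rewrite ReM ReC ImC mulrN opprK !expr2.
Qed.

End complex_integral.

Section L2_inner.
Context d (T : measurableType d) (R : realType).
Variable mu : {measure set T -> \bar R}.
Implicit Types u v w : L2 mu.

Definition L2dot u v : R[i] := cintegral mu (fun x => u x * Num.conj (v x)).

Definition L2norm u : R[i] := (fine (cL2norm mu u))%:C.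

Lemma L2dot_linear w a u v : L2dot (a *: u + v) w = a * L2dot u w + L2dot v w.
Proof.
rewrite /L2dot -cintegral_linear; try by apply: memL2_mul_conj; exact: L2memP.
apply: ae_eq_cintegral.
- by apply/cintegrable_measurable/memL2_mul_conj; exact: L2memP.
- rewrite (_ : (fun x => _) = (fun x => (a * u x + v x) * Num.conj (w x))); last first.
    by apply/funext => x; rewrite mulrDl mulrA.
  apply/cintegrable_measurable.
  exact: (memL2_mul_conj (L2funP (a *: (repr u : L2fun mu) + repr v)) (L2memP w)).
- apply: filterS3 (L2_aeD (a *: u) v) (L2_aeZ a u) (aeW _ (fun=> I)).
  by move=> x /(_ I) -> /(_ I) -> _ _; rewrite mulrDl mulrA.
Qed.

Lemma L2dotC u v : L2dot u v = Num.conj (L2dot v u).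
Proof.
have vuL := memL2_mul_conj (L2memP v) (L2memP u).
rewrite /L2dot /cintegral.
rewrite -[RHS]/(_ +i* - _); congr (_ +i* _).
  by apply: eq_Rintegral => x _; rewrite !ReM !ReC !ImC; ring.
rewrite -mulN1r -RintegralZl//; last by have [] := vuL.
by apply: eq_Rintegral => x _; rewrite !ImM !ReC !ImC; ring.
Qed.

Lemma L2dot_norm u : L2dot u u = L2norm u ^+ 2.
Proof.
by rewrite /L2dot cL2norm_sqr; [rewrite /L2norm -rmorphXn | exact: L2memP].
Qed.

Lemma L2norm_fin u : ((fine (cL2norm mu u))%:E = cL2norm mu u)%E.
Proof.
by rewrite fineK// ge0_fin_numE ?Lnorm_ge0//; have [] := L2memP u.
Qed.

Lemma L2norm0_eq0 u : L2norm u = 0 -> u = 0.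
Proof.
move=> /(congr1 (@complex.Re R)) /= n0.
have := L2norm_fin u; rewrite n0 => /esym u0.
have [mu_ _] := L2memP u.
have mc : measurable_fun [set: T] (EFin \o cabs u).
  by apply/measurable_EFinP; exact: measurable_cabs.
have := Lnorm_eq0_eq0 mc _ u0; rewrite lte_fin => /(_ (ltr0n _ 2)).
move=> uae; apply/L2_aeP.
apply: filterS2 uae (L2_ae0 mu) => x /(_ I) + /(_ I) -> _.
by rewrite /= => -[/Normc.eq0_normc].
Qed.

Fact L2dot_zmod_morphisml v : zmod_morphism (L2dot^~ v).
Proof.
move=> u w; rewrite addrC -scaleN1r L2dot_linear.
by rewrite mulN1r addrC.
Qed.

Fact L2dot_scalel v : scalable_for *%R (L2dot^~ v).
Proof.
have d0 : L2dot 0 v = 0.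
  by rewrite -[X in L2dot X _](subrr 0) L2dot_zmod_morphisml subrr.
by move=> a u; rewrite -[a *: u]addr0 L2dot_linear d0 addr0.
Qed.

Fact L2dot_zmod_morphismr u : zmod_morphism (L2dot u).
Proof.
by move=> v w; rewrite [LHS]L2dotC L2dot_zmod_morphisml rmorphB
  [L2dot u v]L2dotC [L2dot u w]L2dotC.
Qed.

Fact L2dot_scaler u : scalable_for (Num.conj \; *%R) (L2dot u).
Proof. by move=> a v; rewrite [LHS]L2dotC L2dot_scalel rmorphM [L2dot u v]L2dotC. Qed.

HB.instance Definition _ := isBilinear.Build R[i] (L2 mu) (L2 mu) R[i]
  *%R (Num.conj \; *%R) L2dot
  L2dot_zmod_morphisml L2dot_zmod_morphismr L2dot_scalel L2dot_scaler.

Fact L2dot_hermitian u v : L2dot u v = (-1) ^+ false * Num.conj (L2dot v u).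
Proof. by rewrite expr0 mul1r; exact: L2dotC. Qed.

HB.instance Definition _ := isHermitianSesquilinear.Build R[i] (L2 mu)
  false Num.conj L2dot L2dot_hermitian.

Fact L2dot_gt0 u : u != 0 -> 0 < L2dot u u.
Proof.
move=> u0; rewrite L2dot_norm exprn_gt0// lt_neqAle lecR fine_ge0 ?Lnorm_ge0//.
by rewrite andbT eq_sym; apply: contra u0 => /eqP/L2norm0_eq0 ->.
Qed.

HB.instance Definition _ := isDotProduct.Build R[i] (L2 mu) L2dot L2dot_gt0.

Lemma L2norm_ge0 u : 0 <= L2norm u.
Proof. by rewrite lecR fine_ge0// Lnorm_ge0. Qed.

Lemma L2normZ a u : L2norm (a *: u) = `|a| * L2norm u.
Proof.
apply/eqP; rewrite -(@eqrXn2 _ 2)// ?mulr_ge0 ?L2norm_ge0//.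
by rewrite exprMn -!L2dot_norm L2dot_scalel L2dot_scaler mulrA normCK.
Qed.

Lemma ler_L2normD u v : L2norm (u + v) <= L2norm u + L2norm v.
Proof.
rewrite -rmorphD lecR -lee_fin EFinD !L2norm_fin.
have [[mfu _] [mfv _]] := (L2memP u, L2memP v); have [mfuv _] := L2memP (u + v).
have p1 : (1 <= 2%:E :> \bar R)%E by rewrite lee_fin ler1n.
have mu' := measurable_cabs mfu; have mv' := measurable_cabs mfv.
apply: le_trans (eminkowski mu mu' mv' p1).
rewrite /cL2norm unlock /=; apply: gt0_ler_poweR; rewrite ?invr_ge0//.
- by rewrite in_itv/= leey andbT integral_ge0.
- by rewrite in_itv/= leey andbT integral_ge0.
apply: ae_ge0_le_integral => //.
- apply/measurable_EFinP.
  apply: (measurableT_comp (measurable_powR _)) => //.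
  exact/measurableT_comp/measurable_cabs.
- apply/measurable_EFinP.
  apply: (measurableT_comp (measurable_powR _)) => //.
  exact/measurableT_comp/measurable_funD.
- apply: filterS (L2_aeD u v) => x /(_ I) uvx _.
  rewrite lee_fin ge0_ler_powR// ger0_norm ?cabs_ge0// ger0_norm ?addr_ge0 ?cabs_ge0//.
  by rewrite /cabs uvx; exact: le_normcD.
Qed.

HB.instance Definition _ := Lmodule_isNormed.Build R[i] (L2 mu)
  ler_L2normD L2normZ L2norm0_eq0.

Lemma L2dot_normr u : L2dot u u = `|u| ^+ 2.
Proof. exact: L2dot_norm. Qed.
End L2_inner.

HB.mixin Record NormedModule_isPreHilbert (R : realType) H
    & NormedModule R[i] H := {
  inner : {dot H for @Num.conj R[i]} ;
  inner_normr : forall u : H, inner u u = `|u| ^+ 2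
}.

(* Completeness is not part of the structure: none of the definitions below
   depends on it, and they are only used on the spaces [L2 mu]. *)
#[short(type="preHilbertType")]
HB.structure Definition PreHilbert (R : realType) :=
  {H of NormedModule R[i] H & NormedModule_isPreHilbert R H}.

HB.instance Definition _ d (T : measurableType d) (R : realType)
    (mu : {measure set T -> \bar R}) :=
  NormedModule_isPreHilbert.Build R (L2 mu) (@L2dot_normr _ _ _ mu).

Section bounded_operators.
Context (R : realType) (H1 H2 : normedModType R[i]).

Definition bounded_operator (T : H1 -> H2) : Prop :=
  linear T /\ exists M : R[i], forall u, `|T u| <= M * `|u|.

Definition compact_operator (T : H1 -> H2) : Prop :=
  linear T /\ precompact (T @` [set u | `|u| <= 1]).

End bounded_operators.

Section singular_values.
Context (R : realType) (H1 H2 : preHilbertType R).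

Definition is_adjoint (T : H1 -> H2) (S : H2 -> H1) : Prop :=
  forall u v, inner (T u) v = inner u (S v).

Definition positive_operator (P : H1 -> H1) : Prop :=
  bounded_operator P /\ forall u, 0 <= inner (P u) u.

Definition is_modulus (T : H1 -> H2) (P : H1 -> H1) : Prop :=
  positive_operator P /\
  exists2 S : H2 -> H1, is_adjoint T S & forall u, P (P u) = S (T u).

Definition eigenspace (P : H1 -> H1) (l : R) : set H1 :=
  [set u | P u = l%:C *: u].

Definition has_dim (V : set H1) (n : nat) : Prop :=
  exists e : 'I_n -> H1,
    [/\ forall i, V (e i),
        forall c : 'I_n -> R[i], \sum_i c i *: e i = 0 -> forall i, c i = 0
      & forall u, V u -> exists c : 'I_n -> R[i], u = \sum_i c i *: e i].

(* [s k] is the (k+1)-st singular value. Every eigenvalue [l > 0] of |T| occurs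
   in [s] as many times as its multiplicity; the remaining terms, if any, are
   zero. *)
Definition is_singular_values (T : H1 -> H2) (s : nat -> R) : Prop :=
  exists2 P : H1 -> H1, is_modulus T P &
    [/\ nonincreasing_seq s, forall k, 0 <= s k &
        forall l, 0 < l -> exists2 n : nat,
          ([set k | s k = l] #= `I_n)%card & has_dim (eigenspace P l) n].

Definition singular_values (T : H1 -> H2) : nat -> R :=
  xget (fun=> 0) [set s | is_singular_values T s].

Definition schatten_norm (p : R) (T : H1 -> H2) : \bar R :=
  ((\sum_(0 <= k <oo) (singular_values T k `^ p)%:E) `^ p^-1)%E.

(* The second clause always holds for a compact operator between Hilbert
   spaces; it excludes the default value of [singular_values]. *)
Definition schatten (p : R) (T : H1 -> H2) : Prop :=
  [/\ compact_operator T, exists s, is_singular_values T s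
    & (schatten_norm p T < +oo)%E].

End singular_values.

Section unbounded_operators.
Context (R : realType) (H : normedModType R[i]).

(* The values of [uop] outside [domain] are irrelevant. *)
Record unbounded_operator := UnboundedOperator {
  domain : set H ;
  uop :> H -> H ;
  domain0 : domain 0 ;
  domainP : forall (a : R[i]) u v, domain u -> domain v -> domain (a *: u + v) ;
  uop_linear : forall (a : R[i]) u v, domain u -> domain v ->
    uop (a *: u + v) = a *: uop u + uop v ;
  domain_dense : dense domain
}.

Definition uop_inv (E : unbounded_operator) (v : H) : H :=
  xget 0 [set u | domain E u /\ E u = v].

Definition invertible (E : unbounded_operator) : Prop :=
  set_bij (domain E) [set: H] E /\ bounded_operator (uop_inv E).

End unbounded_operators.

Section kernels.
Context d1 d2 (T1 : measurableType d1) (T2 : measurableType d2) (R : realType).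
Variable mu1 : {measure set T1 -> \bar R}.
Variable mu2 : {measure set T2 -> \bar R}.
Implicit Types K G : T2 * T1 -> R[i].

(* For K in L^2(mu2 x mu1) the function of x below is in L^2(mu2) (Tonelli and
   Cauchy-Schwarz), so the default value of [toL2] is not reached. *)
Definition integral_operator K (f : L2 mu1) : L2 mu2 :=
  toL2 mu2 (fun x => cintegral mu1 (fun y => K (x, y) * f y)).

(* [acts_x E2 K G]: (E2)_x K is well defined and represented by G; likewise
   [acts_y E1 K G] for (E1)_y K. *)
Definition acts_x (E2 : unbounded_operator (L2 mu2)) K G : Prop :=
  cmeasurable G /\
  \forall y \ae mu1,
    let Ky := fun x => K (x, y) in let Gy := fun x => G (x, y) in
    [/\ memL2 mu2 Ky, memL2 mu2 Gy, domain E2 (toL2 mu2 Ky)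
      & E2 (toL2 mu2 Ky) = toL2 mu2 Gy].

Definition acts_y (E1 : unbounded_operator (L2 mu1)) K G : Prop :=
  cmeasurable G /\
  \forall x \ae mu2,
    let Kx := fun y => K (x, y) in let Gx := fun y => G (x, y) in
    [/\ memL2 mu1 Kx, memL2 mu1 Gx, domain E1 (toL2 mu1 Kx)
      & E1 (toL2 mu1 Kx) = toL2 mu1 Gx].

End kernels.

Arguments integral_operator {d1 d2 T1 T2 R} mu1 mu2 K f.

(* Main.v *)
(* Write C = E2^-1, let J be complex conjugation, let A = J (E1^-1)^* J be the
   transpose of E1^-1 and B the integral operator whose kernel is the function
   obtained from K by E1 and E2. Applying E1 to K(x, .) factors T through A on the
   right, and applying E2 to K(., y) factors T through C on the left, so that T is
   B A, C B or C B A.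

   The inequality of Hoelder with constant 1 rests on two facts about a compact
   operator T and an orthonormal family g: if r <= 2 and the closed span of g
   contains the range of T^*, then |T|_r^r <= sum_n |T g_n|^r; if p >= 2, then
   sum_n |T g_n|^p <= |T|_p^p. Take for g the left singular vectors of Y: as
   Y^* g_n = s_n(Y) e_n, the first fact applied to (Y A)^* = A^* Y^* gives
   |Y A|_r^r <= sum_n s_n(Y)^r |A^* e_n|^r, and the numerical inequality of Hoelder
   together with the second fact for A^* conclude when p >= 2. For B the second
   fact with p = 2 is Bessel's inequality integrated over the other variable, and a
   factor A of small exponent p is replaced by N factors |A^*|^(1/N) with
   N p >= 2. *)
From mathcomp Require Import all_boot all_order all_algebra.
From mathcomp Require Import sesquilinear complex finmap.
From mathcomp Require Import all_classical all_reals all_analysis measurable_realfun.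
From mathcomp Require Import ring lra.

Set Implicit Arguments.
Unset Strict Implicit.
Unset Printing Implicit Defensive.

Import Order.TTheory GRing.Theory Num.Theory.
Import numFieldNormedType.Exports.
Import ComplexField.
Require Import Defs.

Local Open Scope classical_set_scope.
Local Open Scope ring_scope.
Local Open Scope complex_scope.

(** * Inner product spaces *)

(** The 1/2 in the exponents is the Hilbert-Schmidt exponent 2 of B. Hoelder's inequality is used in
    an asymmetric form: one factor enters through its singular values, with any exponent; the other
    only through a summing inequality over orthonormal families, with an exponent of at least 2; and
    the product must have exponent at most 2. Since B has exponent 2, every product formed satisfies
    the last condition. B takes the summing role in C B, and in B A after passing to adjoints. In C
    B A it is already spent on C B, so A must take that role with an exponent that may be small, and
    this forces the roots. The transpose of E1^-1 appears instead of its adjoint because a kernel is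
    integrated against f without conjugation. Singular values are defined by a choice among the
    sequences attached to some modulus: existence comes from repeatedly splitting off a vector at
    which the norm is attained, and both the modulus and the sequence must be shown unique before
    the chosen values can be computed. *)

Section complex_modulus.
Context {R : realType}.
Implicit Types z w : R[i].
Local Notation normc := (@Normc.normc R).

Lemma norm_normc z : `|z| = (normc z)%:C.
Proof. by []. Qed.

Lemma normc_ge0 z : 0 <= normc z.
Proof. by rewrite -lecR -norm_normc; exact: normr_ge0. Qed.

Lemma normc_real (a : R) : normc a%:C = `|a|.
Proof. by rewrite /= expr0n addr0 sqrtr_sqr. Qed.

Lemma mul_conj_normc z : z * Num.conj z = (normc z ^+ 2)%:C.
Proof. by rewrite -normCK norm_normc rmorphXn. Qed.

Lemma normc_conj z : normc (Num.conj z) = normc z.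
Proof. by apply: complexI; rewrite -!norm_normc norm_conjC. Qed.

Lemma conj_real (a : R) : Num.conj (a%:C) = a%:C.
Proof. by apply/conj_Creal; rewrite complex_real. Qed.

Lemma conj_mul z w : Num.conj (z * w) = Num.conj z * Num.conj w.
Proof. exact: rmorphM. Qed.

Lemma real_complex_eq0 (a : R) : (a%:C == 0) = (a == 0).
Proof. exact: (fmorph_eq0 (real_complex R)). Qed.

End complex_modulus.

Section inner_product.
Context {R : realType} {H : preHilbertType R}.
Implicit Types (u v w : H) (a : R[i]).
Local Notation normc := (@Normc.normc R).

Definition hnorm u : R := complex.Re `|u|.

Lemma hnormE u : `|u| = (hnorm u)%:C.
Proof. by rewrite /hnorm RRe_real// ger0_real. Qed.

Lemma hnorm_ge0 u : 0 <= hnorm u.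
Proof. by rewrite -lecR -hnormE; exact: normr_ge0. Qed.
Local Hint Resolve hnorm_ge0 : core.

Lemma hnorm_eq0 u : (hnorm u == 0) = (u == 0).
Proof.
apply/eqP/eqP => [u0|->]; last by rewrite /hnorm normr0.
by apply/normr0_eq0; rewrite hnormE u0.
Qed.

Lemma hnorm0 : hnorm 0 = 0.
Proof. by apply/eqP; rewrite hnorm_eq0. Qed.

Lemma hnormZ a u : hnorm (a *: u) = normc a * hnorm u.
Proof. by apply: complexI; rewrite rmorphM /= -norm_normc -!hnormE normrZ. Qed.

Lemma hnormZR (c : R) u : hnorm (c%:C *: u) = `|c| * hnorm u.
Proof. by rewrite hnormZ normc_real. Qed.

Lemma ler_hnormD u v : hnorm (u + v) <= hnorm u + hnorm v.
Proof. by rewrite -lecR rmorphD /= -!hnormE ler_normD. Qed.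

Lemma hnormN u : hnorm (- u) = hnorm u.
Proof. by rewrite /hnorm normrN. Qed.

Lemma hdistC u v : hnorm (u - v) = hnorm (v - u).
Proof. by rewrite -hnormN opprB. Qed.

Lemma ler_hdistD w u v : hnorm (u - v) <= hnorm (u - w) + hnorm (w - v).
Proof. by rewrite -[u - v](subrKA w) ler_hnormD. Qed.

Lemma ler_hnorm_dist u v : `|hnorm u - hnorm v| <= hnorm (u - v).
Proof.
rewrite ler_norml; apply/andP; split.
  by rewrite lerNl opprB lerBlDr hdistC -{1}(subrK u v) ler_hnormD.
by rewrite lerBlDr -{1}(subrK v u) ler_hnormD.
Qed.

Lemma innerDl u v w : inner (u + v) w = inner u w + inner v w.
Proof. by rewrite linearDl. Qed.

Lemma innerBl u v w : inner (u - v) w = inner u w - inner v w.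
Proof. by rewrite linearBl. Qed.

Lemma innerZl a u w : inner (a *: u) w = a * inner u w.
Proof. by rewrite linearZl_LR. Qed.

Lemma innerDr u v w : inner w (u + v) = inner w u + inner w v.
Proof. by rewrite linearDr. Qed.

Lemma innerBr u v w : inner w (u - v) = inner w u - inner w v.
Proof. by rewrite linearBr. Qed.

Lemma innerZr a u w : inner w (a *: u) = Num.conj a * inner w u.
Proof. by rewrite linearZr_LR. Qed.

Lemma inner0l w : inner 0 w = 0.
Proof. by rewrite linear0l. Qed.

Lemma inner0r w : inner w 0 = 0.
Proof. by rewrite linear0r. Qed.

Lemma innerC u v : inner u v = Num.conj (inner v u).
Proof. by rewrite hermC expr0 mul1r. Qed.

Lemma normc_innerC u v : normc (inner u v) = normc (inner v u).
Proof. by rewrite innerC normc_conj. Qed.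

Lemma inner_suml I (r : seq I) (P : pred I) (F : I -> H) w :
  inner (\sum_(i <- r | P i) F i) w = \sum_(i <- r | P i) inner (F i) w.
Proof. by rewrite linear_sumlz. Qed.

Lemma inner_sumr I (r : seq I) (P : pred I) (F : I -> H) w :
  inner w (\sum_(i <- r | P i) F i) = \sum_(i <- r | P i) inner w (F i).
Proof. by rewrite linear_sumr. Qed.

Lemma inner_hnorm u : inner u u = (hnorm u ^+ 2)%:C.
Proof. by rewrite inner_normr hnormE rmorphXn. Qed.

Lemma inner_ext u v : (forall w, inner u w = inner v w) -> u = v.
Proof.
move=> uv; apply/eqP; rewrite -subr_eq0 -hnorm_eq0 -sqrf_eq0.
by apply/eqP/complexI; rewrite -inner_hnorm innerBl uv subrr.
Qed.

Lemma hnormD_sqr u v : inner u v = 0 -> hnorm (u + v) ^+ 2 = hnorm u ^+ 2 + hnorm v ^+ 2.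
Proof.
move=> uv; apply: complexI; rewrite rmorphD /= -!inner_hnorm.
by rewrite innerDl !innerDr uv [inner v u]innerC uv conjC0 addr0 add0r.
Qed.

Lemma hnormB_sqr u v : hnorm (u - v) ^+ 2 =
  hnorm u ^+ 2 - complex.Re (inner u v) *+ 2 + hnorm v ^+ 2.
Proof.
rewrite -[LHS]/(complex.Re (_)%:C) -inner_hnorm innerBl !innerBr.
rewrite [inner v u]innerC !inner_hnorm; case: (inner u v) => a b /=; ring.
Qed.

(* Zero vectors are allowed in an orthonormal sequence, so that finite systems
   are sequences as well. *)
Definition orthoseq (e : nat -> H) : Prop :=
  (forall j k, j != k -> inner (e j) (e k) = 0) /\
  (forall k, e k = 0 \/ hnorm (e k) = 1).

(** Lets statements about sequences, such as Bessel's inequality, be applied to one vector. *)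
Definition single_seq u k : H := if k is 0%N then u else 0.

Lemma orthoseq_single u : u = 0 \/ hnorm u = 1 -> orthoseq (single_seq u).
Proof.
by move=> u1; split=> [[|j] [|k]//= _|[|k]]/=; rewrite ?inner0l ?inner0r//; left.
Qed.

Definition oproj (e : nat -> H) n u : H := \sum_(0 <= k < n) inner u (e k) *: e k.

Lemma orthoseq_le1 e k : orthoseq e -> hnorm (e k) <= 1.
Proof. by move=> [_ /(_ k)[->|->//]]; rewrite hnorm0. Qed.

Lemma inner_orthoseqK e u k : orthoseq e ->
  inner u (e k) * inner (e k) (e k) = inner u (e k).
Proof.
move=> [_ /(_ k)[->|ek]]; first by rewrite !inner0r mulr0.
by rewrite inner_hnorm ek expr1n mulr1.
Qed.

Lemma inner_ortho_sum e (c : nat -> R[i]) (r : seq nat) k : orthoseq e -> uniq r ->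
  inner (\sum_(i <- r) c i *: e i) (e k) =
  if k \in r then c k * inner (e k) (e k) else 0.
Proof.
move=> [oe _] ur; rewrite inner_suml; case: ifPn => kr.
  rewrite (bigD1_seq k)//= innerZl big1 ?addr0// => i ik.
  by rewrite innerZl oe ?mulr0.
rewrite big1_seq// => i /andP[_ ir]; rewrite innerZl oe ?mulr0//.
by apply: contraNneq kr => <-.
Qed.

Lemma inner_proj e n u k : orthoseq e ->
  inner (oproj e n u) (e k) = if (k < n)%N then inner u (e k) else 0.
Proof.
move=> oe; rewrite inner_ortho_sum ?iota_uniq// mem_index_iota/=.
by rewrite inner_orthoseqK.
Qed.

Lemma hnorm_ortho_sum e (c : nat -> R[i]) (r : seq nat) : orthoseq e -> uniq r ->
  hnorm (\sum_(i <- r) c i *: e i) ^+ 2 = \sum_(i <- r) (normc (c i) * hnorm (e i)) ^+ 2.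
Proof.
move=> oe ur; apply: complexI; rewrite -inner_hnorm inner_sumr rmorph_sum /=.
apply: eq_big_seq => i ir.
rewrite innerZr inner_ortho_sum// ir exprMn rmorphM /= -mul_conj_normc -inner_hnorm.
by rewrite mulrA [Num.conj _ * _]mulrC.
Qed.

Lemma normc_inner_orthoseqK e u k : orthoseq e ->
  normc (inner u (e k)) * hnorm (e k) = normc (inner u (e k)).
Proof.
move=> [_ /(_ k)[->|->]]; last by rewrite mulr1.
by rewrite inner0r hnorm0 mulr0 normc_real normr0.
Qed.

Lemma hnorm_ortho_coef e (d : nat -> R) (r : seq nat) u : orthoseq e -> uniq r ->
  hnorm (\sum_(i <- r) ((d i)%:C * inner u (e i)) *: e i) ^+ 2 =
  \sum_(i <- r) d i ^+ 2 * normc (inner u (e i)) ^+ 2.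
Proof.
move=> oe ur; rewrite hnorm_ortho_sum//; apply: eq_bigr => i _.
rewrite -exprMn; have := normc_inner_orthoseqK u i oe.
rewrite Normc.normcM normc_real => {2}<-.
rewrite !exprMn; by rewrite -normrX ger0_norm ?sqr_ge0// mulrA.
Qed.

Lemma hnorm_proj e n u : orthoseq e ->
  hnorm (oproj e n u) ^+ 2 = \sum_(0 <= k < n) normc (inner u (e k)) ^+ 2.
Proof.
move=> oe; rewrite /oproj hnorm_ortho_sum ?iota_uniq//.
by apply: eq_bigr => k _; rewrite normc_inner_orthoseqK.
Qed.

Lemma inner_proj_compl e n u : orthoseq e -> inner (u - oproj e n u) (oproj e n u) = 0.
Proof.
move=> oe; rewrite inner_sumr big1_seq// => k /andP[_].
rewrite mem_index_iota /= => kn.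
by rewrite innerZr innerBl inner_proj// kn subrr mulr0.
Qed.

Lemma hnorm_proj_compl e n u : orthoseq e ->
  hnorm (u - oproj e n u) ^+ 2 =
  hnorm u ^+ 2 - \sum_(0 <= k < n) normc (inner u (e k)) ^+ 2.
Proof.
move=> oe; have := hnormD_sqr (inner_proj_compl n u oe); rewrite subrK => ->.
by rewrite hnorm_proj// addrK.
Qed.

Lemma bessel e n u : orthoseq e ->
  \sum_(0 <= k < n) normc (inner u (e k)) ^+ 2 <= hnorm u ^+ 2.
Proof. by move=> oe; rewrite -subr_ge0 -hnorm_proj_compl// sqr_ge0. Qed.

Lemma ler_hnorm_proj_compl e n u : orthoseq e -> hnorm (u - oproj e n u) <= hnorm u.
Proof.
move=> oe; rewrite -(@ler_pXn2r _ 2)// ?nnegrE// hnorm_proj_compl//.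
by rewrite gerBl sumr_ge0// => k _; rewrite sqr_ge0.
Qed.

(** Bessel's inequality for the system consisting of v / |v| alone. *)
Lemma cauchy_schwarz u v : normc (inner u v) <= hnorm u * hnorm v.
Proof.
have [->|v0] := eqVneq v 0; first by rewrite inner0r hnorm0 mulr0 normc_real normr0.
have nv0 : 0 < hnorm v by rewrite lt_neqAle hnorm_ge0 eq_sym hnorm_eq0 v0.
have oe : orthoseq (single_seq (((hnorm v)^-1)%:C *: v)).
  by apply: orthoseq_single; right; rewrite hnormZR ger0_norm ?invr_ge0// mulVf// gt_eqF.
have := bessel 1 u oe; rewrite big_nat1 /= ler_pXn2r ?nnegrE ?normc_ge0//.
rewrite innerZr conj_real Normc.normcM normc_real ger0_norm ?invr_ge0//.
by rewrite ler_pdivrMl// mulrC.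
Qed.

Lemma Re_inner_le u v : complex.Re (inner u v) <= hnorm u * hnorm v.
Proof.
apply: le_trans (cauchy_schwarz u v); case: (inner u v) => a b /=.
apply: le_trans (ler_norm _) _.
by rewrite -[leLHS]sqrtr_sqr ler_wsqrtr// lerDl sqr_ge0.
Qed.

End inner_product.
#[export] Hint Extern 0 (is_true (@Order.le _ _ _ (hnorm _))) =>
  solve [exact: hnorm_ge0] : core.
#[export] Hint Extern 0 (is_true (@Order.le _ _ _ (Normc.normc _))) =>
  solve [exact: normc_ge0] : core.

(** * Linear maps, adjoints and compact operators *)

Section linear_maps.
Context {R : realType} {H1 H2 : preHilbertType R} (T : H1 -> H2).
Hypothesis lT : linear T.

Lemma linear_map0 : T 0 = 0.
Proof. by have := lT (-1) 0 0; rewrite scaler0 add0r scaleN1r addNr. Qed.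

Lemma linear_mapD u v : T (u + v) = T u + T v.
Proof. by have := lT 1 u v; rewrite !scale1r. Qed.

Lemma linear_mapZ a u : T (a *: u) = a *: T u.
Proof. by have := lT a u 0; rewrite !addr0 linear_map0 addr0. Qed.

Lemma linear_mapB u v : T (u - v) = T u - T v.
Proof. by rewrite linear_mapD -scaleN1r linear_mapZ scaleN1r. Qed.

Lemma linear_map_sum I (r : seq I) (F : I -> H1) :
  T (\sum_(i <- r) F i) = \sum_(i <- r) T (F i).
Proof. exact: (big_morph T linear_mapD linear_map0). Qed.

End linear_maps.

Section adjoints.
Context {R : realType} {H1 H2 : preHilbertType R}.
Implicit Types (T : H1 -> H2) (S : H2 -> H1).

Lemma is_adjointC T S : is_adjoint T S -> is_adjoint S T.
Proof. by move=> TS u v; rewrite innerC -TS -innerC. Qed.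

(** A vector is determined by its inner products, and those of [S v] are antilinear in [v] on the
    right. By symmetry of the relation this also yields linearity of [T], which is how limits of
    diagonal sums are seen to be linear. *)
Lemma adjoint_linear T S : is_adjoint T S -> linear S.
Proof.
move=> TS a u v; apply: inner_ext => w.
by rewrite innerDl innerZl !(is_adjointC TS) innerDl innerZl.
Qed.

(** Divide |S v|^2 = Re <T (S v), v> <= M |S v| |v| by |S v|. *)
Lemma adjoint_bound T S (M : R) : 0 <= M -> is_adjoint T S ->
  (forall u, hnorm (T u) <= M * hnorm u) -> forall v, hnorm (S v) <= M * hnorm v.
Proof.
move=> M0 TS TM v; have [->|Sv0] := eqVneq (S v) 0; first by rewrite hnorm0 mulr_ge0.
have Sv_gt0 : 0 < hnorm (S v) by rewrite lt_neqAle eq_sym hnorm_eq0 Sv0 hnorm_ge0.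
rewrite -(ler_pM2l Sv_gt0) -expr2.
have -> : hnorm (S v) ^+ 2 = complex.Re (inner (T (S v)) v) by rewrite TS inner_hnorm.
apply: le_trans (Re_inner_le _ _) _.
by rewrite [leRHS]mulrCA mulrA ler_wpM2r.
Qed.

End adjoints.

Lemma is_adjoint_comp {R : realType} {H1 H2 H3 : preHilbertType R}
    (T : H2 -> H3) (S : H3 -> H2) (T' : H1 -> H2) (S' : H2 -> H1) :
  is_adjoint T S -> is_adjoint T' S' -> is_adjoint (T \o T') (S' \o S).
Proof. by move=> TS TS' u v /=; rewrite TS TS'. Qed.

Section topology.
Context {R : realType} {H : preHilbertType R}.

(** The balls of the normed space have radii in [R[i]]; positivity of a radius forces it to be real,
    so real radii suffice. *)
Lemma hnorm_nbhsP (v : H) (A : set H) :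
  nbhs v A <-> exists2 eps : R, 0 < eps & forall u, hnorm (u - v) < eps -> A u.
Proof.
split=> [/nbhs_ballP[e /= e0 eA]|[eps e0 eA]].
  exists (complex.Re e); first by move: e0; rewrite ltcE /= => /andP[].
  move=> u uv; apply: eA; rewrite -ball_normE /= -normrN opprB hnormE.
  by move: e0 uv; case: (e) => a b; rewrite ltcE /= => /andP[/eqP-> _] uv; rewrite ltcR.
apply/nbhs_ballP; exists (eps%:C); first by rewrite /= ltcR.
move=> u; rewrite -ball_normE /= -normrN opprB hnormE ltcR; exact: eA.
Qed.

End topology.

Lemma hnorm_continuous {R : realType} {H1 H2 : preHilbertType R} (f : H1 -> H2) (M : R) :
  (forall u v, hnorm (f u - f v) <= M * hnorm (u - v)) -> continuous f.
Proof.
move=> fM v A /hnorm_nbhsP[e e0 eA]; apply/hnorm_nbhsP.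
have M1 : 0 < `|M| + 1 by rewrite ltr_wpDl.
exists (e / (`|M| + 1)); first by rewrite divr_gt0.
move=> u uv; apply: eA; apply: le_lt_trans (fM u v) _.
move: uv; rewrite ltr_pdivlMr// mulrC; apply: le_lt_trans.
by rewrite ler_wpM2r// (le_trans (ler_norm _))// lerDl.
Qed.

Lemma precompact_image {R : realType} {H1 H2 : preHilbertType R} (f : H1 -> H2) (A : set H1) :
  continuous f -> precompact A -> precompact (f @` A).
Proof.
move=> cf; rewrite precompactE => cA.
have cfA : compact (f @` closure A).
  by apply: continuous_compact => //; exact: continuous_subspaceT.
apply: (@precompact_subset _ _ (f @` closure A)); first exact/image_subset/subset_closure.
by rewrite precompact_closed//; apply: compact_closed => //; exact: norm_hausdorff.
Qed.

Section compact_operators.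
Context {R : realType} {H1 H2 : preHilbertType R}.
Implicit Types (T : H1 -> H2) (S : H2 -> H1).

(** A cluster point of the images, stated through indices beyond any [N]; it replaces the extraction
    of a convergent subsequence. *)
Lemma compact_operator_cluster T (x : nat -> H1) : compact_operator T ->
  (forall n, hnorm (x n) <= 1) ->
  exists v, forall (eps : R) N, 0 < eps ->
    exists2 n, (N <= n)%N & hnorm (T (x n) - v) < eps.
Proof.
move=> [lT]; rewrite precompactE => cT x1.
have [|v [_ clv]] := cT (fmap (T \o x) \oo) _.
  apply: (@nearW _ \oo) => n; apply: subset_closure => /=; exists (x n) => //=.
  by rewrite hnormE lecR.
exists v => eps N e0.
have [||u [[n /= Nn <-] h]] := clv [set T (x n) | n in [set n | (N <= n)%N]]
    [set u | hnorm (u - v) < eps].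
- by exists N => // n /= Nn; exists n.
- by apply/hnorm_nbhsP; exists eps.
- by exists n.
Qed.

Lemma compact_operator_bounded T : compact_operator T ->
  exists2 M : R, 0 <= M & forall u, hnorm (T u) <= M * hnorm u.
Proof.
move=> cT; have lT := cT.1.
suff [M M0 TM] : exists2 M : R, 0 <= M & forall u, hnorm u <= 1 -> hnorm (T u) <= M.
  exists M => // u; have [->|u0] := eqVneq u 0.
    by rewrite linear_map0// !hnorm0 mulr0.
  have nu0 : 0 < hnorm u by rewrite lt_neqAle hnorm_ge0 eq_sym hnorm_eq0 u0.
  have : hnorm (T (((hnorm u)^-1)%:C *: u)) <= M.
    by apply: TM; rewrite hnormZR ger0_norm ?invr_ge0// mulVf ?gt_eqF.
  by rewrite linear_mapZ// hnormZR ger0_norm ?invr_ge0// ler_pdivrMl// mulrC.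
apply: contrapT => nM.
have /choice[x xP] (n : nat) : exists u, hnorm u <= 1 /\ n%:R < hnorm (T u).
  apply: contrapT => nu; apply: nM; exists n%:R => // u u1.
  by rewrite leNgt; apply/negP => un; apply: nu; exists u.
have [v vP] := compact_operator_cluster cT (fun n => (xP n).1).
have [n Nn nv] := vP 1 (Num.truncn (hnorm v + 1)).+1 ltr01.
have := (xP n).2; apply/negP; rewrite -leNgt.
have vn : hnorm v + 1 <= n%:R.
  by apply/ltW; apply: lt_le_trans (truncnS_gt _) _; rewrite ler_nat.
apply: le_trans vn; rewrite -lerBlDl; apply: le_trans (ltW nv).
exact: le_trans (ler_norm _) (ler_hnorm_dist _ _).
Qed.

(** The norm t of T is attained. For x_n in the unit ball with |T x_n| close to t, S T x_n - t^2 x_n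
    tends to 0, so a cluster point v of T x_n satisfies T S v = t^2 v, and S v normalised is the
    vector sought. If t = 0 the vector is 0, in keeping with [orthoseq]. *)
Lemma compact_operator_extremal T S : compact_operator T -> is_adjoint T S ->
  exists (t : R) (e : H1), [/\ 0 <= t, S (T e) = (t ^+ 2)%:C *: e,
    forall u, hnorm (T u) <= t * hnorm u
    & (t = 0 /\ e = 0) \/ (0 < t /\ hnorm e = 1)].
Proof.
move=> cT TS; have lT := cT.1; have lS := adjoint_linear TS.
have [M M0 TM] := compact_operator_bounded cT.
pose A := [set hnorm (T u) | u in [set u | hnorm u <= 1]].
have hA : has_sup A.
  split; first by exists (hnorm (T 0)), 0 => //=; rewrite hnorm0.
  exists M => _ [u /= u1 <-]; apply: le_trans (TM u) _.
  by rewrite -[leRHS]mulr1 ler_wpM2l.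
pose t := sup A.
have t0 : 0 <= t.
  apply: (@le_trans _ _ (hnorm (T 0))); first exact: hnorm_ge0.
  by apply: ub_le_sup; [case: hA | exists 0 => //=; rewrite hnorm0].
have Tt u : hnorm (T u) <= t * hnorm u.
  have [->|u0] := eqVneq u 0; first by rewrite linear_map0// !hnorm0 mulr0.
  have nu0 : 0 < hnorm u by rewrite lt_neqAle hnorm_ge0 eq_sym hnorm_eq0 u0.
  have : hnorm (T (((hnorm u)^-1)%:C *: u)) <= t.
    apply: ub_le_sup; first by case: hA.
    exists (((hnorm u)^-1)%:C *: u) => //=.
    by rewrite hnormZR ger0_norm ?invr_ge0// mulVf ?gt_eqF.
  by rewrite linear_mapZ// hnormZR ger0_norm ?invr_ge0// ler_pdivrMl// mulrC.
have St v : hnorm (S v) <= t * hnorm v by exact: adjoint_bound v.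
exists t.
have [t00|tn0] := eqVneq t 0.
  exists 0; rewrite linear_map0// (linear_map0 lS) scaler0; split => //.
  by left.
have tgt0 : 0 < t by rewrite lt_neqAle eq_sym tn0.
have /choice[x xP] (n : nat) : exists u, hnorm u <= 1 /\ t - n.+1%:R^-1 < hnorm (T u).
  have [|_ [u /= u1 <-] tu] := @sup_adherent _ A n.+1%:R^-1 _ hA; last by exists u.
  by rewrite invr_gt0.
have [v vP] := compact_operator_cluster cT (fun n => (xP n).1).
(* [x n] is almost an eigenvector: |S T x - t^2 x|^2 <= t^2 (t^2 - |T x|^2). *)
have near_eigen n : hnorm (S (T (x n)) - (t ^+ 2)%:C *: x n) ^+ 2 <=
    2 * t ^+ 3 * n.+1%:R^-1.
  have [x1 xt] := xP n.
  rewrite hnormB_sqr hnormZR innerZr conj_real.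
  rewrite (is_adjointC TS) inner_hnorm -rmorphM /=.
  rewrite ger0_norm ?sqr_ge0//.
  have TxLe : hnorm (T (x n)) <= t by rewrite (le_trans (Tt _))// -[leRHS]mulr1 ler_wpM2l.
  have := St (T (x n)); move: x1 xt TxLe.
  have := hnorm_ge0 (S (T (x n))); have := hnorm_ge0 (T (x n)); have := hnorm_ge0 (x n).
  have : 0 < (n.+1%:R : R)^-1 by rewrite invr_gt0.
  move: (hnorm (S (T (x n)))) (hnorm (T (x n))) (hnorm (x n)) (n.+1%:R^-1).
  move=> b a c d d0 c0 a0 b0 c1 ad at1 bta.
  have b2 : b ^+ 2 <= t ^+ 2 * a ^+ 2 by rewrite -exprMn ler_pXn2r ?nnegrE ?mulr_ge0.
  have c2 : c ^+ 2 <= 1 by rewrite expr_le1.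
  have k2 : (t ^+ 2 * c) ^+ 2 <= t ^+ 4.
    by rewrite exprMn -exprM -[leRHS]mulr1 ler_wpM2l ?exprn_ge0.
  have k3 : t ^+ 2 * (t ^+ 2 - a ^+ 2) <= t ^+ 2 * (d * (2 * t)).
    rewrite ler_wpM2l ?sqr_ge0// subr_sqr ler_pM ?subr_ge0 ?addr_ge0//; lra.
  have -> : 2 * t ^+ 3 * d = t ^+ 2 * (d * (2 * t)) by ring.
  by apply: le_trans k3; move: b2 k2; rewrite mulrBr -mulr_natl; nra.
have TSv : T (S v) = (t ^+ 2)%:C *: v.
  apply/eqP; rewrite -subr_eq0 -hnorm_eq0 eq_le hnorm_ge0 andbT.
  apply/ler_addgt0Pr => eps e0; rewrite add0r.
  (* The three terms into which T S v - t^2 v is split below are bounded by t^2 c, t c and t^2 c. *)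
  pose c := eps / (t ^+ 2 + t ^+ 2 + t).
  have cp : 0 < t ^+ 2 + t ^+ 2 + t by rewrite addr_gt0// addr_gt0// exprn_gt0.
  have c0 : 0 < c by rewrite divr_gt0.
  have [n Nn nv] := vP c (Num.truncn (2 * t ^+ 3 / c ^+ 2)).+1 c0.
  have ne : hnorm (S (T (x n)) - (t ^+ 2)%:C *: x n) <= c.
    rewrite -(@ler_pXn2r _ 2)// ?nnegrE ?(ltW c0)// (le_trans (near_eigen n))// ltW//.
    rewrite ltr_pdivrMr// -ltr_pdivrMl ?exprn_gt0// mulrC.
    apply: lt_le_trans (truncnS_gt _) _; rewrite ler_nat.
    exact: leq_trans Nn (leqnSn n).
  have -> : T (S v) - (t ^+ 2)%:C *: v =
     T (S (v - T (x n))) + (T (S (T (x n)) - (t ^+ 2)%:C *: x n) +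
       (t ^+ 2)%:C *: (T (x n) - v)).
    rewrite (linear_mapB lS) !(linear_mapB lT) (linear_mapZ lT) scalerBr.
    by rewrite !subrKA.
  apply: le_trans (ler_hnormD _ _) _.
  have -> : eps = t ^+ 2 * c + (t * c + t ^+ 2 * c).
    by rewrite /c; field; rewrite gt_eqF.
  apply: lerD.
    apply: le_trans (Tt _) _; rewrite expr2 -mulrA ler_wpM2l// (le_trans (St _))//.
    by rewrite ler_wpM2l// hdistC ltW.
  apply: le_trans (ler_hnormD _ _) _; apply: lerD.
    by apply: le_trans (Tt _) _; rewrite ler_wpM2l.
  by rewrite hnormZR ger0_norm ?sqr_ge0// ler_wpM2l ?sqr_ge0// ltW.
(* For a suitable n, |T x_n| > t - t/2 while T x_n lies within t/2 of v. *)
have v0 : 0 < hnorm v.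
  have [n Nn nv] := vP (t / 2) (Num.truncn (2 / t)).+1 (divr_gt0 tgt0 (ltr0n _ 2)).
  have := le_lt_trans (le_trans (ler_norm _) (ler_hnorm_dist _ _)) nv.
  have := (xP n).2.
  have : n.+1%:R^-1 < t / 2.
    rewrite invf_plt ?posrE ?divr_gt0// invf_div.
    apply: lt_le_trans (truncnS_gt _) _; rewrite ler_nat; exact: leq_trans Nn (leqnSn n).
  move: (n.+1%:R^-1) (hnorm (T (x n))) => a b; lra.
have Sv0 : 0 < hnorm (S v).
  rewrite lt_neqAle hnorm_ge0 eq_sym hnorm_eq0 andbT; apply: contraTneq v0 => Sv0.
  move: TSv; rewrite Sv0 linear_map0// => /(congr1 hnorm).
  rewrite hnorm0 hnormZR ger0_norm ?sqr_ge0// => /esym/eqP.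
  by rewrite mulf_eq0 sqrf_eq0 (negPf tn0)/= => /eqP ->; rewrite ltxx.
exists (((hnorm (S v))^-1)%:C *: S v); split => //.
  by rewrite (linear_mapZ lT) (linear_mapZ lS) TSv (linear_mapZ lS) !scalerA mulrC.
by right; split => //; rewrite hnormZR ger0_norm ?invr_ge0// mulVf ?gt_eqF.
Qed.

End compact_operators.

(** * Singular value decomposition *)

Section singular_value_decomposition.
Context {R : realType} {H1 H2 : preHilbertType R}.
Implicit Types (T : H1 -> H2) (S : H2 -> H1) (s : nat -> R) (e : nat -> H1).

(* [e] lists right singular vectors; the last clause makes [T] the norm limit of
   its restrictions to the spans of the first [n] of them. *)
Record svd T S s e : Prop := Svd {
  svd_adjoint : is_adjoint T S ;
  svd_ortho : orthoseq e ;
  svd_ge0 : forall k, 0 <= s k ;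
  svd_nonincreasing : nonincreasing_seq s ;
  svd_cvg : s @ \oo --> 0 ;
  svd_eigen : forall k, S (T (e k)) = (s k ^+ 2)%:C *: e k ;
  svd_norm : forall k, 0 < s k -> hnorm (e k) = 1 ;
  svd_approx : forall n u, hnorm (T (u - oproj e n u)) <= s n * hnorm u
}.

Lemma is_adjoint_hnorm T S u : is_adjoint T S ->
  hnorm (T u) ^+ 2 = complex.Re (inner (S (T u)) u).
Proof. by move=> TS; rewrite (is_adjointC TS) inner_hnorm. Qed.

Lemma eigen_hnorm T S (l : R) u : is_adjoint T S -> 0 <= l ->
  S (T u) = (l ^+ 2)%:C *: u -> hnorm (T u) = l * hnorm u.
Proof.
move=> TS l0 STu; apply/eqP; rewrite -(@eqrXn2 _ 2)// ?mulr_ge0//.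
by rewrite (is_adjoint_hnorm u TS) STu innerZl inner_hnorm -rmorphM exprMn.
Qed.

Section deflation.
Variables (T : H1 -> H2) (S : H2 -> H1).
Hypotheses (cT : compact_operator T) (TS : is_adjoint T S).

Definition is_top_pair (T' : H1 -> H2) (S' : H2 -> H1) : set (R * H1) :=
  [set te | [/\ 0 <= te.1, S' (T' te.2) = (te.1 ^+ 2)%:C *: te.2,
    forall u, hnorm (T' u) <= te.1 * hnorm u
    & (te.1 = 0 /\ te.2 = 0) \/ (0 < te.1 /\ hnorm te.2 = 1)]].

Definition top_pair (T' : H1 -> H2) (S' : H2 -> H1) : R * H1 :=
  xget (0, 0) (is_top_pair T' S').

(** Both operators are carried along: a projection composed on the right of T_n reappears on the
    left of S_n, and choosing the next pair involves S_n T_n. *)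
Fixpoint deflate n : (H1 -> H2) * (H2 -> H1) :=
  if n is n'.+1 then
    let Tn := (deflate n').1 in let Sn := (deflate n').2 in
    let e := (top_pair Tn Sn).2 in
    (fun u => Tn (u - inner u e *: e), fun v => Sn v - inner (Sn v) e *: e)
  else (T, S).

Local Notation Tn n := (deflate n).1.
Local Notation Sn n := (deflate n).2.
Definition top_value n : R := (top_pair (Tn n) (Sn n)).1.
Definition top_vector n : H1 := (top_pair (Tn n) (Sn n)).2.
Local Notation s := top_value.
Local Notation e := top_vector.

Let top_pairP n : compact_operator (Tn n) -> is_adjoint (Tn n) (Sn n) ->
  [/\ 0 <= s n, Sn n (Tn n (e n)) = (s n ^+ 2)%:C *: e n,
    forall u, hnorm (Tn n u) <= s n * hnorm u
    & (s n = 0 /\ e n = 0) \/ (0 < s n /\ hnorm (e n) = 1)].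
Proof.
move=> cTn TSn; have [t [f tf]] := compact_operator_extremal cTn TSn.
exact: (@xgetPex _ (0, 0) (is_top_pair _ _) (ex_intro _ (t, f) tf)).
Qed.

Lemma deflate_step (f : H1) : f = 0 \/ hnorm f = 1 ->
  forall u, hnorm (u - inner u f *: f) <= hnorm u.
Proof.
move=> f1 u.
by have := ler_hnorm_proj_compl 1 u (orthoseq_single f1); rewrite /oproj big_nat1.
Qed.

Let deflateP n : compact_operator (Tn n) /\ is_adjoint (Tn n) (Sn n).
Proof.
elim: n => [//|n [cTn TSn]].
have [_ _ _ en] := top_pairP cTn TSn.
have e1 : e n = 0 \/ hnorm (e n) = 1 by case: en => -[]; [left|right].
have lTn := cTn.1.
split; last first.
  move=> u v /=; rewrite (linear_mapB lTn) (linear_mapZ lTn) innerBl innerBr innerZl innerZr.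
  by rewrite !TSn [inner (e n) _]innerC mulrC.
split.
  move=> a u v /=; rewrite -lTn; congr (Tn n _).
  rewrite innerDl innerZl scalerDl -scalerA scalerBr; apply/eqP.
  by rewrite opprD addrACA.
apply: precompact_subset cTn.2 => _ [u /= u1 <-].
exists (u - inner u (e n) *: e n) => //=.
move: u1; rewrite !hnormE !lecR; apply: le_trans; exact: deflate_step.
Qed.

Let top_ge0 n : 0 <= s n.
Proof. by have [cTn TSn] := deflateP n; have [] := top_pairP cTn TSn. Qed.

Let top_unit n : (s n = 0 /\ e n = 0) \/ (0 < s n /\ hnorm (e n) = 1).
Proof. by have [cTn TSn] := deflateP n; have [] := top_pairP cTn TSn. Qed.

(** For m < n the induction needs <e_m, e_n> = 0, which follows from s_n^2 <e_n, e_m> = <T_n e_n,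
    T_n e_m> = 0, or from e_n = 0 when s_n = 0. *)
Let deflate_kills n m : (m < n)%N -> Tn n (e m) = 0.
Proof.
elim: n => [//|n IH]; rewrite ltnS leq_eqVlt => /predU1P[->|mn] /=.
  have lTn := (deflateP n).1.1.
  suff -> : e n - inner (e n) (e n) *: e n = 0 by rewrite linear_map0.
  case: (top_unit n) => [[_ ->]|[_ en]]; first by rewrite scaler0 subrr.
  by rewrite inner_hnorm en expr1n scale1r subrr.
suff -> : inner (e m) (e n) = 0 by rewrite scale0r subr0 IH.
have [cTn TSn] := deflateP n; have [_ Sen _ _] := top_pairP cTn TSn.
case: (top_unit n) => [[_ ->]|[sn en]]; first by rewrite inner0r.
have : inner (Sn n (Tn n (e n))) (e m) = 0.
  by rewrite (is_adjointC TSn) IH// inner0r.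
rewrite Sen innerZl => /eqP; rewrite mulf_eq0 => /orP[|/eqP h].
  by rewrite real_complex_eq0 sqrf_eq0 gt_eqF.
by rewrite innerC h conjC0.
Qed.

Let top_orth m n : (m < n)%N -> inner (e n) (e m) = 0.
Proof.
move=> mn; have [cTn TSn] := deflateP n; have [_ Sen _ _] := top_pairP cTn TSn.
case: (top_unit n) => [[_ ->]|[sn en]]; first by rewrite inner0l.
have : inner (Sn n (Tn n (e n))) (e m) = 0.
  by rewrite (is_adjointC TSn) (deflate_kills mn) inner0r.
rewrite Sen innerZl => /eqP; rewrite mulf_eq0 => /orP[|/eqP//].
by rewrite real_complex_eq0 sqrf_eq0 gt_eqF.
Qed.

Lemma orthoseq_top_vector : orthoseq e.
Proof.
split=> [j k|k]; last by case: (top_unit k) => -[]; [left|right].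
by rewrite neq_ltn => /orP[jk|kj]; [rewrite innerC top_orth// conjC0|exact: top_orth].
Qed.
Let oe := orthoseq_top_vector.

Let deflateE n : (forall u, Tn n u = T (u - oproj e n u)) /\
  (forall v, Sn n v = S v - oproj e n (S v)).
Proof.
elim: n => [|n [IT IS]]; first by split=> u; rewrite /oproj big_geq//= subr0.
have pE u : oproj e n.+1 u = oproj e n u + inner u (e n) *: e n.
  by rewrite /oproj big_nat_recr.
split=> [u|v] /=.
  rewrite IT; congr T; rewrite pE opprD addrA addrAC; congr (_ - _ - _).
  apply: eq_big_nat => k /andP[_ kn]; congr (_ *: _).
  by rewrite innerBl innerZl top_orth// mulr0 subr0.
rewrite IS pE opprD addrA; congr (_ - _ *: _).
by rewrite innerBl inner_proj// ltnn subr0.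
Qed.

Let proj_top n : oproj e n (e n) = 0.
Proof.
by rewrite /oproj big_nat_cond big1// => k /andP[/andP[_ kn] _]; rewrite top_orth// scale0r.
Qed.

(** S_n T_n e_n differs from S T e_n by its projection on the earlier e_k, which vanishes because
    these are eigenvectors of S T orthogonal to e_n. *)
Let top_eigen n : S (T (e n)) = (s n ^+ 2)%:C *: e n.
Proof.
elim/ltn_ind: n => n IH.
have [cTn TSn] := deflateP n; have [_ Sen _ _] := top_pairP cTn TSn.
move: Sen; rewrite (deflateE n).1 (deflateE n).2 proj_top subr0 => <-.
rewrite [oproj _ _ _](_ : _ = 0) ?subr0//.
rewrite /oproj big_nat_cond big1// => k /andP[/andP[_ kn] _].
rewrite (is_adjointC TS) TS IH// innerZr top_orth// mulr0 scale0r//.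
Qed.

Let top_decr n : s n.+1 <= s n.
Proof.
have [cTn TSn] := deflateP n; have [_ _ h en] := top_pairP cTn TSn.
have [cTn1 TSn1] := deflateP n.+1; have [_ Sen _ _] := top_pairP cTn1 TSn1.
case: (top_unit n.+1) => [[-> _]//|[_ en1]].
have := eigen_hnorm TSn1 (top_ge0 _) Sen; rewrite en1 mulr1 => <- /=.
apply: le_trans (h _) _; rewrite -[leRHS]mulr1 ler_wpM2l// -en1 deflate_step//.
by case: en => -[]; [left|right].
Qed.

Let top_nonincr : nonincreasing_seq s.
Proof. by apply/nonincreasing_seqP => n; exact: top_decr. Qed.

(** The T e_n are pairwise orthogonal with norms s_n. If all s_n were at least eps, their mutual
    distances would be at least eps times the square root of 2, whereas two of them lie within eps /
    2 of a common cluster point. *)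
Let top_cvg : s @ \oo --> 0.
Proof.
suff small eps : 0 < eps -> exists N, s N < eps.
  apply/cvgrPdist_lt => eps /small[N sN]; exists N => // n /= Nn.
  by rewrite sub0r normrN ger0_norm// (le_lt_trans _ sN)// top_nonincr.
move=> e0; apply: contrapT => nN.
have se n : eps <= s n by rewrite leNgt; apply/negP => h; apply: nN; exists n.
have en n : hnorm (e n) = 1.
  case: (top_unit n) => -[sn]//; have := se n.
  by rewrite sn => /(lt_le_trans e0); rewrite ltxx.
have [v vP] : exists v, forall (eps : R) N, 0 < eps ->
    exists2 n, (N <= n)%N & hnorm (T (e n) - v) < eps.
  by apply: (compact_operator_cluster cT) => n; rewrite en.
have [n _ nv] := vP (eps / 2) 0%N (divr_gt0 e0 (ltr0n _ 2)).
have [m nm mv] := vP (eps / 2) n.+1 (divr_gt0 e0 (ltr0n _ 2)).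
have lT := cT.1.
have : hnorm (T (e n) - T (e m)) ^+ 2 = s n ^+ 2 + s m ^+ 2.
  rewrite hnormB_sqr TS top_eigen innerZr innerC top_orth// conjC0 mulr0 mul0rn subr0.
  by rewrite !(eigen_hnorm TS (top_ge0 _) (top_eigen _)) !en !mulr1.
have := ler_hdistD v (T (e n)) (T (e m)); rewrite [hnorm (v - _)]hdistC.
move: nv mv (se n) (se m) e0 (hnorm_ge0 (T (e n) - T (e m))).
move: (hnorm _) (hnorm _) (hnorm _) (s n) (s m) => a b c x y; nra.
Qed.

Lemma svd_deflation : svd T S s e.
Proof.
split => //.
- by move=> k; case: (top_unit k) => -[-> //]; rewrite ltxx.
- move=> n u; have [cTn TSn] := deflateP n; have [_ _ + _] := top_pairP cTn TSn.
  by rewrite -(deflateE n).1.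
Qed.

End deflation.

Lemma svd_exists T S : compact_operator T -> is_adjoint T S ->
  exists s e, svd T S s e.
Proof. by move=> cT TS; do 2!eexists; exact: svd_deflation. Qed.

End singular_value_decomposition.

(** * Limits and diagonal operators *)

Section hilbert_limits.
Context {R : realType} {H : preHilbertType R}.
Implicit Types (u v : nat -> H) (e : nat -> H) (d : nat -> R).
Local Notation normc := (@Normc.normc R).

Definition hcvg u (l : H) : Prop := (fun n => hnorm (u n - l)) @ \oo --> (0 : R).

(** [PreHilbert] does not contain completeness, so it travels as a hypothesis; for [L2] it is
    supplied by Riesz-Fischer. *)
Definition hcomplete : Prop := forall u : nat -> H,
  (forall eps : R, 0 < eps -> exists N, forall m n, (N <= m)%N -> (N <= n)%N ->
     hnorm (u m - u n) < eps) -> exists l, hcvg u l.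

Lemma hcvgP u l : hcvg u l <-> forall eps : R, 0 < eps ->
  exists N, forall n, (N <= n)%N -> hnorm (u n - l) < eps.
Proof.
split=> [ul eps e0|ul].
  move/cvgrPdist_lt: ul => /(_ _ e0)[N _ NP]; exists N => n /NP.
  by rewrite sub0r normrN ger0_norm.
apply/cvgrPdist_lt => eps /ul[N NP]; exists N => // n /= Nn.
by rewrite sub0r normrN ger0_norm// NP.
Qed.

Lemma hcvg_le u l (a : nat -> R) : (forall n, hnorm (u n - l) <= a n) ->
  a @ \oo --> 0 -> hcvg u l.
Proof.
move=> ua a0; apply: (squeeze_cvgr _ (cvg_cst 0) a0).
by apply: nearW => n; rewrite hnorm_ge0 ua.
Qed.

Lemma eq_hcvg u v l : u =1 v -> hcvg u l -> hcvg v l.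
Proof. by move=> /funext ->. Qed.

Lemma hcvg_unique u l l' : hcvg u l -> hcvg u l' -> l = l'.
Proof.
move=> ul ul'; apply/eqP; rewrite -subr_eq0 -hnorm_eq0 eq_le hnorm_ge0 andbT.
apply/ler_addgt0Pr => eps e0; rewrite add0r.
have e20 : 0 < eps / 2 by rewrite divr_gt0.
move/hcvgP : ul => /(_ _ e20)[N NP]; move/hcvgP : ul' => /(_ _ e20)[N' NP'].
apply: le_trans (ler_hdistD (u (maxn N N')) _ _) _.
rewrite [leRHS](splitr eps); apply: lerD; apply: ltW; last exact: NP' (leq_maxr _ _).
by rewrite hdistC; exact: NP (leq_maxl _ _).
Qed.

(** With partial sums of a diagonal operator for [u] and [v], this passes their self-adjointness to
    the limit. *)
Lemma hcvg_inner u v l l' w w' : hcvg u l -> hcvg v l' ->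
  (forall n, inner (u n) w = inner w' (v n)) -> inner l w = inner w' l'.
Proof.
move=> ul vl uv; apply/eqP; rewrite -subr_eq0; apply/eqP/Normc.eq0_normc/eqP.
rewrite eq_le normc_ge0 andbT; apply/ler_addgt0Pr => eps e0; rewrite add0r.
pose c := eps / (hnorm w + hnorm w' + 1).
have p0 : 0 < hnorm w + hnorm w' + 1 by rewrite ltr_wpDl ?addr_ge0.
have c0 : 0 < c by rewrite divr_gt0.
move/hcvgP : ul => /(_ _ c0)[N NP]; move/hcvgP : vl => /(_ _ c0)[N' NP'].
pose n := maxn N N'.
have -> : inner l w - inner w' l' = inner (l - u n) w + inner w' (v n - l').
  by rewrite innerBl innerBr uv addrA subrK.
apply: le_trans (le_normcD _ _) _.
apply: (@le_trans _ _ (c * hnorm w + hnorm w' * c)).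
  apply: lerD; apply: le_trans (cauchy_schwarz _ _) _.
    by rewrite ler_wpM2r// hdistC ltW// NP// leq_maxl.
  by rewrite ler_wpM2l// ltW// NP'// leq_maxr.
rewrite mulrC -mulrDl /c mulrCA -[leRHS]mulr1 ler_wpM2l ?(ltW e0)//.
by rewrite ler_pdivrMr// mul1r lerDl.
Qed.

Lemma hcvg_hnorm u l : hcvg u l -> (fun n => hnorm (u n)) @ \oo --> hnorm l.
Proof.
move=> ul; apply/cvgrPdist_lt => eps e0.
move/hcvgP : ul => /(_ _ e0)[N NP]; exists N => // n /= /NP; apply: le_lt_trans.
by rewrite distrC ler_hnorm_dist.
Qed.

Definition diag_sum d e n (u : H) : H :=
  \sum_(0 <= k < n) ((d k)%:C * inner u (e k)) *: e k.

Lemma diag_sum_adjoint d e n : is_adjoint (diag_sum d e n) (diag_sum d e n).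
Proof.
move=> u v; rewrite inner_suml inner_sumr; apply: eq_bigr => k _.
by rewrite innerZl innerZr conj_mul conj_real -innerC mulrAC.
Qed.

Lemma hnorm_diag_sum d e n (u : H) : orthoseq e -> hnorm (diag_sum d e n u) ^+ 2 =
  \sum_(0 <= k < n) d k ^+ 2 * normc (inner u (e k)) ^+ 2.
Proof. by move=> oe; rewrite hnorm_ortho_coef// iota_uniq. Qed.

Definition bounded_seq d (M : R) : Prop := forall k, `|d k| <= M.

Lemma diag_sum_bound d e M n (u : H) : orthoseq e -> bounded_seq d M ->
  hnorm (diag_sum d e n u) <= M * hnorm u.
Proof.
move=> oe dM; have M0 : 0 <= M := le_trans (normr_ge0 _) (dM 0%N).
rewrite -(@ler_pXn2r _ 2)// ?nnegrE ?mulr_ge0//.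
rewrite hnorm_diag_sum// exprMn; apply: (le_trans _ (ler_wpM2l _ (bessel n u oe))).
  rewrite mulr_sumr; apply: ler_sum => k _.
  by rewrite ler_wpM2r ?sqr_ge0// -real_normK ?num_real// ler_pXn2r ?nnegrE.
exact: sqr_ge0.
Qed.

(** The squared norm of a block of terms is at most M^2 times the same block of the convergent
    series of Bessel's inequality. *)
Lemma diag_sum_cvg d e M (u : H) : hcomplete -> orthoseq e -> bounded_seq d M ->
  exists l, hcvg (fun n => diag_sum d e n u) l.
Proof.
move=> cH oe dM; have M0 : 0 <= M := le_trans (normr_ge0 _) (dM 0%N).
apply: cH => eps e0.
pose a n := \sum_(0 <= k < n) normc (inner u (e k)) ^+ 2.
have na : nondecreasing_seq a.
  apply/nondecreasing_seqP => n.
  by rewrite /a big_nat_recr//= lerDl sqr_ge0.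
have ca : cvgn a.
  apply: nondecreasing_is_cvgn => //; exists (hnorm u ^+ 2) => _ [n _ <-].
  exact: bessel.
pose c := (eps / (M + 1)) ^+ 2.
have M1 : 0 < M + 1 by rewrite ltr_wpDl.
have c0 : 0 < c / 2 by rewrite divr_gt0// exprn_gt0// divr_gt0.
move/cvgrPdist_lt: ca => /(_ _ c0)[N _ NP]; exists N.
suff main m n : (N <= m)%N -> (m <= n)%N -> hnorm (diag_sum d e n u - diag_sum d e m u) < eps.
  move=> m n Nm Nn; case/orP: (leq_total m n) => mn; last exact: main.
  by rewrite hdistC main.
move=> Nm mn; rewrite /diag_sum (@big_cat_nat _ _ _ m)//= addrAC subrr add0r.
rewrite -(@ltr_pXn2r _ 2)// ?nnegrE ?(ltW e0)//.
rewrite hnorm_ortho_coef ?iota_uniq//.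
apply: (@le_lt_trans _ _ (M ^+ 2 * (a n - a m))).
  rewrite /a (@big_cat_nat _ _ _ m 0 n)//= [_ + _ - _]addrAC subrr add0r mulr_sumr.
  apply: ler_sum => k _.
  by rewrite ler_wpM2r ?sqr_ge0// -real_normK ?num_real// ler_pXn2r ?nnegrE.
have nm : a n - a m <= c.
  have := NP n (leq_trans Nm mn); have := NP m Nm => /=; move: (lim _) => l.
  rewrite !ltr_norml => /andP[h1 h2] /andP[h3 h4]; lra.
apply: (@le_lt_trans _ _ (M ^+ 2 * c)); first by rewrite ler_wpM2l ?sqr_ge0.
rewrite /c -exprMn ltr_pXn2r ?nnegrE ?(ltW e0) ?mulr_ge0 ?invr_ge0 ?(ltW e0) ?(ltW M1)//.
by rewrite mulrCA -[ltRHS]mulr1 ltr_pM2l// ltr_pdivrMr// mul1r ltrDl.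
Qed.

(** The default 0 of [xget] is not reached for bounded [d] and orthonormal [e] in a complete space.
    Since [d] is real, the operator is self-adjoint. *)
Definition diag d e (u : H) : H := xget 0 [set l | hcvg (fun n => diag_sum d e n u) l].

End hilbert_limits.
Arguments hcomplete {R} H.

Section diagonal_operators.
Context {R : realType} {H : preHilbertType R}.
Variable (e : nat -> H).
Hypotheses (cH : hcomplete H) (oe : orthoseq e).
Implicit Types (d : nat -> R) (M : R).
Local Notation normc := (@Normc.normc R).

Lemma diag_cvg d M u : bounded_seq d M -> hcvg (fun n => diag_sum d e n u) (diag d e u).
Proof.
move=> dM; have [l lP] := diag_sum_cvg u cH oe dM.
exact: (@xgetPex _ 0 [set l | _] (ex_intro _ l lP)).
Qed.

Lemma diag_adjoint d M : bounded_seq d M -> is_adjoint (diag d e) (diag d e).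
Proof.
move=> dM u v; apply: (hcvg_inner (diag_cvg u dM) (diag_cvg v dM)) => n.
exact: diag_sum_adjoint.
Qed.

Lemma diag_linear d M : bounded_seq d M -> linear (diag d e).
Proof. by move=> dM; exact: adjoint_linear (diag_adjoint dM). Qed.

Lemma diag_bound d M u : bounded_seq d M -> hnorm (diag d e u) <= M * hnorm u.
Proof.
move=> dM; have /hcvg_hnorm h := diag_cvg u dM.
rewrite -(cvg_lim _ h)//; apply: limr_le; first exact: cvgP h.
apply: nearW => n.
exact: diag_sum_bound.
Qed.

Lemma diag_basis d M k : bounded_seq d M -> diag d e (e k) = (d k)%:C *: e k.
Proof.
move=> dM; apply: (hcvg_unique (diag_cvg _ dM)); apply/hcvgP => eps e0.
exists k.+1 => n kn; rewrite /diag_sum (bigD1_seq k) ?iota_uniq ?mem_index_iota//=.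
rewrite big1 => [|i ik]; last by rewrite oe.1 1?eq_sym// mulr0 scale0r.
rewrite addr0; case: (oe.2 k) => [->|ek]; first by rewrite !scaler0 subrr hnorm0.
by rewrite inner_hnorm ek expr1n mulr1 subrr hnorm0.
Qed.

Lemma inner_diag_basis d M u k : bounded_seq d M ->
  inner (diag d e u) (e k) = (d k)%:C * inner u (e k).
Proof. by move=> dM; rewrite (diag_adjoint dM) (diag_basis _ dM) innerZr conj_real. Qed.

Lemma bounded_seqM d d' M M' : bounded_seq d M -> bounded_seq d' M' ->
  bounded_seq (fun k => d k * d' k) (M * M').
Proof. by move=> dM dM' k; rewrite normrM ler_pM. Qed.

Lemma diag_comp d d' M M' u : bounded_seq d M -> bounded_seq d' M' ->
  diag d e (diag d' e u) = diag (fun k => d k * d' k) e u.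
Proof.
move=> dM dM'; apply: (hcvg_unique (diag_cvg _ dM)).
apply: (eq_hcvg _ (diag_cvg u (bounded_seqM dM dM'))) => n.
apply: eq_bigr => k _; congr (_ *: _).
by rewrite (inner_diag_basis _ _ dM') rmorphM mulrA.
Qed.

Lemma diag_hnorm d M u : bounded_seq d M ->
  (fun n => \sum_(0 <= k < n) d k ^+ 2 * normc (inner u (e k)) ^+ 2) @ \oo -->
  hnorm (diag d e u) ^+ 2.
Proof.
move=> dM; have /hcvg_hnorm h := diag_cvg u dM.
by under eq_fun do rewrite -hnorm_diag_sum// expr2; rewrite expr2; exact: cvgM.
Qed.

(** The operator is the square of the self-adjoint diagonal operator with entries the square roots
    of d_k. *)
Lemma diag_ge0 d M u : bounded_seq d M -> (forall k, 0 <= d k) ->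
  0 <= inner (diag d e u) u.
Proof.
move=> dM d0; pose q k := Num.sqrt (d k).
have qM : bounded_seq q (Num.sqrt M).
  by move=> k; rewrite ger0_norm ?sqrtr_ge0// ler_wsqrtr// (le_trans _ (dM k))// ler_norm.
have -> : diag d e u = diag q e (diag q e u).
  rewrite (diag_comp _ qM qM); congr (diag _ e u); apply/funext => k.
  by rewrite -expr2 sqr_sqrtr.
by rewrite (diag_adjoint qM) inner_hnorm lecR sqr_ge0.
Qed.

End diagonal_operators.

(** * Uniqueness of the modulus and of the singular values *)

Section linear_dimension.
Context {R : realType} {H : preHilbertType R}.

(** If m < n, the n x m matrix of coefficients has a nonzero left kernel, and each of its rows is a
    linear relation among the independent vectors. *)
Lemma has_dim_le (V : set H) n m : has_dim V n -> has_dim V m -> (n <= m)%N.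
Proof.
move=> [e [Ve ie _]] [f [_ _ sf]]; rewrite leqNgt; apply/negP => mn.
have /choice[A AP] i := sf _ (Ve i).
pose B : 'M[R[i]]_(n, m) := \matrix_(i, j) A i j.
have : kermx B != 0.
  by rewrite kermx_eq0 /row_free neq_ltn (leq_ltn_trans (rank_leq_col _)).
move=> /eqP kn0; apply: kn0; apply/row_matrixP => i; rewrite row0.
set c := row i _.
have cB : c *m B = 0 by apply/sub_kermxP; rewrite row_sub.
apply/rowP => j; rewrite [RHS]mxE; apply: (ie (fun j => c 0 j)); rewrite (eq_bigr (fun j =>
    \sum_k (c 0 j * A j k) *: f k)); last first.
  by move=> {}j _; rewrite AP scaler_sumr; apply: eq_bigr => k _; rewrite scalerA.
rewrite exchange_big big1// => k _; rewrite -scaler_suml.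
have := congr1 (fun M : 'rV_m => M 0 k) cB; rewrite !mxE => h.
by rewrite (eq_bigr (fun j => c 0 j * B j k)) ?h ?scale0r// => l _; rewrite !mxE.
Qed.

Lemma has_dim_uniq (V : set H) n m : has_dim V n -> has_dim V m -> n = m.
Proof. by move=> Vn Vm; apply/eqP; rewrite eqn_leq (has_dim_le Vn Vm) (has_dim_le Vm Vn). Qed.

End linear_dimension.

(** At a first index k where s' k < s k = l, every j with s' j = l lies before k, by monotonicity,
    and there s j = l too. As s k = l as well, l occurs more often in s than in s'. *)
Lemma nonincreasing_multiplicity_uniq {R : realType} (s s' : nat -> R) :
  nonincreasing_seq s -> nonincreasing_seq s' ->
  (forall k, 0 <= s k) -> (forall k, 0 <= s' k) ->
  (forall l, 0 < l -> exists2 n : nat, ([set k | s k = l] #= `I_n)%card &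
     ([set k | s' k = l] #= `I_n)%card) -> s = s'.
Proof.
suff wl (t t' : nat -> R) : nonincreasing_seq t -> nonincreasing_seq t' ->
    (forall k, 0 <= t k) -> (forall k, 0 <= t' k) ->
    (forall l, 0 < l -> exists2 n : nat, ([set k | t k = l] #= `I_n)%card &
     ([set k | t' k = l] #= `I_n)%card) ->
    forall k, (forall j, (j < k)%N -> t j = t' j) -> t k <= t' k.
  move=> ds ds' s0 s0' ss'; apply/funext; elim/ltn_ind => k IH.
  apply/le_anti; rewrite !wl// => [l /ss'[n]|j /IH ->//]; by exists n.
move: t t' => {s s'} s s' ds ds' s0 s0' ss' k eqs; rewrite leNgt; apply/negP => s'k.
have [n sn s'n] := ss' _ (le_lt_trans (s0' k) s'k).
have sub j : s' j = s k -> (j < k)%N /\ s j = s k.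
  move=> s'j; have jk : (j < k)%N.
    by rewrite ltnNge; apply/negP => /ds'; rewrite s'j leNgt s'k.
  by rewrite eqs.
have fs : finite_set [set j | s j = s k] by exists n.
have fs' : finite_set [set j | s' j = s k] by exists n.
have : (#|` fset_set [set j | s' j = s k]| < #|` fset_set [set j | s j = s k]|)%N.
  apply: fproper_ltn_card; rewrite fproperE; apply/andP; split.
    by apply/fsubsetP => j; rewrite !in_fset_set// => /set_mem /sub[_ sj]; exact/mem_set.
  apply/fsubsetPn; exists k; rewrite !in_fset_set//; first exact/mem_set.
  by apply/negP => /set_mem /sub[]; rewrite ltnn.
by rewrite (card_fset_set s'n) (card_fset_set sn) ltnn.
Qed.

(** Polarisation: <P w, w> is real for w = u, v, u + v and u + i v, which fixes the real and
    imaginary parts of <P u, v> in terms of <P v, u>. *)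
Lemma positive_operator_selfadjoint {R : realType} {H : preHilbertType R} (P : H -> H) :
  positive_operator P -> is_adjoint P P.
Proof.
move=> [[lP _] P0] u v; rewrite innerC [RHS]innerC; congr (Num.conj _).
have r u' : complex.Im (inner (P u') u') = 0.
  by have := P0 u'; rewrite lecE /= => /andP[/eqP].
have h1 := r (u + v); have h2 := r (u + (0 +i* 1) *: v).
move: h1 h2; rewrite !(linear_mapD lP) (linear_mapZ lP).
rewrite !innerDl !innerDr !innerZl !innerZr.
have := r u; have := r v; rewrite [inner v (P u)]innerC.
move: (inner (P u) u) (inner (P v) v) (inner (P u) v) (inner (P v) u).
move=> [a a'] [b b'] [c c'] [d d'] /= -> -> h1 h2.
by congr (_ +i* _); lra.
Qed.

Section modulus.
Context {R : realType} {H1 H2 : preHilbertType R}.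
Variables (T : H1 -> H2) (S : H2 -> H1) (s : nat -> R) (e : nat -> H1).
Hypothesis svdT : svd T S s e.
Local Notation normc := (@Normc.normc R).

Let TS := svd_adjoint svdT.
Let oe := svd_ortho svdT.
Let s0 := svd_ge0 svdT.
Let lT : linear T := adjoint_linear (is_adjointC TS).
Let lS : linear S := adjoint_linear TS.

Lemma svd_bound u : hnorm (T u) <= s 0%N * hnorm u.
Proof. by have := svd_approx svdT 0 u; rewrite /oproj big_geq// subr0. Qed.

Lemma svd_bounded_seq : bounded_seq s (s 0%N).
Proof. by move=> k; rewrite ger0_norm// (svd_nonincreasing svdT). Qed.
Let sM := svd_bounded_seq.

Lemma svd_small (c : R) : 0 <= c -> (fun n => s n * c) @ \oo --> 0.
Proof. by move=> c0; rewrite -(mul0r c); apply: cvgMr_tmp; exact: svd_cvg svdT. Qed.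

Lemma svd_normal_cvg u :
  hcvg (fun n => diag_sum (fun k => s k * s k) e n u) (S (T u)).
Proof.
apply: (@hcvg_le _ _ _ _ (fun n => s n * (s 0%N * hnorm u))); last first.
  by apply: svd_small; rewrite mulr_ge0.
move=> n; rewrite hdistC.
have -> : S (T u) - diag_sum (fun k => s k * s k) e n u = S (T (u - oproj e n u)).
  rewrite (linear_mapB lT) (linear_mapB lS); congr (_ - _).
  rewrite /oproj (linear_map_sum lT) (linear_map_sum lS); apply: eq_bigr => k _.
  by rewrite (linear_mapZ lT) (linear_mapZ lS) (svd_eigen svdT) scalerA -expr2 mulrC.
apply: le_trans (adjoint_bound (s0 0%N) TS svd_bound _) _.
by rewrite mulrCA ler_wpM2l// (svd_approx svdT).
Qed.


(** For w = P e_k - s_k e_k one has P w = - s_k w, so positivity gives w = 0 when s_k > 0; when s_k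
    = 0, |P e_k| = |T e_k| = 0. As |P w| = |T w| for all w, the approximation clause of [svd]
    carries over to P. *)
Lemma svd_modulus_unique P : is_modulus T P ->
  forall u, hcvg (fun n => diag_sum s e n u) (P u).
Proof.
move=> [Ppos [S' TS' PP]] u.
have PPE w : P (P w) = S (T w).
  by rewrite PP; apply: inner_ext => v; rewrite !(is_adjointC TS, is_adjointC TS').
have Psym := positive_operator_selfadjoint Ppos.
have [[lP _] P0] := Ppos.
have PT w : hnorm (P w) = hnorm (T w).
  apply/eqP; rewrite -(@eqrXn2 _ 2)//; apply/eqP/complexI.
  by rewrite -!inner_hnorm Psym PPE TS.
have Pe k : P (e k) = (s k)%:C *: e k.
  apply/eqP; rewrite -subr_eq0; set w := _ - _.
  have Pw : P w = - ((s k)%:C *: w).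
    rewrite /w (linear_mapB lP) PPE (svd_eigen svdT) (linear_mapZ lP).
    by rewrite scalerBr opprB scalerA -rmorphM -expr2.
  have [sk0|sk0] := eqVneq (s k) 0.
    rewrite -hnorm_eq0 /w sk0 scale0r subr0 PT (eigen_hnorm TS (s0 k) (svd_eigen svdT k)).
    by rewrite sk0 mul0r.
  have := P0 w; rewrite Pw -scaleNr innerZl inner_hnorm -rmorphN -rmorphM lecR.
  rewrite mulNr oppr_ge0 pmulr_rle0 ?lt_neqAle ?(eq_sym 0) ?sk0 ?s0// => w0.
  by rewrite -hnorm_eq0 -sqrf_eq0 eq_le w0 sqr_ge0.
apply: (@hcvg_le _ _ _ _ (fun n => s n * hnorm u)); last exact: svd_small.
move=> n; rewrite hdistC.
have -> : P u - diag_sum s e n u = P (u - oproj e n u).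
  rewrite (linear_mapB lP) (linear_map_sum lP); congr (_ - _); apply: eq_bigr => k _.
  by rewrite (linear_mapZ lP) Pe scalerA mulrC.
by rewrite PT (svd_approx svdT).
Qed.

Hypothesis cH1 : hcomplete H1.

Lemma svd_is_modulus : is_modulus T (diag s e).
Proof.
split; last first.
  exists S => // u; rewrite (diag_comp cH1 oe _ sM sM).
  exact: (hcvg_unique (diag_cvg cH1 oe _ (bounded_seqM sM sM)) (svd_normal_cvg u)).
split; last by move=> u; exact: (diag_ge0 cH1 oe _ sM).
split; first exact: (diag_linear cH1 oe sM).
exists (s 0%N)%:C => u; rewrite !hnormE -rmorphM lecR; exact: (diag_bound cH1 oe _ sM).
Qed.

(** Finitely many indices have s_k = l because s tends to 0. An eigenvector minus its projection on
    their e_k is orthogonal to every e_k: for the other k the eigenvalues of S T differ. The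
    approximation clause then makes T vanish on it, and l > 0 forces it to be 0. *)
Lemma svd_eigenspace_dim l : 0 < l -> exists2 n : nat,
  ([set k | s k = l] #= `I_n)%card & has_dim (eigenspace (diag s e) l) n.
Proof.
move=> l0; have l2 : 0 < l ^+ 2 by rewrite exprn_gt0.
have [N NP] : exists N, forall k, s k = l -> (k < N)%N.
  have /cvgrPdist_lt/(_ _ l0)[N _ NP] := svd_cvg svdT; exists N => k skl.
  rewrite ltnNge; apply/negP => /NP /=.
  by rewrite sub0r normrN ger0_norm// skl ltxx.
pose F := [seq k <- iota 0 N | s k == l].
have uF : uniq F by rewrite filter_uniq ?iota_uniq.
have inF k : (k \in F) = (s k == l).
  rewrite mem_filter mem_iota/= add0n; case: eqP => //= /NP ->//.
exists (size F).
  rewrite card_eq_sym; apply/card_set_bijP; exists (nth 0%N F); split.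
  - by move=> i /= iF; apply/eqP; rewrite -inF mem_nth.
  - move=> i j /set_mem /= iF /set_mem /= jF /eqP.
    by rewrite nth_uniq// => /eqP.
  - move=> k /= /eqP; rewrite -inF => kF; exists (index k F); rewrite /= ?index_mem//.
    by rewrite nth_index.
pose g (i : 'I_(size F)) := nth 0%N F i.
have sg i : s (g i) = l by apply/eqP; rewrite -inF mem_nth.
have sum_g (c : nat -> R[i]) : \sum_i c (g i) *: e (g i) = \sum_(k <- F) c k *: e k.
  by rewrite (big_nth 0%N) big_mkord.
have eg i : hnorm (e (g i)) = 1 by apply: (svd_norm svdT); rewrite sg.
exists (fun i => e (g i)); split.
- by move=> i; rewrite /eigenspace /= (diag_basis cH1 oe _ sM) sg.
- move=> c ce0 i; have := congr1 (fun v => inner v (e (g i))) ce0.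
  rewrite inner0l inner_suml (bigD1 i)//= big1 ?addr0 => [|j ji].
    by rewrite innerZl inner_hnorm eg expr1n mulr1.
  rewrite innerZl oe.1 ?mulr0//; apply: contra ji => /eqP gij.
  by apply/eqP/val_inj/eqP; rewrite /= -(@nth_uniq _ 0%N F)//; apply/eqP.
- move=> u Pu; exists (fun i => inner u (e (g i))).
  rewrite (sum_g (fun k => inner u (e k))); apply/eqP; rewrite -subr_eq0.
  set w := _ - _.
  have STu : S (T u) = (l ^+ 2)%:C *: u.
    have [_ [S' TS' PP]] := svd_is_modulus.
    have -> : S (T u) = S' (T u).
      by apply: inner_ext => v; rewrite !(is_adjointC TS, is_adjointC TS').
    rewrite -PP Pu (linear_mapZ (diag_linear cH1 oe sM)) Pu scalerA.
    by rewrite -rmorphM.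
  have STw : S (T w) = (l ^+ 2)%:C *: w.
    rewrite /w (linear_mapB lT) (linear_mapB lS) STu scalerBr; congr (_ - _).
    rewrite (linear_map_sum lT) (linear_map_sum lS) scaler_sumr; apply: eq_big_seq => k.
    rewrite inF => /eqP skl.
    by rewrite (linear_mapZ lT) (linear_mapZ lS) (svd_eigen svdT) skl !scalerA mulrC.
  have we k : inner w (e k) = 0.
    have [skl|skl] := eqVneq (s k) l.
      by rewrite innerBl inner_ortho_sum// inF skl eqxx inner_orthoseqK// subrr.
    have : inner (S (T w)) (e k) = inner w (S (T (e k))).
      by rewrite (is_adjointC TS) TS.
    rewrite STw (svd_eigen svdT) innerZl innerZr conj_real => /eqP.
    rewrite -subr_eq0 -mulrBl -rmorphB mulf_eq0 real_complex_eq0 subr_eq0.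
    by rewrite eqrXn2// ?(ltW l0)// eq_sym (negPf skl) => /eqP.
  have Tw : hnorm (T w) = 0.
    apply/eqP; rewrite eq_le hnorm_ge0 andbT.
    have h := svd_small (hnorm_ge0 w).
    rewrite -(cvg_lim _ h)//; apply: limr_ge; first exact: cvgP h.
    apply: nearW => n; have := svd_approx svdT n w.
    by rewrite /oproj big1 ?subr0// => k _; rewrite we scale0r.
  have := eigen_hnorm TS (ltW l0) STw; rewrite Tw => /esym/eqP.
  by rewrite mulf_eq0 gt_eqF//= hnorm_eq0.
Qed.

Lemma svd_is_singular_values : is_singular_values T s.
Proof.
exists (diag s e); first exact: svd_is_modulus.
by split=> //; [exact: svd_nonincreasing svdT | exact: svd_eigenspace_dim].
Qed.

(** Every admissible modulus is [diag s e] and its multiplicities determine the sequence, so the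
    choice made in [singular_values] can only be [s]. *)
Lemma svd_singular_values : singular_values T = s.
Proof.
apply: xget_unique; first exact: svd_is_singular_values.
move=> s' [P mP [ds' s0' Pl]].
apply: (nonincreasing_multiplicity_uniq ds' (svd_nonincreasing svdT) s0' s0) => l l0.
have PE : P = diag s e.
  apply/funext => u; apply: (hcvg_unique (svd_modulus_unique mP u)).
  exact: (diag_cvg cH1 oe _ sM).
have [n sn Pn] := Pl _ l0; have [m sm Pm] := svd_eigenspace_dim l0.
by exists n => //; rewrite PE in Pn; rewrite (has_dim_uniq Pn Pm).
Qed.

End modulus.

(** * Compactness and singular values of adjoints *)

Section compact_composition.
Context {R : realType}.

Lemma compact_operator_ball {H1 H2 : preHilbertType R} (T : H1 -> H2) (M : R) :
  compact_operator T -> precompact (T @` [set u | hnorm u <= M]).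
Proof.
move=> [lT pT]; pose c := `|M| + 1.
have c0 : 0 < c by rewrite ltr_wpDl.
have cs : continuous (fun v : H2 => c%:C *: v).
  by apply: (@hnorm_continuous _ _ _ _ c) => u v; rewrite -scalerBr hnormZR gtr0_norm.
apply: precompact_subset (precompact_image cs pT) => _ [u /= uM <-].
exists (T ((c^-1)%:C *: u)); last first.
  by rewrite linear_mapZ// scalerA -rmorphM mulfV ?gt_eqF// scale1r.
exists ((c^-1)%:C *: u) => //=.
rewrite hnormE hnormZR ger0_norm ?invr_ge0 ?(ltW c0)// lecR ler_pdivrMl// mulr1.
by rewrite (le_trans uM)// (le_trans (ler_norm _))// lerDl.
Qed.

Lemma compact_operator_comp {H1 H2 H3 : preHilbertType R}
    (T : H2 -> H3) (A : H1 -> H2) (M : R) : compact_operator T -> linear A ->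
  (forall u, hnorm (A u) <= M * hnorm u) -> compact_operator (T \o A).
Proof.
move=> cT lA AM; split; first by move=> a u v /=; rewrite lA cT.1.
apply: precompact_subset (compact_operator_ball `|M| cT) => _ [u /= u1 <-].
exists (A u) => //=; apply: le_trans (AM u) _; apply: le_trans (ler_norm _) _.
rewrite normrM -[leRHS]mulr1 ler_wpM2l//.
by rewrite ger0_norm//; move: u1; rewrite hnormE lecR.
Qed.

End compact_composition.

Section adjoint_operator.
Context {R : realType} {H1 H2 : preHilbertType R}.
Variables (T : H1 -> H2) (S : H2 -> H1).

(** Where [s k] is 0 its inverse is 0 by convention, and so is the vector, which [orthoseq]
    allows. *)
Definition left_vectors (s : nat -> R) (e : nat -> H1) k : H2 := ((s k)^-1)%:C *: T (e k).

Lemma svd_left_vectors s e k : svd T S s e -> T (e k) = (s k)%:C *: left_vectors s e k.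
Proof.
move=> D; rewrite /left_vectors scalerA -rmorphM.
have [sk0|sk0] := eqVneq (s k) 0; last by rewrite mulfV// scale1r.
rewrite sk0 mul0r scale0r; apply/eqP; rewrite -hnorm_eq0.
by rewrite (eigen_hnorm (svd_adjoint D) (svd_ge0 D k) (svd_eigen D k)) sk0 mul0r.
Qed.

Lemma svd_adjoint_vectors s e k : svd T S s e -> S (left_vectors s e k) = (s k)%:C *: e k.
Proof.
move=> D; rewrite (linear_mapZ (adjoint_linear (svd_adjoint D))) (svd_eigen D).
rewrite scalerA -rmorphM; have [->|sk0] := eqVneq (s k) 0.
  by rewrite expr0n/= mulr0.
by rewrite expr2 mulKf.
Qed.

Lemma svd_norm_left_vectors s e k : svd T S s e -> 0 < s k ->
  hnorm (left_vectors s e k) = 1.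
Proof.
move=> D sk0; rewrite hnormZR ger0_norm ?invr_ge0 ?(ltW sk0)//.
rewrite (eigen_hnorm (svd_adjoint D) (svd_ge0 D k) (svd_eigen D k)).
by rewrite (svd_norm D)// mulr1 mulVf// gt_eqF.
Qed.

Lemma orthoseq_left_vectors s e : svd T S s e -> orthoseq (left_vectors s e).
Proof.
move=> D; split=> [j k jk|k].
  rewrite innerZl innerZr (svd_adjoint D) (svd_eigen D) innerZr.
  by rewrite (svd_ortho D).1// !mulr0.
have [sk0|sk0] := eqVneq (s k) 0; first by left; rewrite /left_vectors sk0 invr0 scale0r.
right; apply: (svd_norm_left_vectors D).
by rewrite lt_neqAle eq_sym sk0 (svd_ge0 D).
Qed.

(** Only the approximation clause takes an argument. With w = S v minus its projection on the first
    n vectors e_k, |w|^2 = Re <T w, v>, and w is orthogonal to these e_k, so |T w| <= s_n |w|. *)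
Lemma svd_adjoint_sym s e : svd T S s e -> svd S T s (left_vectors s e).
Proof.
move=> D; have TS := svd_adjoint D; have oe := svd_ortho D.
have lS := adjoint_linear TS; have lT := adjoint_linear (is_adjointC TS).
split.
- exact: is_adjointC.
- exact: orthoseq_left_vectors.
- exact: svd_ge0 D.
- exact: svd_nonincreasing D.
- exact: svd_cvg D.
- move=> k; rewrite svd_adjoint_vectors// (linear_mapZ lT) (svd_left_vectors _ D).
  by rewrite scalerA -rmorphM.
- by move=> k; exact: svd_norm_left_vectors D.
- move=> n v.
  have -> : S (v - oproj (left_vectors s e) n v) = S v - oproj e n (S v).
    rewrite (linear_mapB lS) (linear_map_sum lS); congr (_ - _); apply: eq_bigr => k _.
    rewrite (linear_mapZ lS) (svd_adjoint_vectors _ D) scalerA (is_adjointC TS).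
    by rewrite (svd_left_vectors _ D) innerZr conj_real mulrC.
  set w := S v - _.
  have [->|w0] := eqVneq w 0; first by rewrite hnorm0 mulr_ge0 ?(svd_ge0 D).
  have w_gt0 : 0 < hnorm w by rewrite lt_neqAle eq_sym hnorm_eq0 w0 hnorm_ge0.
  rewrite -(ler_pM2l w_gt0) -expr2.
  have -> : hnorm w ^+ 2 = complex.Re (inner (T w) v).
    rewrite TS -[RHS]/(complex.Re (inner w _)) -[S v](subrK (oproj e n (S v))).
    by rewrite innerDr inner_proj_compl// addr0 inner_hnorm.
  apply: le_trans (Re_inner_le _ _) _.
  rewrite mulrA ler_wpM2r// mulrC.
  have -> : T w = T (w - oproj e n w).
    congr T; rewrite [oproj e n w](_ : _ = 0) ?subr0//.
    rewrite /oproj big_nat_cond big1// => k /andP[/andP[_ kn] _].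
    by rewrite innerBl inner_proj// kn subrr scale0r.
  exact: (svd_approx D n w).
Qed.

End adjoint_operator.

Section adjoint_compact.
Context {R : realType} {H1 H2 : preHilbertType R}.
Variables (T : H1 -> H2) (S : H2 -> H1).

(* Schauder: |T (u - u')|^2 <= |S T (u - u')| |u - u'|, so a filter on the image
   of the unit ball of [T] is Cauchy as soon as its image under [S] converges. *)
Lemma adjoint_compact : hcomplete H2 -> is_adjoint T S -> compact_operator S ->
  compact_operator T.
Proof.
move=> cH2 TS cS; have lS := cS.1; have lT := adjoint_linear (is_adjointC TS).
have [M M0 SM] := compact_operator_bounded cS.
have TM := adjoint_bound M0 (is_adjointC TS) SM.
split => //; rewrite precompactE; set A := T @` _.
have AP v (eps : R) : closure A v -> 0 < eps ->
    exists u, hnorm u <= 1 /\ hnorm (T u - v) < eps.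
  move=> clv e0; have [|_ [[u /= u1 <-] h]] := clv [set w | hnorm (w - v) < eps].
    by apply/hnorm_nbhsP; exists eps.
  by exists u; move: u1; rewrite hnormE lecR.
have key v v' (c : R) : closure A v -> closure A v' -> 0 < c ->
    hnorm (S v - S v') < c ^+ 2 / 4 -> hnorm (v - v') <= 2 * c.
  (* The second bound makes |S T (u - u')| at most c^2/4 + 2 c^2/8; as |u - u'| <= 2 this gives |T
     (u - u')| <= c. The first bound pays for replacing v and v' by T u and T u'. *)
  move=> clv clv' c0 Sv; pose eps := Num.min (c / 2) (c ^+ 2 / (8 * (M + 1))).
  have M1 : 0 < M + 1 by rewrite ltr_wpDl.
  have e0 : 0 < eps.
    by rewrite /eps lt_min !divr_gt0// ?mulr_gt0// exprn_gt0.
  have ec : eps <= c / 2 by rewrite ge_min lexx.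
  have eM : eps <= c ^+ 2 / (8 * (M + 1)) by rewrite ge_min lexx orbT.
  have [u [u1 uv]] := AP _ _ clv e0; have [u' [u1' uv']] := AP _ _ clv' e0.
  have STuu' : hnorm (S (T (u - u'))) <= c ^+ 2 / 2.
    rewrite (linear_mapB lT) (linear_mapB lS).
    apply: le_trans (ler_hdistD (S v) _ _) _.
    apply: (@le_trans _ _ (M * eps + (c ^+ 2 / 4 + M * eps))).
      apply: lerD.
        by rewrite -(linear_mapB lS) (le_trans (SM _))// ler_wpM2l// ltW.
      apply: le_trans (ler_hdistD (S v') _ _) _; apply: lerD; first exact: ltW.
      by rewrite -(linear_mapB lS) (le_trans (SM _))// ler_wpM2l// hdistC ltW.
    have : M * eps <= c ^+ 2 / 8.
      apply: (@le_trans _ _ ((M + 1) * (c ^+ 2 / (8 * (M + 1))))).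
        by apply: ler_pM => //; [exact: ltW | rewrite lerDl].
      by rewrite invfM mulrCA [(M + 1) * _]mulrCA mulfV ?gt_eqF// mulr1.
    move: (M * eps) => x xc; lra.
  have Tuu' : hnorm (T (u - u')) <= c.
    rewrite -(@ler_pXn2r _ 2)// ?nnegrE ?(ltW c0)//.
    rewrite (is_adjoint_hnorm _ TS); apply: le_trans (Re_inner_le _ _) _.
    have : hnorm (u - u') <= 2.
      by rewrite (le_trans (ler_hnormD _ _))// hnormN; lra.
    move: STuu' (hnorm_ge0 (S (T (u - u')))) (hnorm_ge0 (u - u')).
    move: (hnorm _) (hnorm _) => x y; nra.
  apply: le_trans (ler_hdistD (T u) _ _) _.
  apply: le_trans (lerD (lexx _) (ler_hdistD (T u') _ _)) _.
  rewrite hdistC -(linear_mapB lT).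
  by move: uv uv' Tuu'; move: (hnorm _) (hnorm _) (hnorm _) => x y z; lra.
rewrite compact_ultra => F UF FA.
have PF : ProperFilter F by exact: ultra_proper.
have cSb := compact_operator_ball (M + 1) cS; rewrite precompactE in cSb.
have [|w [_ clw]] := cSb (fmap S F) _.
  suff : F (S @^-1` closure (S @` [set u | hnorm u <= M + 1])) by [].
  apply: filterS FA => v clv; apply: subset_closure; exists v => //=.
  have [u [u1 uv]] := AP _ _ clv ltr01.
  rewrite -(subrK (T u) v) addrC (le_trans (ler_hnormD _ _))//.
  by rewrite lerD// ?(le_trans (TM u))// ?ler_piMr// hdistC ltW.
(* [w] is only a cluster point of the image of [F] under [S]; for an ultrafilter this is
   convergence, as otherwise the complement would belong to [F]. *)
have FS (eps : R) : 0 < eps -> F [set v | hnorm (S v - w) < eps].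
  move=> e0; have [//|nF] := in_ultra_setVsetC [set v | hnorm (S v - w) < eps] UF.
  have [||x [xn xy]] := clw (~` [set x | hnorm (x - w) < eps]) [set x | hnorm (x - w) < eps].
  - exact: nF.
  - by apply/hnorm_nbhsP; exists eps.
  - by [].
pose c (n : nat) : R := n.+1%:R^-1.
have c0 n : 0 < c n by rewrite invr_gt0.
have c20 n : 0 < c n ^+ 2 / 8 by rewrite divr_gt0// exprn_gt0.
(* Completeness concerns sequences, so a sequence is drawn from the sets of [F]; c_n^2/8 is half of
   what [key] tolerates. *)
have /choice[x xP] n : exists v, closure A v /\ hnorm (S v - w) < c n ^+ 2 / 8.
  by have [v [vA vS]] := filter_ex (filterI FA (FS _ (c20 n))); exists v.
have near_x n v : closure A v -> hnorm (S v - w) < c n ^+ 2 / 8 -> hnorm (v - x n) <= 2 * c n.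
  move=> vA vw; apply: key => //; first exact: (xP n).1.
  apply: le_lt_trans (ler_hdistD w _ _) _; rewrite [hnorm (w - _)]hdistC.
  have := (xP n).2; move: vw; move: (hnorm _) (hnorm _) (c n ^+ 2) => a b d; lra.
have c_small (eps : R) : 0 < eps -> exists N, 2 * c N < eps.
  move=> e0; exists (Num.truncn (2 / eps)).
  rewrite /c ltr_pdivrMr// -ltr_pdivrMl// mulrC; exact: truncnS_gt.
have [eps e0|l xl] := cH2 x.
  have [N cN] := c_small _ (divr_gt0 e0 (ltr0n _ 2)); exists N => m n Nm Nn.
  have h k : (N <= k)%N -> hnorm (x k - x N) < eps / 2.
    move=> Nk; apply: le_lt_trans cN; apply: near_x; first exact: (xP k).1.
    apply: lt_le_trans (xP k).2 _; rewrite ler_pM2r// ler_pXn2r ?nnegrE ?(ltW (c0 _))//.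
    by rewrite lef_pV2 ?posrE// ler_nat.
  apply: le_lt_trans (ler_hdistD (x N) _ _) _; rewrite (splitr eps) ltrD ?h//.
  by rewrite hdistC h.
have Fl (eps : R) : 0 < eps -> F [set v | hnorm (v - l) < eps].
  move=> e0; have e20 := divr_gt0 e0 (ltr0n _ 2).
  have [N cN] := c_small _ e20; move/hcvgP: xl => /(_ _ e20)[N' N'P].
  pose n := maxn N N'.
  apply: filterS (filterI FA (FS _ (c20 n))) => v [vA vw] /=.
  apply: le_lt_trans (ler_hdistD (x n) _ _) _; rewrite (splitr eps) ltrD//; last first.
    by rewrite N'P// leq_maxr.
  apply: le_lt_trans (near_x _ _ vA vw) _; apply: le_lt_trans cN.
  by rewrite ler_pM2l// lef_pV2 ?posrE// ler_nat ltnS leq_maxl.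
exists l; split; last by move=> B /hnorm_nbhsP[eps e0 eB]; apply: filterS (Fl _ e0).
apply: closed_closure => B /hnorm_nbhsP[eps e0 eB].
have [v [vA vl]] := filter_ex (filterI FA (Fl _ e0)).
by exists v; split=> //; exact: eB.
Qed.

End adjoint_compact.

(** * Hoelder's inequality for Schatten classes *)

Section power_sums.
Context {R : realType}.
Implicit Types (a b w x : nat -> R) (s t al be p q r : R).

Lemma young_powR (x y : R) al be : 0 <= x -> 0 <= y -> 0 < al -> 0 < be -> al + be = 1 ->
  x `^ al * y `^ be <= al * x + be * y.
Proof.
move=> x0 y0 al0 be0 ab1.
have := @conjugate_powR R (x `^ al) (y `^ be) al^-1 be^-1.
rewrite !powR_ge0 !invr_gt0 !invrK -!powRrM !mulfV ?gt_eqF// !powRr1//.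
by move/(_ isT isT al0 be0 ab1); rewrite mulrC [y * _]mulrC [x * _]mulrC [_ * x `^ _]mulrC.
Qed.

(** Young's inequality termwise, after division by the two total sums; a zero sum makes all its
    terms zero. *)
Lemma hoelder_sum N a b al be : (forall n, 0 <= a n) -> (forall n, 0 <= b n) ->
  0 < al -> 0 < be -> al + be = 1 ->
  \sum_(0 <= n < N) a n `^ al * b n `^ be <=
  (\sum_(0 <= n < N) a n) `^ al * (\sum_(0 <= n < N) b n) `^ be.
Proof.
move=> a0 b0 al0 be0 ab1; set A := \sum_(0 <= n < N) a n; set B := \sum_(0 <= n < N) b n.
have A0 : 0 <= A by exact: sumr_ge0.
have B0 : 0 <= B by exact: sumr_ge0.
have zero (c : nat -> R) n : (forall n, 0 <= c n) -> \sum_(0 <= n < N) c n = 0 ->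
    (n \in index_iota 0 N) -> c n = 0.
  move=> c0 /eqP; rewrite psumr_eq0// => /allP h nN; exact/eqP/(h n nN).
have [A00|An0] := eqVneq A 0.
  rewrite A00 powR0 ?gt_eqF// mul0r big1_seq// => n /andP[_ nN].
  by rewrite (zero a)// powR0 ?gt_eqF// mul0r.
have [B00|Bn0] := eqVneq B 0.
  rewrite B00 powR0 ?gt_eqF// mulr0 big1_seq// => n /andP[_ nN].
  by rewrite (zero b)// powR0 ?gt_eqF// mulr0.
have Agt0 : 0 < A by rewrite lt_neqAle eq_sym An0.
have Bgt0 : 0 < B by rewrite lt_neqAle eq_sym Bn0.
have h n : a n `^ al * b n `^ be <=
    A `^ al * B `^ be * (al / A * a n + be / B * b n).
  have aE : a n `^ al = (a n / A) `^ al * A `^ al.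
    by rewrite -powRM ?divr_ge0// divfK.
  have bE : b n `^ be = (b n / B) `^ be * B `^ be.
    by rewrite -powRM ?divr_ge0// divfK.
  rewrite aE bE mulrACA mulrC ler_wpM2l ?mulr_ge0 ?powR_ge0//.
  have -> : al / A * a n + be / B * b n = al * (a n / A) + be * (b n / B) by ring.
  by rewrite young_powR ?divr_ge0.
apply: (le_trans (ler_sum _ (fun n _ => h n))).
rewrite -mulr_sumr big_split/= -!mulr_sumr -/A -/B !divfK ?gt_eqF//.
by rewrite ab1 mulr1.
Qed.

(** Hoelder's inequality for (w x)^t w^(1 - t). The weights may sum to less than 1, as they do when
    they come from Bessel's inequality. *)
Lemma jensen_powR N w x t m : (forall k, 0 <= w k) -> (forall k, 0 <= x k) ->
  \sum_(0 <= k < N) w k <= 1 -> 0 < t <= 1 ->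
  \sum_(0 <= k < N) w k * x k <= m ->
  \sum_(0 <= k < N) w k * x k `^ t <= m `^ t.
Proof.
move=> w0 x0 w1 /andP[t0 t1] wxm.
have wx0 : 0 <= \sum_(0 <= k < N) w k * x k by apply: sumr_ge0 => k _; rewrite mulr_ge0.
have m0 := le_trans wx0 wxm.
move: t1; rewrite le_eqVlt => /predU1P[t1|t1].
  by rewrite t1 powRr1//; under eq_bigr do rewrite powRr1//.
have t10 : 0 < 1 - t by rewrite subr_gt0.
apply: (@le_trans _ _ (\sum_(0 <= k < N) (w k * x k) `^ t * w k `^ (1 - t))).
  apply: ler_sum => k _; rewrite powRM// mulrAC -powRD; last first.
    by rewrite addrCA subrr addr0 oner_eq0.
  by rewrite addrCA subrr addr0 powRr1.
apply: le_trans (hoelder_sum N _ _ t0 t10 _) _ => //.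
- by move=> k; rewrite mulr_ge0.
- by rewrite addrCA subrr addr0.
rewrite -[leRHS]mulr1 ler_pM ?powR_ge0//.
  by rewrite ge0_ler_powR ?nnegrE ?(ltW t0).
have h1 : 1 = 1 `^ (1 - t) :> R by rewrite powR1.
rewrite [leRHS]h1 ge0_ler_powR ?nnegrE ?(ltW t10)//.
by rewrite sumr_ge0.
Qed.

(** The concave case with exponent 1/t, applied to x^t. *)
Lemma jensen_powR_convex N w x t : (forall k, 0 <= w k) -> (forall k, 0 <= x k) ->
  \sum_(0 <= k < N) w k <= 1 -> 1 <= t ->
  (\sum_(0 <= k < N) w k * x k) `^ t <= \sum_(0 <= k < N) w k * x k `^ t.
Proof.
move=> w0 x0 w1 t1; have t0 : 0 < t := lt_le_trans ltr01 t1.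
have ti : 0 < t^-1 <= 1 by rewrite invr_gt0 t0 invf_le1.
have := jensen_powR w0 (fun k => powR_ge0 (x k) t) w1 ti (lexx _).
under eq_bigr do rewrite -powRrM mulfV ?gt_eqF// powRr1//.
move=> h; set y := \sum_(0 <= k < N) w k * x k `^ t.
have y0 : 0 <= y by apply: sumr_ge0 => k _; rewrite mulr_ge0 ?powR_ge0.
have wx0 : 0 <= \sum_(0 <= k < N) w k * x k by apply: sumr_ge0 => k _; rewrite mulr_ge0.
rewrite -[y]powRr1// -(@mulVf _ t) ?gt_eqF// powRrM.
by rewrite ge0_ler_powR ?nnegrE ?powR_ge0 ?(ltW t0).
Qed.

Lemma lee_poweR (x y : \bar R) r : 0 <= r -> (0 <= x)%E -> (x <= y)%E ->
  (x `^ r <= y `^ r)%E.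
Proof.
move=> r0 x0 xy; apply: gt0_ler_poweR => //; rewrite in_itv/= leey andbT//.
exact: le_trans xy.
Qed.

Definition powsum p (s : nat -> R) : \bar R := (\sum_(0 <= k <oo) (s k `^ p)%:E)%E.

Lemma powsum_ge0 p (s : nat -> R) : (0 <= powsum p s)%E.
Proof. by apply: nneseries_ge0 => k _ _; rewrite lee_fin powR_ge0. Qed.

Lemma nneseries_le (f : nat -> R) (x : \bar R) : (forall k, 0 <= f k) ->
  (forall N, ((\sum_(0 <= k < N) f k)%:E <= x)%E) ->
  (\sum_(0 <= k <oo) (f k)%:E <= x)%E.
Proof.
move=> f0 fx; apply: lime_le; first by apply: is_cvg_nneseries => k _ _; rewrite lee_fin.
by apply: nearW => N; rewrite sumEFin.
Qed.

Lemma nneseries_ge (f : nat -> R) N : (forall k, 0 <= f k) ->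
  ((\sum_(0 <= k < N) f k)%:E <= \sum_(0 <= k <oo) (f k)%:E)%E.
Proof.
by move=> f0; rewrite -sumEFin; apply: nneseries_lim_ge => k _ _; rewrite lee_fin.
Qed.

(** With c the q-norm of s, every s_k is at most c, hence s_k^r <= s_k^q c^(r - q). *)
Lemma powsum_mono q r (s : nat -> R) : (forall k, 0 <= s k) -> 0 < q -> q <= r ->
  (powsum r s `^ r^-1 <= powsum q s `^ q^-1)%E.
Proof.
move=> s0 q0 qr; have r0 := lt_le_trans q0 qr.
have := powsum_ge0 q s; case E : (powsum q s) => [S| |]//; last first.
  by rewrite poweRyr ?leey// gt_eqF// invr_gt0.
rewrite lee_fin => S0.
pose c := S `^ q^-1; have c0 : 0 <= c := powR_ge0 _ _.
have cS : c `^ q = S by rewrite -powRrM mulVf ?gt_eqF// powRr1.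
have sc k : s k <= c.
  have : s k `^ q <= S.
    rewrite -lee_fin -E; apply: le_trans (nneseries_ge k.+1 (fun j => powR_ge0 (s j) q)).
    by rewrite lee_fin big_nat_recr//= lerDr sumr_ge0// => j _; exact: powR_ge0.
  move=> skS; rewrite -[s k]powRr1// -(@mulfV _ q) ?gt_eqF// powRrM.
  by rewrite ge0_ler_powR ?nnegrE ?powR_ge0 ?invr_ge0 ?(ltW q0).
have rE : r = q + (r - q) by rewrite addrC subrK.
have powE (x : R) : x `^ r = x `^ q * x `^ (r - q).
  by rewrite {1}rE powRD// -rE gt_eqF.
have main : (powsum r s <= (c `^ r)%:E)%E.
  apply: nneseries_le => [k|N]; first exact: powR_ge0.
  rewrite lee_fin powE cS.
  apply: (@le_trans _ _ (\sum_(0 <= k < N) s k `^ q * c `^ (r - q))).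
    apply: ler_sum => k _; rewrite powE ler_wpM2l ?powR_ge0//.
    by rewrite ge0_ler_powR ?nnegrE ?subr_ge0.
  rewrite -mulr_suml ler_wpM2r ?powR_ge0// -lee_fin -E.
  exact: nneseries_ge (fun j => powR_ge0 (s j) q).
apply: (le_trans (lee_poweR _ (powsum_ge0 _ _) main)); first by rewrite invr_ge0 ltW.
by rewrite !poweR_EFin -powRrM mulfV ?gt_eqF// powRr1.
Qed.

End power_sums.

(** * Power sums over orthonormal families *)

Section singular_value_sums.
Context {R : realType}.
Local Notation normc := (@Normc.normc R).
Implicit Types (r p q : R).

Lemma sqr_powR_half (x r : R) : 0 <= x -> (x ^+ 2) `^ (r / 2) = x `^ r.
Proof. by move=> x0; rewrite -powR_mulrn// -powRrM mulrC divfK. Qed.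

Section two_spaces.
Context {H1 H2 : preHilbertType R}.
Variables (T : H1 -> H2) (S : H2 -> H1) (s : nat -> R) (e : nat -> H1).
Hypothesis D : svd T S s e.
Local Notation f := (left_vectors T s e).

(** Bessel's inequality for T u against the left vectors, whose coefficients are s_k <u, e_k>. *)
Lemma svd_coef_le N u :
  \sum_(0 <= k < N) normc (inner u (e k)) ^+ 2 * s k ^+ 2 <= hnorm (T u) ^+ 2.
Proof.
apply: le_trans (bessel N (T u) (orthoseq_left_vectors D)).
apply: ler_sum => k _.
rewrite (svd_adjoint D) (svd_adjoint_vectors _ D) innerZr conj_real.
by rewrite Normc.normcM normc_real exprMn mulrC real_normK ?num_real.
Qed.

(* Concavity of [x |-> x^(r/2)] is what restricts [r] to [r <= 2]. *)
Lemma svd_powsum_le (g : nat -> H1) r : orthoseq g ->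
  (forall k, 0 < s k ->
     (1 <= \sum_(0 <= n <oo) (normc (inner (e k) (g n)) ^+ 2)%:E)%E) ->
  0 < r <= 2 -> (powsum r s <= \sum_(0 <= n <oo) (hnorm (T (g n)) `^ r)%:E)%E.
Proof.
move=> og parseval /andP[r0 r2]; have s0 := svd_ge0 D.
apply: nneseries_le => [k|N]; first exact: powR_ge0.
(* The hypothesis inserts a factor of at least 1 for each k with s_k > 0, which makes the sum double
   and its order exchangeable. *)
apply: (@le_trans _ _ (\sum_(0 <= k < N) \sum_(0 <= n <oo)
    (s k `^ r)%:E * (normc (inner (e k) (g n)) ^+ 2)%:E)%E).
  rewrite -sumEFin; apply: lee_sum => k _.
  rewrite nneseriesZl; last by move=> n _; rewrite lee_fin sqr_ge0.
  have [->|sk0] := eqVneq (s k) 0; first by rewrite powR0 ?gt_eqF// mul0e.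
  rewrite -[leLHS]mule1 lee_wpmul2l ?lee_fin ?powR_ge0// parseval//.
  by rewrite lt_neqAle eq_sym sk0 s0.
rewrite -nneseries_sum_nat; last first.
  by move=> i j; rewrite -EFinM lee_fin mulr_ge0 ?powR_ge0 ?sqr_ge0.
apply: lee_nneseries => [n _ _|n _].
  by apply: sume_ge0 => k _; rewrite -EFinM lee_fin mulr_ge0 ?powR_ge0 ?sqr_ge0.
under eq_bigr do rewrite -EFinM.
rewrite sumEFin lee_fin -sqr_powR_half//.
under eq_bigr do rewrite mulrC normc_innerC -sqr_powR_half//.
(* For fixed n the weights are |<g_n, e_k>|^2, the values s_k^2 and the exponent r/2. *)
apply: jensen_powR => [k|k||//|]; rewrite ?sqr_ge0//; last exact: svd_coef_le.
- apply: (le_trans (bessel N (g n) (svd_ortho D))).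
  by rewrite expr_le1// orthoseq_le1.
- by rewrite divr_gt0//= ler_pdivrMr// mul1r.
Qed.

(** The distance from T z to its projection on N left vectors is |T (z - P_N z)| <= s_N |z|, with
    P_N the projection on the first N right vectors, and it tends to 0. *)
Lemma svd_parseval_range z : hnorm (T z) = 1 ->
  (1 <= \sum_(0 <= n <oo) (normc (inner (T z) (f n)) ^+ 2)%:E)%E.
Proof.
move=> Tz1; have of_ := orthoseq_left_vectors D.
have lT := adjoint_linear (is_adjointC (svd_adjoint D)).
apply/lee_addgt0Pr => eps e0.
have := svd_small D (hnorm_ge0 z) => /cvgrPdist_lt.
have se0 : 0 < Num.sqrt eps by rewrite sqrtr_gt0.
move=> /(_ _ se0)[N _ /(_ N (leqnn N))] /=.
rewrite sub0r normrN ger0_norm ?mulr_ge0 ?(svd_ge0 D)// => small.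
have : hnorm (T z - oproj f N (T z)) < Num.sqrt eps.
  apply: le_lt_trans small.
  have -> : T z - oproj f N (T z) = T (z - oproj e N z).
    rewrite (linear_mapB lT) (linear_map_sum lT); congr (_ - _).
    apply: eq_bigr => k _; rewrite (linear_mapZ lT) (svd_left_vectors _ D).
    by rewrite (svd_adjoint D) (svd_adjoint_vectors _ D) innerZr conj_real [RHS]scalerA mulrC.
  exact: svd_approx D _ _.
rewrite -(@ltr_pXn2r _ 2)// ?nnegrE ?sqrtr_ge0// sqr_sqrtr ?(ltW e0)//.
rewrite hnorm_proj_compl// Tz1 expr1n ltrBlDl => h.
apply: le_trans (leeD2r _ (nneseries_ge N (fun n => sqr_ge0 _))).
by rewrite -EFinD lee_fin ltW.
Qed.

End two_spaces.

(** All that Hoelder's inequality asks of its second factor. For an integral operator it can be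
    checked on the kernel, before anything is known about singular values. *)
Definition power_summing {H H' : preHilbertType R} (A : H -> H') p (a : R) : Prop :=
  forall g : nat -> H, orthoseq g ->
  forall N, \sum_(0 <= n < N) hnorm (A (g n)) `^ p <= a `^ p.

(* Convexity of [x |-> x^(p/2)] is what restricts [p] to [2 <= p]. *)
Lemma diag_power_summing {H : preHilbertType R} (d : nat -> R) (e : nat -> H) (M p : R)
    (a : R) : hcomplete H -> orthoseq e -> bounded_seq d M -> (forall k, 0 <= d k) ->
  2 <= p -> powsum p d = (a `^ p)%:E -> power_summing (diag d e) p a.
Proof.
move=> cH oe dM d0 p2 da g og N.
have p0 : 0 < p by apply: lt_le_trans p2.
pose w n k := normc (inner (g n) (e k)) ^+ 2.
have w0 n k : 0 <= w n k by exact: sqr_ge0.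
have X0 n k : 0 <= d k `^ p * w n k by rewrite mulr_ge0 ?powR_ge0.
have key n : ((hnorm (diag d e (g n)) `^ p)%:E <=
    \sum_(0 <= k <oo) (d k `^ p * w n k)%:E)%E.
  have : (0 <= \sum_(0 <= k <oo) (d k `^ p * w n k)%:E)%E.
    by apply: nneseries_ge0 => k _ _; rewrite lee_fin.
  case E : (\sum_(0 <= k <oo) _)%E => [x| |]// x0; last by rewrite leey.
  rewrite lee_fin -sqr_powR_half//; rewrite lee_fin in x0.
  (* The limit at hand is that of squared norms, so the comparison of partial sums is made at
     exponent 2. *)
  have -> : x = (x `^ (2 / p)) `^ (p / 2).
    by rewrite -powRrM -mulrA mulKf ?gt_eqF// divff// powRr1.
  rewrite ge0_ler_powR ?nnegrE ?sqr_ge0 ?powR_ge0 ?divr_ge0 ?(ltW p0)//.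
  have h := diag_hnorm (u := g n) cH oe dM.
  rewrite -(cvg_lim _ h)//; apply: limr_le; first exact: cvgP h.
  apply: nearW => K.
  rewrite -[leLHS]powRr1 ?sumr_ge0// => [|k _]; last by rewrite mulr_ge0 ?sqr_ge0.
  have {1}-> : 1 = p / 2 * (2 / p) by rewrite mulrA divfK// mulfV// gt_eqF.
  rewrite powRrM ge0_ler_powR ?nnegrE ?powR_ge0 ?divr_ge0 ?(ltW p0)//.
  under eq_bigr do rewrite mulrC.
  apply: (@le_trans _ _ (\sum_(0 <= k < K) w n k * (d k ^+ 2) `^ (p / 2))).
    apply: jensen_powR_convex; [exact: w0|by move=> k; apply: sqr_ge0| |].
      by apply: (le_trans (bessel K (g n) oe)); rewrite expr_le1// orthoseq_le1.
    by rewrite ler_pdivlMr// mul1r.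
  under eq_bigr do rewrite sqr_powR_half// mulrC.
  by rewrite -lee_fin -E; exact: nneseries_ge.
rewrite -lee_fin -da -sumEFin.
(* After exchanging the sums, Bessel's inequality for e_k against g bounds the total weight of each
   d_k^p by 1. *)
apply: (le_trans (lee_sum _ (fun n _ => key n))).
rewrite -nneseries_sum_nat; last by move=> i j; rewrite lee_fin.
apply: lee_nneseries => [k _ _|k _].
  by apply: sume_ge0 => n _; rewrite lee_fin.
rewrite sumEFin lee_fin -mulr_sumr -[leRHS]mulr1 ler_wpM2l ?powR_ge0//.
under eq_bigr do rewrite /w normc_innerC.
by apply: (le_trans (bessel N (e k) og)); rewrite expr_le1// orthoseq_le1.
Qed.

(* Hoelder's inequality for |T^*| = |A^* Y^*|: on the left singular vectors
   [g n] of [Y], [A^* Y^*] is [s n *: A^* (e n)]. *)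
Lemma powsum_hoelder {H0 H1 H2 H3 : preHilbertType R}
    (T : H0 -> H3) (S : H3 -> H0) (t : nat -> R) (h : nat -> H0)
    (Y : H2 -> H3) (Y' : H3 -> H2) (s : nat -> R) (e : nat -> H2)
    (A : H1 -> H2) (A' : H2 -> H1) (p q r a : R) :
  svd T S t h -> svd Y Y' s e -> is_adjoint A A' ->
  (forall v, T (S v) = Y (A (A' (Y' v)))) ->
  power_summing A' p a -> 0 <= a -> 0 < p -> 0 < q -> 0 < r ->
  r^-1 = q^-1 + p^-1 -> r <= 2 ->
  (powsum r t `^ r^-1 <= powsum q s `^ q^-1 * a%:E)%E.
Proof.
move=> DT DY AA' TSE A'a a0 p0 q0 r0 rE r2.
pose g := left_vectors Y s e; have og := orthoseq_left_vectors DY.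
have lA' := adjoint_linear AA'.
have Sg n : hnorm (S (g n)) = s n * hnorm (A' (e n)).
  have -> : hnorm (S (g n)) = hnorm (A' (Y' (g n))).
    apply/eqP; rewrite -(@eqrXn2 _ 2)//; apply/eqP/complexI.
    rewrite -!inner_hnorm -(svd_adjoint DT) TSE (svd_adjoint DY) (AA').
    by rewrite innerC -innerC.
  rewrite (svd_adjoint_vectors _ DY) (linear_mapZ lA') hnormZR ger0_norm//.
  exact: svd_ge0 DY n.
have parseval k : 0 < t k ->
    (1 <= \sum_(0 <= n <oo) (normc (inner (left_vectors T t h k) (g n)) ^+ 2)%:E)%E.
  (* The left vectors of T with t_k > 0 lie in the range of Y, since t_k^2 times such a vector is
     its image under T S = Y A A' Y'. *)
  move=> tk; have [z zE] : exists z, left_vectors T t h k = Y z.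
    have D' := svd_adjoint_sym DT.
    have lY := adjoint_linear (is_adjointC (svd_adjoint DY)).
    exists (((t k ^+ 2)^-1)%:C *: A (A' (Y' (left_vectors T t h k)))).
    rewrite (linear_mapZ lY) -TSE (svd_eigen D') scalerA -rmorphM mulVf ?scale1r//.
    by rewrite sqrf_eq0 gt_eqF.
  by rewrite zE; apply: (svd_parseval_range DY); rewrite -zE (svd_norm_left_vectors DT).
have r02 : 0 < r <= 2 by rewrite r0.
have main := svd_powsum_le (svd_adjoint_sym DT) og parseval r02.
have s0 := svd_ge0 DY.
have [rq rp] : 0 < r / q /\ 0 < r / p by rewrite !divr_gt0.
have rqp : r / q + r / p = 1 by rewrite -mulrDr -rE mulfV// gt_eqF.
have powsum_le : (powsum r t <= powsum q s `^ (r / q) * (a `^ r)%:E)%E.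
  apply: le_trans main _; apply: nneseries_le => [n|N]; first exact: powR_ge0.
  have h1 : \sum_(0 <= n < N) hnorm (S (g n)) `^ r <=
      (\sum_(0 <= n < N) s n `^ q) `^ (r / q) * a `^ r.
    have split_exp (x l : R) : 0 < l -> x `^ r = (x `^ l) `^ (r / l).
      by move=> l0; rewrite -powRrM [l * _]mulrC divfK// gt_eqF.
    rewrite (eq_bigr (fun n => (s n `^ q) `^ (r / q) * (hnorm (A' (e n)) `^ p) `^ (r / p)));
      last by move=> n _; rewrite Sg powRM// -!split_exp.
    apply: le_trans (hoelder_sum N _ _ rq rp rqp) _.
    - by move=> n; exact: powR_ge0.
    - by move=> n; exact: powR_ge0.
    rewrite ler_wpM2l ?powR_ge0//.
    have -> : a `^ r = (a `^ p) `^ (r / p) by rewrite -powRrM mulrC divfK// gt_eqF.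
    rewrite ge0_ler_powR ?nnegrE ?powR_ge0 ?(ltW rp)//.
      by apply: sumr_ge0 => n _; exact: powR_ge0.
    exact: A'a (svd_ortho DY) N.
  apply: (@le_trans _ _ (((\sum_(0 <= n < N) s n `^ q) `^ (r / q) * a `^ r)%:E)).
    by rewrite lee_fin.
  rewrite EFinM lee_wpmul2r ?lee_fin ?powR_ge0// -poweR_EFin.
  apply: lee_poweR; first exact: ltW.
    by rewrite lee_fin; apply: sumr_ge0 => n _; exact: powR_ge0.
  exact: nneseries_ge (fun n => powR_ge0 (s n) q).
apply: (le_trans (lee_poweR _ (powsum_ge0 _ _) powsum_le)).
  by rewrite invr_ge0 ltW.
rewrite poweRM ?poweR_ge0 ?lee_fin ?powR_ge0// -poweRrM poweR_EFin -powRrM.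
by rewrite mulfV ?gt_eqF// powRr1// mulrAC mulfV ?gt_eqF// mul1r.
Qed.

End singular_value_sums.

(** * Products in Schatten classes *)

Section schatten_products.
Context {R : realType}.
Implicit Types (p q r : R).

Lemma schatten_svd {H1 H2 : preHilbertType R} (T : H1 -> H2) S p :
  hcomplete H1 -> schatten p T -> is_adjoint T S ->
  exists e, svd T S (singular_values T) e.
Proof.
move=> cH [cT _ _] TS; have [s [e D]] := svd_exists cT TS.
by exists e; rewrite (svd_singular_values D).
Qed.

(** The adjoint is extracted from the modulus underlying the second clause of [schatten]. *)
Lemma schatten_has_adjoint {H1 H2 : preHilbertType R} (T : H1 -> H2) p :
  schatten p T -> exists S, is_adjoint T S.
Proof. by move=> [_ [s [P [_ [S TS _]] _]] _]; exists S. Qed.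

Lemma schatten_normE {H1 H2 : preHilbertType R} (T : H1 -> H2) S s e p :
  hcomplete H1 -> svd T S s e -> schatten_norm p T = (powsum p s `^ p^-1)%E.
Proof. by move=> cH D; rewrite /schatten_norm (svd_singular_values D). Qed.

Lemma svd_schatten {H1 H2 : preHilbertType R} (T : H1 -> H2) S s e p :
  hcomplete H1 -> compact_operator T -> svd T S s e ->
  (powsum p s `^ p^-1 < +oo)%E -> schatten p T.
Proof.
move=> cH cT D h; split; first exact: cT.
  by exists s; exact: svd_is_singular_values D cH.
by rewrite (schatten_normE _ cH D).
Qed.

Lemma schatten_mono {H1 H2 : preHilbertType R} (T : H1 -> H2) q r :
  hcomplete H1 -> schatten q T -> 0 < q -> q <= r ->
  schatten r T /\ (schatten_norm r T <= schatten_norm q T)%E.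
Proof.
move=> cH sT q0 qr; have [S TS] := schatten_has_adjoint sT.
have [e D] := schatten_svd cH sT TS; have [cT xs nT] := sT.
have le_norm : (schatten_norm r T <= schatten_norm q T)%E.
  by rewrite !(schatten_normE _ cH D); apply: powsum_mono => //; exact: svd_ge0 D.
by split => //; split => //; exact: le_lt_trans nT.
Qed.

Lemma schatten_adjoint {H1 H2 : preHilbertType R} (T : H1 -> H2) S p :
  hcomplete H1 -> hcomplete H2 -> is_adjoint T S -> schatten p S ->
  schatten p T /\ schatten_norm p T = schatten_norm p S.
Proof.
move=> cH1 cH2 TS sS; have [e D] := schatten_svd cH2 sS (is_adjointC TS).
have D' := svd_adjoint_sym D; have [cS xs nS] := sS.
have nE : schatten_norm p T = schatten_norm p S.
  by rewrite (schatten_normE _ cH1 D') (schatten_normE _ cH2 D).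
split; last exact: nE.
apply: (svd_schatten cH1 _ D'); first exact: adjoint_compact TS _.
by rewrite -(schatten_normE _ cH1 D') nE.
Qed.

Lemma schatten_norm_ge0 {H1 H2 : preHilbertType R} (T : H1 -> H2) p :
  (0 <= schatten_norm p T)%E.
Proof. exact: poweR_ge0. Qed.

Lemma schatten_norm_fin {H1 H2 : preHilbertType R} (T : H1 -> H2) p :
  schatten p T -> ((fine (schatten_norm p T))%:E = schatten_norm p T)%E.
Proof.
by move=> [_ _ nT]; rewrite fineK// ge0_fin_numE// schatten_norm_ge0.
Qed.

Lemma schatten_powsum {H1 H2 : preHilbertType R} (T : H1 -> H2) p : 0 < p ->
  schatten p T ->
  (powsum p (singular_values T) = ((fine (schatten_norm p T)) `^ p)%:E)%E.
Proof.
move=> p0 sT; rewrite -poweR_EFin schatten_norm_fin// -poweRrM mulVf ?gt_eqF//.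
by rewrite poweRe1// powsum_ge0.
Qed.

Lemma schatten_hoelder {H0 H1 H2 H3 : preHilbertType R}
    (T : H0 -> H3) (S : H3 -> H0) (Y : H2 -> H3) (Y' : H3 -> H2)
    (A : H1 -> H2) (A' : H2 -> H1) (p q r a : R) :
  hcomplete H0 -> hcomplete H2 -> schatten q Y -> is_adjoint A A' -> 0 <= a ->
  power_summing A' p a -> 0 < p -> 0 < q -> 0 < r -> r <= 2 -> r^-1 = q^-1 + p^-1 ->
  compact_operator T -> is_adjoint T S -> is_adjoint Y Y' ->
  (forall v, T (S v) = Y (A (A' (Y' v)))) ->
  schatten r T /\ (schatten_norm r T <= schatten_norm q Y * a%:E)%E.
Proof.
move=> cH0 cH2 sY AA' a0 A'a p0 q0 r0 r2 rE cT TS YY' TSE; have [t [h D]] := svd_exists cT TS.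
have [e DY] := schatten_svd cH2 sY YY'.
have le_norm := powsum_hoelder D DY AA' TSE A'a a0 p0 q0 r0 rE r2.
have fin : (schatten_norm q Y * a%:E < +oo)%E.
  by rewrite -(schatten_norm_fin sY) -EFinM ltry.
split; last by rewrite (schatten_normE _ cH0 D).
by apply: (svd_schatten cH0 cT D); exact: le_lt_trans fin.
Qed.

Section summing_right_factor.
Context {H1 H2 H3 : preHilbertType R}.
Hypotheses (cH1 : hcomplete H1) (cH2 : hcomplete H2).
Variables (Y : H2 -> H3) (A : H1 -> H2) (A' : H2 -> H1) (p q r a : R).
Hypotheses (sY : schatten q Y) (AA' : is_adjoint A A') (a0 : 0 <= a)
  (A'a : power_summing A' p a).
Hypotheses (p0 : 0 < p) (q0 : 0 < q) (r0 : 0 < r) (r2 : r <= 2)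
  (rE : r^-1 = q^-1 + p^-1).

(** The summing inequality for the system consisting of v / |v| alone; it bounds A and so makes Y A
    compact. *)
Lemma summing_bound v : hnorm (A' v) <= a * hnorm v.
Proof.
have lA' := adjoint_linear AA'.
have [->|v0] := eqVneq v 0; first by rewrite linear_map0// !hnorm0 mulr0.
have nv0 : 0 < hnorm v by rewrite lt_neqAle hnorm_ge0 eq_sym hnorm_eq0 v0.
pose u := ((hnorm v)^-1)%:C *: v.
have og : orthoseq (single_seq u).
  by apply: orthoseq_single; right; rewrite hnormZR ger0_norm ?invr_ge0// mulVf// gt_eqF.
have := A'a og 1; rewrite big_nat1 /= => h.
have : hnorm (A' u) <= a.
  rewrite -[leLHS]powRr1// -[leRHS]powRr1// -(mulfV (negbT (gt_eqF p0))) !powRrM.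
  by rewrite ge0_ler_powR ?nnegrE ?powR_ge0 ?invr_ge0 ?(ltW p0).
rewrite /u (linear_mapZ lA') hnormZR ger0_norm ?invr_ge0//.
by rewrite ler_pdivrMl// mulrC.
Qed.

Lemma schatten_comp_summing :
  schatten r (Y \o A) /\ (schatten_norm r (Y \o A) <= schatten_norm q Y * a%:E)%E.
Proof.
have [Y' YY'] := schatten_has_adjoint sY.
have [cY _ _] := sY.
apply: (schatten_hoelder cH1 cH2 sY AA' a0 A'a p0 q0 r0 r2 rE _
  (is_adjoint_comp YY' AA') YY') => //.
apply: (compact_operator_comp cY (adjoint_linear (is_adjointC AA'))).
exact: adjoint_bound (is_adjointC AA') summing_bound.
Qed.

End summing_right_factor.

Section schatten_comp.
Context {H1 H2 H3 : preHilbertType R}.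
Hypotheses (cH1 : hcomplete H1) (cH2 : hcomplete H2).

(* With [D = |A^*|^(1/N)], [X A] and [X D^N] have the same singular values; each
   factor [D] is in a Schatten class of exponent [N p >= 2], to which
   [schatten_hoelder] applies. *)
Lemma schatten_comp (X : H2 -> H3) (A : H1 -> H2) (p q r : R) :
  schatten q X -> schatten p A -> 0 < p -> 0 < q -> 0 < r -> q <= 2 ->
  r^-1 = q^-1 + p^-1 ->
  schatten r (X \o A) /\
  (schatten_norm r (X \o A) <= schatten_norm q X * schatten_norm p A)%E.
Proof.
move=> sX sA p0 q0 r0 q2 rE.
have [A' AA'] := schatten_has_adjoint sA; have [X' XX'] := schatten_has_adjoint sX.
have [e DA] := schatten_svd cH1 sA AA'; have DA' := svd_adjoint_sym DA.
set s := singular_values A in DA DA'; set f := left_vectors A s e in DA'.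
have of_ : orthoseq f := svd_ortho DA'.
have s0 : forall k, 0 <= s k := svd_ge0 DA.
(* The number of roots is N = n + 1, which is positive by construction. *)
have [n Np2] : exists n : nat, 2 <= n.+1%:R * p.
  by exists (Num.truncn (2 / p)); rewrite -ler_pdivrMr// ltW// truncnS_gt.
set N : R := n.+1%:R in Np2; have N0 : 0 < N by rewrite ltr0n.
have Np0 : 0 < N * p by rewrite mulr_gt0.
pose d k := s k `^ N^-1; have d0 k : 0 <= d k by exact: powR_ge0.
have dM : bounded_seq d (s 0%N `^ N^-1).
  move=> k; rewrite ger0_norm// ge0_ler_powR ?nnegrE ?invr_ge0 ?(ltW N0)//.
  exact: svd_nonincreasing DA _ _ (leq0n k).
pose Dg : H2 -> H2 := diag d f.
have DD : is_adjoint Dg Dg by exact: (diag_adjoint cH2 of_ dM).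
have iter_diag j : exists2 M, bounded_seq (fun k => d k ^+ j.+1) M &
    forall v, iter j.+1 Dg v = diag (fun k => d k ^+ j.+1) f v.
  elim: j => [|j [M jM jE]].
    by exists (s 0%N `^ N^-1) => [k|v]; [rewrite expr1; exact: dM|].
  exists (s 0%N `^ N^-1 * M) => [|v].
    by rewrite (_ : (fun _ => _) = fun k => d k * d k ^+ j.+1); [exact: bounded_seqM|].
  rewrite iterS jE /Dg (diag_comp cH2 of_ _ dM jM).
  by congr (diag _ f v); apply/funext => k; rewrite -exprS.
have dN k : d k ^+ n.+1 = s k.
  by rewrite -powR_mulrn// /d -powRrM mulVf ?gt_eqF// powRr1.
(* A A' is diagonal on the left vectors of A, with entries s_k^2 = d_k^(2 N), and 2 N is
   [(n + n).+2]. *)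
have AA'E v : A (A' v) = iter (n + n).+2 Dg v.
  have [M jM ->] := iter_diag (n + n).+1.
  apply: (hcvg_unique (svd_normal_cvg DA' v)).
  have -> : (fun k => s k * s k) = (fun k => d k ^+ (n + n).+2).
    apply/funext => k; have -> : (n + n).+2 = (n.+1 * 2)%N by rewrite muln2 -addnn addnS.
    by rewrite exprM dN expr2.
  exact: (diag_cvg cH2 of_ _ jM).
pose a := fine (schatten_norm p A).
have a0 : 0 <= a by rewrite fine_ge0// schatten_norm_ge0.
pose b := a `^ N^-1; have b0 : 0 <= b by exact: powR_ge0.
have bN : b ^+ n.+1 = a.
  by rewrite -powR_mulrn// /b -powRrM mulVf ?gt_eqF// powRr1.
have Db : power_summing Dg (N * p) b.
  apply: (diag_power_summing cH2 of_ dM d0 Np2).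
  rewrite /b -powRrM mulKf ?gt_eqF// -(schatten_powsum p0 sA).
  apply: eq_eseriesr => k _.
  by rewrite /d -powRrM mulKf ?gt_eqF.
(* Each factor D adds 1/(N p) to the reciprocal exponent, so t_0 = q and t_N = r; all stay at most q
   <= 2. *)
pose t (j : nat) : R := (q^-1 + j%:R * (N * p)^-1)^-1.
have tV j : (t j)^-1 = q^-1 + j%:R * (N * p)^-1 by rewrite invrK.
have t_gt0 j : 0 < t j.
  by rewrite invr_gt0 ltr_pwDl ?invr_gt0// mulr_ge0// invr_ge0 ltW.
have tS j : (t j.+1)^-1 = (t j)^-1 + (N * p)^-1.
  by rewrite !tV -addrA -[in LHS]natr1 mulrDl mul1r.
have t2 j : t j <= 2.
  rewrite -lef_pV2 ?posrE// tV; apply: (@le_trans _ _ q^-1).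
    by rewrite lef_pV2 ?posrE.
  by rewrite lerDl mulr_ge0// invr_ge0 ltW.
have X_j j : [/\ is_adjoint (X \o iter j Dg) (iter j Dg \o X'),
    schatten (t j) (X \o iter j Dg)
    & (schatten_norm (t j) (X \o iter j Dg) <= schatten_norm q X * (b ^+ j)%:E)%E].
  elim: j => [|j [XXj sXj nXj]].
    by rewrite /t mul0r addr0 invrK expr0 mule1; split.
  have -> : X \o iter j.+1 Dg = (X \o iter j Dg) \o Dg.
    by apply/funext => v /=; rewrite -iterSr.
  have [sY nY] := schatten_comp_summing cH2 cH2 sXj DD b0 Db Np0
    (t_gt0 j) (t_gt0 j.+1) (t2 j.+1) (tS j).
  split=> //; first exact: (is_adjoint_comp XXj DD).
  apply: (le_trans nY); rewrite exprSr EFinM muleA.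
  by rewrite lee_wpmul2r// lee_fin.
have [XXn sXn nXn] := X_j n.
have rE' : r^-1 = (t n)^-1 + (N * p)^-1.
  rewrite -tS tV rE invfM mulrA mulfV ?gt_eqF// mul1r//.
have [cX _ _] := sX.
have lA := adjoint_linear (is_adjointC AA').
have cXA : compact_operator (X \o A).
  exact: (compact_operator_comp cX lA (svd_bound DA)).
have r2 : r <= 2.
  rewrite -lef_pV2 ?posrE// rE (le_trans (_ : _ <= q^-1)) ?lef_pV2 ?posrE//.
  by rewrite lerDl invr_ge0 ltW.
(* The induction stops at n = N - 1. The last factor D is treated with X A itself as the product:
   only T S enters [schatten_hoelder], and here it is (X D^n) D D (X D^n)^*. *)
have XAE v : X (A (A' (X' v))) = X (iter n Dg (Dg (Dg (iter n Dg (X' v))))).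
  by rewrite AA'E -2!iterS -iterD !addnS.
have [sT nT] := schatten_hoelder cH1 cH2 sXn DD b0 Db Np0 (t_gt0 n) r0 r2 rE'
  cXA (is_adjoint_comp XX' AA') XXn XAE.
split=> //; apply: (le_trans nT).
rewrite -(schatten_norm_fin sA) -/a -bN exprSr EFinM muleA.
by rewrite lee_wpmul2r// lee_fin.
Qed.

End schatten_comp.
End schatten_products.

(** * The Hilbert space of square integrable functions *)

Section square_integrable.
Context d (T : measurableType d) (R : realType).
Variable mu : {measure set T -> \bar R}.
Local Notation normc := (@Normc.normc R).
Implicit Types (f g : T -> R[i]) (u v : L2 mu).

Lemma cmeasurableD f g : cmeasurable f -> cmeasurable g -> cmeasurable (fun x => f x + g x).
Proof.
move=> [fr fi] [gr gi]; split.
  rewrite (_ : _ \o _ = (@complex.Re R \o f) \+ (@complex.Re R \o g)).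
    exact: measurable_funD.
  by apply/funext => x /=; rewrite ReD.
rewrite (_ : _ \o _ = (@complex.Im R \o f) \+ (@complex.Im R \o g)).
  exact: measurable_funD.
by apply/funext => x /=; rewrite ImD.
Qed.

Lemma cmeasurableM f g : cmeasurable f -> cmeasurable g -> cmeasurable (fun x => f x * g x).
Proof.
move=> [fr fi] [gr gi]; split.
  rewrite (_ : _ \o _ = ((@complex.Re R \o f) \* (@complex.Re R \o g)) \-
      ((@complex.Im R \o f) \* (@complex.Im R \o g))).
    by apply: measurable_funB; apply: measurable_funM.
  by apply/funext => x /=; rewrite ReM.
rewrite (_ : _ \o _ = ((@complex.Re R \o f) \* (@complex.Im R \o g)) \+
    ((@complex.Im R \o f) \* (@complex.Re R \o g))).
  by apply: measurable_funD; apply: measurable_funM.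
by apply/funext => x /=; rewrite ImM.
Qed.

Lemma cmeasurable_conj f : cmeasurable f -> cmeasurable (fun x => Num.conj (f x)).
Proof.
move=> [fr fi]; split.
  by rewrite (_ : _ \o _ = @complex.Re R \o f)//; apply/funext => x /=; rewrite ReC.
rewrite (_ : _ \o _ = \- (@complex.Im R \o f)); last by apply/funext => x /=; rewrite ImC.
exact: measurable_funN.
Qed.

Lemma cmeasurable_cst (c : R[i]) : cmeasurable (fun _ : T => c).
Proof. by split; exact: measurable_cst. Qed.

Lemma cmeasurableB f g : cmeasurable f -> cmeasurable g -> cmeasurable (fun x => f x - g x).
Proof.
move=> mf mg; rewrite (_ : (fun x => _) = fun x => f x + (-1) * g x).
  by apply: cmeasurableD => //; apply: cmeasurableM => //; exact: cmeasurable_cst.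
by apply/funext => x; rewrite mulN1r.
Qed.

Lemma cmeasurable_L2 u : cmeasurable u.
Proof. by have [] := L2memP u. Qed.

(** The squared modulus with values in the extended reals, so that Tonelli and Fatou apply without
    exponents. *)
Definition sqnorm f : T -> \bar R := fun x => (normc (f x) ^+ 2)%:E.

Lemma sqnorm_ge0 f x : (0 <= sqnorm f x)%E.
Proof. by rewrite lee_fin sqr_ge0. Qed.

Lemma integral_sqnorm_ge0 f : (0 <= \int[mu]_x sqnorm f x)%E.
Proof. by apply: integral_ge0 => x _; exact: sqnorm_ge0. Qed.

Lemma measurable_sqnorm f : cmeasurable f -> measurable_fun [set: T] (sqnorm f).
Proof.
move=> mf; apply/measurable_EFinP; apply: measurable_funX; exact: measurable_cabs.
Qed.

Lemma cL2norm_sqnorm f : (cL2norm mu f `^ 2 = \int[mu]_x sqnorm f x)%E.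
Proof.
rewrite /cL2norm powR_Lnorm//; apply: eq_integral => x _.
by rewrite /= ger0_norm ?cabs_ge0// powR_mulrn ?cabs_ge0.
Qed.

Lemma memL2_sqnorm f : cmeasurable f ->
  memL2 mu f <-> (\int[mu]_x sqnorm f x < +oo)%E.
Proof.
move=> mf; rewrite -cL2norm_sqnorm; split=> [[_ h]|h]; first exact: poweR_lty.
by split => //; apply: lty_poweRy h.
Qed.

Lemma integral_sqnorm f : memL2 mu f ->
  (\int[mu]_x sqnorm f x = (fine (cL2norm mu f) ^+ 2)%:E)%E.
Proof.
move=> [mf nf]; rewrite -cL2norm_sqnorm.
rewrite -[in LHS](@fineK _ (cL2norm mu f)) ?ge0_fin_numE ?Lnorm_ge0//.
by rewrite poweR_EFin powR_mulrn// fine_ge0// Lnorm_ge0.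
Qed.

Lemma hnorm_sqnorm u : ((hnorm u ^+ 2)%:E = \int[mu]_x sqnorm u x)%E.
Proof. by rewrite integral_sqnorm//; exact: L2memP. Qed.

Lemma ae_eq_sqnorm f g : cmeasurable f -> cmeasurable g -> f = g %[ae mu] ->
  (\int[mu]_x sqnorm f x = \int[mu]_x sqnorm g x)%E.
Proof.
move=> mf mg fg; apply: ae_eq_integral => //; try exact: measurable_sqnorm.
by apply: filterS fg => x /(_ I) fgx _; rewrite /sqnorm fgx.
Qed.

Lemma hnorm_toL2 f : memL2 mu f -> ((hnorm (toL2 mu f) ^+ 2)%:E = \int[mu]_x sqnorm f x)%E.
Proof.
move=> fL; rewrite hnorm_sqnorm; apply: ae_eq_sqnorm; first exact: cmeasurable_L2.
  by case: fL.
exact: toL2E.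
Qed.

Lemma L2_aeB u v : ((u - v : L2 mu) : T -> R[i]) = (fun x => u x - v x) %[ae mu].
Proof.
rewrite -scaleN1r; apply: filterS2 (L2_aeD u (-1 *: v)) (L2_aeZ (-1) v).
by move=> x /(_ I) -> /(_ I) -> _; rewrite mulN1r.
Qed.

Lemma hdist_sqnorm u v :
  ((hnorm (u - v) ^+ 2)%:E = \int[mu]_x sqnorm (fun x => u x - v x)%R x)%E.
Proof.
rewrite hnorm_sqnorm; apply: ae_eq_sqnorm; last exact: L2_aeB.
  exact: cmeasurable_L2.
by apply: cmeasurableB; exact: cmeasurable_L2.
Qed.

Lemma memL2_lin (a : R[i]) f g : memL2 mu f -> memL2 mu g ->
  memL2 mu (fun x => a * f x + g x).
Proof.
by move=> fL gL; have [_ /(_ a f g)] := L2pred_submod_closed mu; rewrite !inE; apply.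
Qed.

Lemma memL2D f g : memL2 mu f -> memL2 mu g -> memL2 mu (fun x => f x + g x).
Proof. by move=> fL /(memL2_lin 1 fL); under eq_fun do rewrite mul1r. Qed.

End square_integrable.

(** * Completeness of the space of square integrable functions *)

Section real_sequences.
Context {R : realType}.

(** With z_k = 2 C / 2^k, whose decrements are C / 2^k, the sequence a + z decreases and a - z
    increases. *)
Lemma geometric_steps_cvg (a : nat -> R) (C : R) :
  (forall k, `|a k.+1 - a k| <= C / 2 ^+ k) -> cvgn a.
Proof.
move=> aC; have C0 : 0 <= C.
  by have := aC 0%N; rewrite expr0 divr1; apply: le_trans.
pose z k : R := 2 * C / 2 ^+ k.
have zS k : z k - z k.+1 = C / 2 ^+ k.
  by rewrite /z exprS; field; rewrite expf_neq0.
have z0 k : 0 <= z k by rewrite divr_ge0 ?mulr_ge0// exprn_ge0.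
have dec : nonincreasing_seq (fun k => a k + z k).
  apply/nonincreasing_seqP => k; have := aC k; have := zS k.
  by rewrite ler_norml => h /andP[_]; lra.
have inc : nondecreasing_seq (fun k => a k - z k).
  apply/nondecreasing_seqP => k; have := aC k; have := zS k.
  by rewrite ler_norml => h /andP[+ _]; lra.
have cb : cvgn (fun k => a k + z k).
  apply: nonincreasing_is_cvgn => //; exists (a 0%N - z 0%N) => _ [k _ <-].
  by apply: (le_trans (inc _ _ (leq0n k))); have := z0 k; lra.
have cz : z @ \oo --> 0.
  rewrite (_ : z = geometric (2 * C) (2^-1)).
    by apply: cvg_geometric; rewrite ger0_norm ?invr_ge0// invf_lt1// ltr1n.
  by apply/funext => k; rewrite /z /geometric /= exprVn.
rewrite (_ : a = fun k => (a k + z k) - z k); last by apply/funext => k; rewrite addrK.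
by apply: is_cvgB => //; exact: cvgP cz.
Qed.

Lemma limn_einf_le (u : nat -> \bar R) (c : \bar R) N :
  (forall n, (N <= n)%N -> (u n <= c)%E) -> (limn_einf u <= c)%E.
Proof.
move=> uc; rewrite limn_einf_lim; apply: lime_le; first exact: is_cvg_einfs.
exists N => // n /= Nn; apply: le_trans (uc n Nn).
by apply: ereal_inf_lbound; exists n => /=.
Qed.

End real_sequences.

Lemma ReB (R : realType) (z w : R[i]) : complex.Re (z - w) = complex.Re z - complex.Re w.
Proof. by case: z w => [a b] [a' b']. Qed.

Lemma ImB (R : realType) (z w : R[i]) : complex.Im (z - w) = complex.Im z - complex.Im w.
Proof. by case: z w => [a b] [a' b']. Qed.

Section completeness.
Context d (T : measurableType d) (R : realType).
Variable mu : {measure set T -> \bar R}.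
Local Notation normc := (@Normc.normc R).

(* Riesz-Fischer: along a subsequence with |u_(k+1) - u_k| < 4^-(k+1), the series
   of 4^k |u_(k+1) - u_k|^2 is integrable, hence finite almost everywhere. *)
Lemma L2_complete : hcomplete (L2 mu).
Proof.
move=> u cu.
pose eta k : R := (4 ^+ k.+1)^-1.
have eta0 k : 0 < eta k by rewrite invr_gt0 exprn_gt0.
have /choice[N NP] k := cu _ (eta0 k).
(* Partial sums make the indices nondecreasing while keeping them above [N k]. *)
pose phi k := (\sum_(j < k.+1) N j)%N.
have Nphi k : (N k <= phi k)%N by rewrite /phi big_ord_recr/= leq_addl.
have phiS k : (phi k <= phi k.+1)%N by rewrite {2}/phi big_ord_recr/= leq_addr.
have phi_le k j : (k <= j)%N -> (phi k <= phi j)%N.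
  by apply: (homo_leq _ leq_trans phiS) => // ?.
pose F k : T -> R[i] := fun_of_L2 (u (phi k)).
have mF k : cmeasurable (F k) by exact: cmeasurable_L2.
have dF k j : (k <= j)%N ->
    (\int[mu]_x sqnorm (fun x => F j x - F k x)%R x <= (eta k ^+ 2)%:E)%E.
  move=> kj; rewrite -hdist_sqnorm lee_fin ler_pXn2r ?nnegrE ?(ltW (eta0 k))//.
  by apply/ltW/NP; [exact: leq_trans (Nphi k) (phi_le _ _ kj)|exact: Nphi].
have mFB k j : cmeasurable (fun x => F j x - F k x) by exact: cmeasurableB.
(* The weight 4^k leaves integrals of at most 4^k 4^(-2(k+1)) = 4^(-k-2), still summable. *)
pose h k x := ((4 ^+ k)%:E * sqnorm (fun x => F k.+1 x - F k x)%R x)%E.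
have h0 k x : (0 <= h k x)%E by rewrite mule_ge0 ?sqnorm_ge0// lee_fin exprn_ge0.
have mh k : measurable_fun [set: T] (h k).
  by apply: measurable_funeM; exact: measurable_sqnorm.
have int_h : (\int[mu]_x (\sum_(0 <= k <oo) h k x) < +oo)%E.
  rewrite integral_nneseries//.
  apply: (@le_lt_trans _ _ (\sum_(0 <= k <oo) (1 / (2 ^ (k + 1))%:R)%:E)%E).
    apply: lee_nneseries => [k _ _|k _]; first exact: integral_ge0.
    have -> : (\int[mu]_x h k x =
        (4 ^+ k)%:E * \int[mu]_x sqnorm (fun x => F k.+1 x - F k x)%R x)%E.
      apply: (ge0_integralZl_EFin _ measurableT) => [x _||].
      - exact: sqnorm_ge0.
      - exact: measurable_sqnorm.
      - exact: exprn_ge0.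
    apply: (le_trans (lee_wpmul2l _ (dF k k.+1 (leqnSn k)))).
      by rewrite lee_fin exprn_ge0.
    rewrite -EFinM lee_fin /eta natrX addn1 div1r.
    have -> : (4 ^+ k : R) * (4 ^+ k.+1)^-1 ^+ 2 = (4 ^+ k.+2)^-1.
      by rewrite !exprS; field; rewrite expf_neq0.
    rewrite lef_pV2 ?posrE ?exprn_gt0//.
    apply: (@le_trans _ _ (4 ^+ k.+1)); first by rewrite lerXn2r ?nnegrE// ler_nat.
    by rewrite ler_eXn2l// ltr1n.
  have := @cvg_geometric_eseries_half R 1 0; rewrite expr0 divr1.
  by move=> /cvg_lim ->//; rewrite ltry.
have ae_fin : \forall x \ae mu, (\sum_(0 <= k <oo) h k x < +oo)%E.
  have ih : mu.-integrable [set: T] (fun x => \sum_(0 <= k <oo) h k x)%E.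
    apply/integrableP; split; first exact: ge0_emeasurable_sum.
    by under eq_integral do rewrite gee0_abs ?nneseries_ge0//.
  apply: filterS (integrable_ae measurableT ih) => x /(_ I).
  by rewrite ge0_fin_numE// nneseries_ge0.
(* An upper limit exists and is measurable everywhere; it is the limit only almost everywhere. *)
pose fr x := fine (limn_esup (fun k => (complex.Re (F k x))%:E)).
pose fi x := fine (limn_esup (fun k => (complex.Im (F k x))%:E)).
pose f x : R[i] := fr x +i* fi x.
have mf : cmeasurable f.
  split.
    apply: (measurableT_comp (@fine_measurable R setT measurableT)).
    apply: measurable_fun_limn_esup => k; apply/measurable_EFinP.
    by have [] := mF k.
  apply: (measurableT_comp (@fine_measurable R setT measurableT)).
  apply: measurable_fun_limn_esup => k; apply/measurable_EFinP.
  by have [] := mF k.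
have ae_cvg : \forall x \ae mu,
    (fun k => complex.Re (F k x)) @ \oo --> complex.Re (f x) /\
    (fun k => complex.Im (F k x)) @ \oo --> complex.Im (f x).
  apply: filterS ae_fin => x.
  have : (0 <= \sum_(0 <= k <oo) h k x)%E by exact: nneseries_ge0.
  case E : (\sum_(0 <= k <oo) h k x)%E => [C| |]// C0 _; rewrite lee_fin in C0.
  (* From 4^k |F_(k+1) - F_k|^2 <= C <= (C + 1)^2 at the point x. *)
  have steps k : normc (F k.+1 x - F k x) <= (C + 1) / 2 ^+ k.
    have : (h k x <= C%:E)%E.
      rewrite -E; apply: le_trans (nneseries_lim_ge k.+1 _) => //.
      by rewrite big_nat_recr//= leeDr// sume_ge0.
    rewrite /h -EFinM lee_fin => hC.
    rewrite -(@ler_pXn2r _ 2)// ?nnegrE ?divr_ge0 ?addr_ge0 ?exprn_ge0//.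
    rewrite expr_div_n ler_pdivlMr ?exprn_gt0// exprAC.
    have -> : (2 ^+ 2 : R) = 4 by rewrite expr2 -natrM.
    rewrite mulrC; apply: (le_trans hC); rewrite sqrrD expr1n; nra.
  split.
  - have cr : cvgn (fun k => complex.Re (F k x)).
      apply: (@geometric_steps_cvg _ _ (C + 1)) => k; apply: le_trans (steps k).
      rewrite -ReB.
      exact: (normr_Re_cabs (fun y => F k.+1 y - F k y)).
    have ce : (fun k => (complex.Re (F k x))%:E) @ \oo -->
        (limn (fun k => complex.Re (F k x)))%:E by apply/fine_cvgP; split; [exact: nearW|].
    suff -> : complex.Re (f x) = limn (fun k => complex.Re (F k x)) by [].
    by rewrite /= /fr (cvg_limn_einf_sup ce).2.
  - have ci : cvgn (fun k => complex.Im (F k x)).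
      apply: (@geometric_steps_cvg _ _ (C + 1)) => k; apply: le_trans (steps k).
      rewrite -ImB.
      exact: (normr_Im_cabs (fun y => F k.+1 y - F k y)).
    have ce : (fun k => (complex.Im (F k x))%:E) @ \oo -->
        (limn (fun k => complex.Im (F k x)))%:E by apply/fine_cvgP; split; [exact: nearW|].
    suff -> : complex.Im (f x) = limn (fun k => complex.Im (F k x)) by [].
    by rewrite /= /fi (cvg_limn_einf_sup ce).2.
(* For fixed k, |f - F_k|^2 is almost everywhere the lower limit over j of |F_j - F_k|^2, whose
   integrals are bounded for j >= k. *)
have fatou_f k : (\int[mu]_x sqnorm (fun x => f x - F k x)%R x <= (eta k ^+ 2)%:E)%E.
  pose G j x := sqnorm (fun x => F j x - F k x)%R x.
  have mG j : measurable_fun [set: T] (G j) by exact: measurable_sqnorm.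
  have mfF : cmeasurable (fun x => f x - F k x) by exact: cmeasurableB.
  have -> : (\int[mu]_x sqnorm (fun x => f x - F k x)%R x =
      \int[mu]_x limn_einf (G^~ x))%E.
    apply: ae_eq_integral => //; first exact: measurable_sqnorm.
      under eq_fun do rewrite -[limn_einf _]oppeK -limn_esupN.
      apply: measurableT_comp => //; apply: measurable_fun_limn_esup => j.
      exact: measurableT_comp.
    apply: filterS ae_cvg => x [cr ci] _.
    have sqE (z : R[i]) : normc z ^+ 2 = complex.Re z ^+ 2 + complex.Im z ^+ 2.
      exact: (cabsE (fun _ : T => z) x).
    suff : (fun j => G j x) @ \oo --> sqnorm (fun x => f x - F k x) x.
      by move/cvg_limn_einf_sup => -[-> _].
    apply/fine_cvgP; split; first exact: nearW.
    rewrite [X in X @ _ --> _](_ : _ = fun j => normc (F j x - F k x) ^+ 2)//.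
    rewrite sqE ReB ImB /comp /=.
    under eq_fun do rewrite sqE ReB ImB.
    apply: cvgD; rewrite expr2; under eq_fun do rewrite expr2;
      by apply: cvgM; apply: cvgB => //; exact: cvg_cst.
  apply: (le_trans (fatou _ measurableT mG _)) => [j x _|]; first exact: sqnorm_ge0.
  by apply: (@limn_einf_le _ _ _ k) => j; exact: dF.
have fFL k : memL2 mu (fun x => f x - F k x).
  apply/memL2_sqnorm; first exact: cmeasurableB.
  by apply: le_lt_trans (fatou_f k) _; exact: ltry.
have FL k : memL2 mu (F k) by exact: L2memP.
have fL : memL2 mu f.
  by have := memL2D (fFL 0%N) (FL 0%N); under eq_fun do rewrite subrK.
exists (toL2 mu f).
have dist k : hnorm (u (phi k) - toL2 mu f) <= eta k.
  rewrite hdistC -(@ler_pXn2r _ 2)// ?nnegrE ?(ltW (eta0 k))// -lee_fin.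
  apply: le_trans (fatou_f k); rewrite hdist_sqnorm le_eqVlt; apply/orP; left; apply/eqP.
  apply: ae_eq_sqnorm; first by apply: cmeasurableB => //; exact: cmeasurable_L2.
    exact: cmeasurableB.
  by apply: filterS (toL2E fL) => x /(_ I) -> _.
apply/hcvgP => eps e0.
have [K KP] : exists K, eta K < eps / 2.
  exists (Num.truncn (2 / eps)); rewrite /eta invf_plt ?posrE ?exprn_gt0 ?divr_gt0//.
  rewrite invf_div; apply: lt_le_trans (truncnS_gt _) _.
  by rewrite -natrX ler_nat ltnW// ltn_expl.
exists (phi K) => n Kn; apply: le_lt_trans (ler_hdistD (u (phi K)) _ _) _.
rewrite (splitr eps); apply: ltrD; last exact: le_lt_trans (dist K) KP.
by apply: lt_trans KP; apply: NP => //; exact: leq_trans (Nphi K) Kn.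
Qed.
End completeness.

(** * Complex conjugation *)

Section L2_conjugation.
Context d (T : measurableType d) (R : realType).
Variable mu : {measure set T -> \bar R}.
Implicit Types (f g : T -> R[i]) (u v : L2 mu).
Local Notation normc := (@Normc.normc R).

Lemma memL2_conj f : memL2 mu f -> memL2 mu (fun x => Num.conj (f x)).
Proof.
move=> [mf nf]; split; first exact: cmeasurable_conj.
rewrite /cL2norm (_ : cabs _ = cabs f)//; apply/funext => x.
exact: normc_conj.
Qed.

Definition conjL2 u : L2 mu := toL2 mu (fun x => Num.conj (u x)).

Lemma conjL2E u : (conjL2 u : T -> R[i]) = (fun x => Num.conj (u x)) %[ae mu].
Proof. by apply: toL2E; apply: memL2_conj; exact: L2memP. Qed.

Lemma conjL2K u : conjL2 (conjL2 u) = u.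
Proof.
apply/L2_aeP; apply: filterS2 (conjL2E (conjL2 u)) (conjL2E u).
by move=> x /(_ I) -> /(_ I) -> _; rewrite conjCK.
Qed.

Lemma inner_cintegral u v : inner u v = cintegral mu (fun x => u x * Num.conj (v x)).
Proof. by []. Qed.

Lemma cmeasurable_mulL2 f v : cmeasurable f -> cmeasurable (fun x => f x * Num.conj (v x)).
Proof.
by move=> mf; apply: cmeasurableM => //; apply: cmeasurable_conj; exact: cmeasurable_L2.
Qed.

Lemma inner_toL2 f v : memL2 mu f ->
  inner (toL2 mu f) v = cintegral mu (fun x => f x * Num.conj (v x)).
Proof.
move=> fL; rewrite inner_cintegral; apply: ae_eq_cintegral.
- exact/cmeasurable_mulL2/cmeasurable_L2.
- by apply: cmeasurable_mulL2; case: fL.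
- by apply: filterS (toL2E fL) => x /(_ I) -> _.
Qed.

(** Turns the bilinear integral of a kernel against a function into an inner product, so that
    Bessel, Cauchy-Schwarz and adjoints apply to it. *)
Lemma inner_toL2_conj f v : memL2 mu f ->
  inner (toL2 mu f) (conjL2 v) = cintegral mu (fun x => f x * v x).
Proof.
move=> fL; have mf := fL.1; rewrite inner_toL2//; apply: ae_eq_cintegral.
- exact: cmeasurable_mulL2.
- by apply: cmeasurableM => //; exact: cmeasurable_L2.
- by apply: filterS (conjL2E v) => x /(_ I) -> _; rewrite conjCK.
Qed.

Lemma inner_conjr u v : inner u (conjL2 v) = cintegral mu (fun x => u x * v x).
Proof. by rewrite -[u in LHS]toL2K inner_toL2_conj//; exact: L2memP. Qed.

Lemma inner_conjC u v : inner u (conjL2 v) = inner v (conjL2 u).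
Proof. by rewrite !inner_conjr; congr cintegral; apply/funext => x; rewrite mulrC. Qed.

Lemma inner_conjL2 u v : inner (conjL2 u) (conjL2 v) = Num.conj (inner u v).
Proof. by rewrite inner_conjC conjL2K innerC. Qed.

Lemma conjL2_semilinear (a : R[i]) u v :
  conjL2 (a *: u + v) = Num.conj a *: conjL2 u + conjL2 v.
Proof.
apply: inner_ext => w; rewrite -[w]conjL2K inner_conjL2 !innerDl !innerZl !inner_conjL2.
by rewrite -conj_mul rmorphD.
Qed.

End L2_conjugation.

Section conjugation.
Context {R : realType}.

(** An antiunitary involution. It is not linear itself, but T framed by two of them is. *)
Record conjugation {H : preHilbertType R} (J : H -> H) : Prop := Conjugation {
  conjugation_semilinear : forall a u v, J (a *: u + v) = Num.conj a *: J u + J v ;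
  conjugation_inner : forall u v, inner (J u) (J v) = Num.conj (inner u v) ;
  conjugationK : forall u, J (J u) = u
}.

Section one_space.
Context {H : preHilbertType R} (J : H -> H).
Hypothesis cJ : conjugation J.

Lemma conjugation0 : J 0 = 0.
Proof.
have := conjugation_semilinear cJ (-1) 0 0.
by rewrite scaler0 addr0 rmorphN1 scaleN1r addNr.
Qed.

Lemma conjugationD u v : J (u + v) = J u + J v.
Proof. by have := conjugation_semilinear cJ 1 u v; rewrite rmorph1 !scale1r. Qed.

Lemma conjugationZ a u : J (a *: u) = Num.conj a *: J u.
Proof. by have := conjugation_semilinear cJ a u 0; rewrite !addr0 conjugation0 addr0. Qed.

Lemma conjugationB u v : J (u - v) = J u - J v.
Proof. by rewrite conjugationD -scaleN1r conjugationZ rmorphN1 scaleN1r. Qed.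

Lemma conjugation_sum I (r : seq I) (F : I -> H) :
  J (\sum_(i <- r) F i) = \sum_(i <- r) J (F i).
Proof. exact: (big_morph J conjugationD conjugation0). Qed.

Lemma conjugation_innerr u v : inner u (J v) = Num.conj (inner (J u) v).
Proof. by rewrite -[u in LHS](conjugationK cJ) (conjugation_inner cJ). Qed.

Lemma conjugation_hnorm u : hnorm (J u) = hnorm u.
Proof.
apply/eqP; rewrite -(@eqrXn2 _ 2)//; apply/eqP/complexI.
by rewrite -!inner_hnorm (conjugation_inner cJ) -innerC.
Qed.

Lemma conjugation_orthoseq e : orthoseq e -> orthoseq (J \o e).
Proof.
move=> [oe ne]; split=> [j k jk|k] /=; first by rewrite (conjugation_inner cJ) oe// conjC0.
by rewrite conjugation_hnorm; case: (ne k) => [->|->]; [left; rewrite conjugation0|right].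
Qed.

End one_space.

Section two_spaces.
Context {H1 H2 : preHilbertType R} (J1 : H1 -> H1) (J2 : H2 -> H2).
Hypotheses (cJ1 : conjugation J1) (cJ2 : conjugation J2).
Implicit Types (T : H1 -> H2) (S : H2 -> H1).

Lemma conjugation_linear T : linear T -> linear (J2 \o T \o J1).
Proof.
move=> lT a u v /=; rewrite (conjugation_semilinear cJ1) lT.
by rewrite (conjugation_semilinear cJ2) conjCK.
Qed.

Lemma conjugation_adjoint T S : is_adjoint T S ->
  is_adjoint (J2 \o T \o J1) (J1 \o S \o J2).
Proof.
by move=> TS u v /=; rewrite (conjugation_innerr cJ1) -TS (conjugation_innerr cJ2) conjCK.
Qed.

Lemma conjugation_compact T : compact_operator T -> compact_operator (J2 \o T \o J1).
Proof.
move=> [lT pT]; split; first exact: conjugation_linear.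
have cont : continuous J2.
  apply: (@hnorm_continuous _ _ _ _ 1) => u v.
  by rewrite -(conjugationB cJ2) (conjugation_hnorm cJ2) mul1r.
apply: precompact_subset (precompact_image cont pT) => _ [u /= u1 <-].
exists (T (J1 u)) => //; exists (J1 u) => //=.
by move: u1; rewrite !hnormE (conjugation_hnorm cJ1).
Qed.

(** The singular values are unchanged because the eigenvalues s_k^2 of S T are real, hence fixed by
    conjugation. *)
Lemma conjugation_svd T S s e : svd T S s e ->
  svd (J2 \o T \o J1) (J1 \o S \o J2) s (J1 \o e).
Proof.
move=> D; split.
- exact: conjugation_adjoint (svd_adjoint D).
- exact: conjugation_orthoseq (svd_ortho D).
- exact: svd_ge0 D.
- exact: svd_nonincreasing D.
- exact: svd_cvg D.
- move=> k /=; rewrite (conjugationK cJ1) (conjugationK cJ2) (svd_eigen D).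
  by rewrite (conjugationZ cJ1) conj_real.
- by move=> k sk0 /=; rewrite (conjugation_hnorm cJ1) (svd_norm D).
- move=> n u /=; rewrite (conjugation_hnorm cJ2) (conjugationB cJ1).
  rewrite [J1 (oproj _ _ _)](_ : _ = oproj e n (J1 u)).
    by rewrite -[hnorm u](conjugation_hnorm cJ1) (svd_approx D).
  rewrite /oproj (conjugation_sum cJ1); apply: eq_bigr => k _ /=.
  by rewrite (conjugationZ cJ1) (conjugationK cJ1) (conjugation_innerr cJ1) conjCK.
Qed.

Lemma conjugation_schatten T p : hcomplete H1 -> schatten p T ->
  schatten p (J2 \o T \o J1) /\ schatten_norm p (J2 \o T \o J1) = schatten_norm p T.
Proof.
move=> cH sT; have [S TS] := schatten_has_adjoint sT.
have [e D] := schatten_svd cH sT TS; have D' := conjugation_svd D.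
have [cT _ nT] := sT.
have nE : schatten_norm p (J2 \o T \o J1) = schatten_norm p T.
  by rewrite (schatten_normE _ cH D') (schatten_normE _ cH D).
have cJT := conjugation_compact cT.
split; last exact: nE.
by apply: (svd_schatten cH cJT D'); rewrite -(schatten_normE _ cH D).
Qed.

End two_spaces.
End conjugation.

(** * Integral operators *)

Section kernels.
Context d1 d2 (T1 : measurableType d1) (T2 : measurableType d2) (R : realType).
Variables (mu1 : {sigma_finite_measure set T1 -> \bar R})
  (mu2 : {sigma_finite_measure set T2 -> \bar R}).
Implicit Types (K G H : T2 * T1 -> R[i]) (f : L2 mu1) (v : L2 mu2).
Local Notation normc := (@Normc.normc R).

Lemma cmeasurable_left K x : cmeasurable K -> cmeasurable (fun y => K (x, y)).
Proof.
by move=> [kr ki]; split; [exact: (measurableT_comp kr (pair1_measurable x))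
  |exact: (measurableT_comp ki (pair1_measurable x))].
Qed.

Lemma cmeasurable_fst (g : T2 -> R[i]) : cmeasurable g ->
  cmeasurable (fun z : T2 * T1 => g z.1).
Proof.
by move=> [gr gi]; split; [exact: (measurableT_comp gr measurable_fst)
  |exact: (measurableT_comp gi measurable_fst)].
Qed.

Lemma cmeasurable_snd (g : T1 -> R[i]) : cmeasurable g ->
  cmeasurable (fun z : T2 * T1 => g z.2).
Proof.
by move=> [gr gi]; split; [exact: (measurableT_comp gr measurable_snd)
  |exact: (measurableT_comp gi measurable_snd)].
Qed.

(** Sections may fail to be integrable, so the positive and negative parts are treated separately by
    Tonelli. *)
Lemma measurable_fun_integral_section (h : T2 * T1 -> \bar R) :
  measurable_fun [set: T2 * T1] h ->
  measurable_fun [set: T2] (fun x => \int[mu1]_y h (x, y))%E.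
Proof.
move=> mh; under eq_fun do rewrite integralE.
apply: emeasurable_funB.
  have E x : (fun y => h (x, y))^\+%E = (h^\+ \o pair x)%E by exact: (funepos_comp h (pair x)).
  under eq_fun do rewrite E.
  exact: (measurable_fun_fubini_tonelli_F (m2 := mu1) (h^\+)%E (measurable_funepos mh)
    (fun z => funepos_ge0 h z)).
have E x : (fun y => h (x, y))^\-%E = (h^\- \o pair x)%E by exact: (funeneg_comp h (pair x)).
under eq_fun do rewrite E.
exact: (measurable_fun_fubini_tonelli_F (m2 := mu1) (h^\-)%E (measurable_funeneg mh)
  (fun z => funeneg_ge0 h z)).
Qed.

Lemma cmeasurable_cintegral H : cmeasurable H ->
  cmeasurable (fun x => cintegral mu1 (fun y => H (x, y))).
Proof.
move=> [hr hi]; split; apply: (measurableT_comp (@fine_measurable R setT measurableT)).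
  by apply: (measurable_fun_integral_section (h := EFin \o (@complex.Re R \o H)));
    exact/measurable_EFinP.
by apply: (measurable_fun_integral_section (h := EFin \o (@complex.Im R \o H)));
    exact/measurable_EFinP.
Qed.

Lemma tonelli_sqnorm K : cmeasurable K ->
  (\int[mu2 \x mu1]_z sqnorm K z =
   \int[mu2]_x \int[mu1]_y sqnorm (fun y => K (x, y)) y)%E.
Proof.
move=> mK; rewrite (fubini_tonelli1 (sqnorm K))//; first exact: measurable_sqnorm.
exact: sqnorm_ge0.
Qed.

Lemma tonelli_sqnorm_swap K : cmeasurable K ->
  (\int[mu2 \x mu1]_z sqnorm K z =
   \int[mu1]_y \int[mu2]_x sqnorm (fun x => K (x, y)) x)%E.
Proof.
move=> mK; rewrite (fubini_tonelli2 (sqnorm K))//; first exact: measurable_sqnorm.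
exact: sqnorm_ge0.
Qed.

Lemma ae_memL2_left K : memL2 (mu2 \x mu1)%E K ->
  \forall x \ae mu2, memL2 mu1 (fun y => K (x, y)).
Proof.
move=> KL; have mK := KL.1.
have : (\int[mu2]_x \int[mu1]_y sqnorm (fun y => K (x, y)) y < +oo)%E.
  by rewrite -tonelli_sqnorm//; apply/memL2_sqnorm.
move=> fin.
have ih : mu2.-integrable [set: T2] (fun x => \int[mu1]_y sqnorm (fun y => K (x, y)) y)%E.
  apply/integrableP; split.
    by apply: (@measurable_fun_integral_section (sqnorm K)); exact: measurable_sqnorm.
  under eq_integral do rewrite gee0_abs ?integral_sqnorm_ge0//.
  exact: fin.
apply: filterS (integrable_ae measurableT ih) => x /(_ I).
rewrite ge0_fin_numE ?integral_sqnorm_ge0// => h.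
by apply/memL2_sqnorm => //; exact: cmeasurable_left.
Qed.

(** The inner real integrals agree with the extended ones where the section is integrable, that is
    almost everywhere. *)
Lemma Rintegral_fubini (h : T2 * T1 -> R) :
  (mu2 \x mu1)%E.-integrable [set: T2 * T1] (EFin \o h) ->
  \int[mu2]_x \int[mu1]_y h (x, y) = \int[mu1]_y \int[mu2]_x h (x, y).
Proof.
move=> ih; rewrite /Rintegral; congr fine.
have F := measurable_fubini_F ih; have G := measurable_fubini_G ih.
transitivity (\int[mu2]_x \int[mu1]_y (h (x, y))%:E)%E.
  apply: ae_eq_integral => //.
  - apply/measurable_EFinP; apply: (measurableT_comp (@fine_measurable R setT measurableT)).
    exact: F.
  - apply: filterS (ae_integrable1 ih) => x xi _.
    by rewrite fineK//; exact: integrable_fin_num xi.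
rewrite (Fubini ih); apply: ae_eq_integral => //.
- apply/measurable_EFinP; apply: (measurableT_comp (@fine_measurable R setT measurableT)).
  exact: G.
- apply: filterS (ae_integrable2 ih) => x xi _.
    by rewrite fineK//; exact: integrable_fin_num xi.
Qed.

Lemma cintegral_fubini H : cintegrable (mu2 \x mu1)%E H ->
  cintegral mu2 (fun x => cintegral mu1 (fun y => H (x, y))) =
  cintegral mu1 (fun y => cintegral mu2 (fun x => H (x, y))).
Proof.
move=> [hr hi]; rewrite /cintegral /=; congr (_ +i* _).
  exact: (Rintegral_fubini hr).
exact: (Rintegral_fubini hi).
Qed.

End kernels.

Section kernel_swap.
Context d1 d2 (T1 : measurableType d1) (T2 : measurableType d2) (R : realType).
Variables (mu1 : {sigma_finite_measure set T1 -> \bar R})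
  (mu2 : {sigma_finite_measure set T2 -> \bar R}).

Definition kernel_swap (K : T2 * T1 -> R[i]) : T1 * T2 -> R[i] := fun z => K (z.2, z.1).

Lemma cmeasurable_swap K : cmeasurable K -> cmeasurable (kernel_swap K).
Proof.
have ms : measurable_fun [set: T1 * T2] (fun z => (z.2, z.1)).
  by apply: measurable_fun_pair; [exact: measurable_snd|exact: measurable_fst].
by move=> [kr ki]; split; [exact: (measurableT_comp kr ms)|exact: (measurableT_comp ki ms)].
Qed.

Lemma integral_sqnorm_swap K : cmeasurable K ->
  (\int[mu1 \x mu2]_z sqnorm (kernel_swap K) z = \int[mu2 \x mu1]_z sqnorm K z)%E.
Proof.
by move=> mK; rewrite tonelli_sqnorm ?tonelli_sqnorm_swap//; exact: cmeasurable_swap.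
Qed.

Lemma memL2_swap K : memL2 (mu2 \x mu1)%E K -> memL2 (mu1 \x mu2)%E (kernel_swap K).
Proof.
move=> KL; have mK := KL.1; apply/memL2_sqnorm; first exact: cmeasurable_swap.
by rewrite integral_sqnorm_swap//; apply/memL2_sqnorm.
Qed.

Lemma cL2norm_swap K : memL2 (mu2 \x mu1)%E K ->
  fine (cL2norm (mu1 \x mu2)%E (kernel_swap K)) = fine (cL2norm (mu2 \x mu1)%E K).
Proof.
move=> KL; apply/eqP; rewrite -(@eqrXn2 _ 2)// ?fine_ge0 ?Lnorm_ge0//.
apply/eqP/EFin_inj; rewrite -!integral_sqnorm//; last exact: memL2_swap.
exact: integral_sqnorm_swap KL.1.
Qed.

End kernel_swap.

Lemma conjL2_conjugation d (T : measurableType d) (R : realType)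
    (mu : {measure set T -> \bar R}) : conjugation (@conjL2 d T R mu).
Proof.
split; [exact: conjL2_semilinear|exact: inner_conjL2|exact: conjL2K].
Qed.

Lemma cintegralZ d (T : measurableType d) (R : realType) (mu : {measure set T -> \bar R})
    (c : R[i]) (f : T -> R[i]) : cintegrable mu f ->
  cintegral mu (fun x => c * f x) = c * cintegral mu f.
Proof.
move=> fi; have i0 : cintegrable mu (fun=> 0 : R[i]) by split; exact: integrable0.
have z0 : cintegral mu (fun=> 0 : R[i]) = 0 by rewrite /cintegral /Rintegral /= !integral0.
by have := cintegral_linear c fi i0; under eq_fun do rewrite addr0; rewrite z0 addr0.
Qed.

Section integral_operators.
Context d1 d2 (T1 : measurableType d1) (T2 : measurableType d2) (R : realType).
Variables (mu1 : {sigma_finite_measure set T1 -> \bar R})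
  (mu2 : {sigma_finite_measure set T2 -> \bar R}).
Implicit Types (K : T2 * T1 -> R[i]) (f : L2 mu1) (v : L2 mu2).
Local Notation normc := (@Normc.normc R).

Lemma cmeasurable_integral_operator K f : cmeasurable K ->
  cmeasurable (fun x => cintegral mu1 (fun y => K (x, y) * f y)).
Proof.
move=> mK; apply: (cmeasurable_cintegral mu1 (H := fun z => K z * f z.2)).
apply: cmeasurableM => //; apply: cmeasurable_snd; exact: cmeasurable_L2.
Qed.

Lemma sum_integral_operator_le K (g : nat -> L2 mu1) N : memL2 (mu2 \x mu1)%E K ->
  orthoseq g ->
  (\sum_(0 <= n < N) \int[mu2]_x
      sqnorm (fun x => cintegral mu1 (fun y => K (x, y) * g n y)%R) x
   <= \int[mu2 \x mu1]_z sqnorm K z)%E.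
Proof.
move=> KL og; have mK := KL.1.
have mF n : measurable_fun [set: T2]
    (sqnorm (fun x => cintegral mu1 (fun y => K (x, y) * g n y))).
  exact/measurable_sqnorm/cmeasurable_integral_operator.
rewrite -ge0_integral_sum//; last by move=> n x _; exact: sqnorm_ge0.
rewrite tonelli_sqnorm//; apply: ae_ge0_le_integral => //.
- by move=> x _; apply: sume_ge0 => n _; exact: sqnorm_ge0.
- exact: emeasurable_sum.
- by move=> x _; exact: integral_sqnorm_ge0.
- exact: (measurable_fun_integral_section mu1 (h := sqnorm K) (measurable_sqnorm mK)).
apply: filterS (ae_memL2_left KL) => x Kx _.
under eq_bigr do rewrite /sqnorm -inner_toL2_conj//.
(* The n-th value at x is now the inner product of K(x, .) with the conjugate of g_n, and conjugates
   of an orthonormal family are orthonormal. *)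
rewrite sumEFin -hnorm_toL2// lee_fin.
exact: (bessel N (toL2 mu1 (fun y => K (x, y)))
  (conjugation_orthoseq (conjL2_conjugation mu1) og)).
Qed.

End integral_operators.

Lemma cintegrable_mul d (T : measurableType d) (R : realType) (mu : {measure set T -> \bar R})
    (f g : T -> R[i]) : memL2 mu f -> memL2 mu g -> cintegrable mu (fun x => f x * g x).
Proof. by move=> fL /memL2_conj /(memL2_mul_conj fL); under eq_fun do rewrite conjCK. Qed.

Section integral_operators_L2.
Context d1 d2 (T1 : measurableType d1) (T2 : measurableType d2) (R : realType).
Variables (mu1 : {sigma_finite_measure set T1 -> \bar R})
  (mu2 : {sigma_finite_measure set T2 -> \bar R}).
Implicit Types (K : T2 * T1 -> R[i]) (f : L2 mu1) (v : L2 mu2).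
Local Notation normc := (@Normc.normc R).

Lemma memL2_integral_operator K f : memL2 (mu2 \x mu1)%E K ->
  memL2 mu2 (fun x => cintegral mu1 (fun y => K (x, y) * f y)).
Proof.
move=> KL; have mK := KL.1; have mTf := cmeasurable_integral_operator f mK.
apply/memL2_sqnorm => //.
apply: (@le_lt_trans _ _ ((hnorm f ^+ 2)%:E * \int[mu2 \x mu1]_z sqnorm K z)%E); last first.
  rewrite integral_sqnorm// -EFinM; exact: ltry.
rewrite tonelli_sqnorm//.
have mS := measurable_fun_integral_section mu1 (h := sqnorm K) (measurable_sqnorm mK).
rewrite -(ge0_integralZl_EFin mu2 measurableT (fun x _ => integral_sqnorm_ge0 _ _) mS
  (sqr_ge0 _)).
apply: ae_ge0_le_integral => //.
- by move=> x _; exact: sqnorm_ge0.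
- exact: measurable_sqnorm.
- by move=> x _; rewrite mule_ge0 ?integral_sqnorm_ge0// lee_fin sqr_ge0.
- by apply: measurable_funeM; exact: mS.
apply: filterS (ae_memL2_left KL) => x Kx _.
rewrite /sqnorm -inner_toL2_conj// -hnorm_toL2// -EFinM lee_fin mulrC -exprMn.
rewrite ler_pXn2r ?nnegrE ?mulr_ge0//.
apply: le_trans (cauchy_schwarz _ _) _.
by rewrite (conjugation_hnorm (conjL2_conjugation mu1)).
Qed.

Lemma integral_operator_power_summing K : memL2 (mu2 \x mu1)%E K ->
  power_summing (integral_operator mu1 mu2 K) 2 (fine (cL2norm (mu2 \x mu1)%E K)).
Proof.
move=> KL g og N; under eq_bigr do rewrite powR_mulrn//.
rewrite powR_mulrn ?fine_ge0 ?Lnorm_ge0// -lee_fin -integral_sqnorm// -sumEFin.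
rewrite (eq_bigr _ (fun n _ => hnorm_toL2 (memL2_integral_operator (g n) KL))).
exact: sum_integral_operator_le.
Qed.

(** Its product with K in the inner product of the product space gives the integrability of K(x, y)
    f(y) conj(v(x)) that Fubini requires. *)
Lemma memL2_tensor f v : memL2 (mu2 \x mu1)%E (fun z => Num.conj (f z.2) * v z.1).
Proof.
have mf := cmeasurable_L2 f; have mv := cmeasurable_L2 v.
have mW : cmeasurable (fun z : T2 * T1 => Num.conj (f z.2) * v z.1).
  apply: cmeasurableM; last exact: cmeasurable_fst.
  exact/cmeasurable_conj/(cmeasurable_snd _ mf).
apply/memL2_sqnorm => //; rewrite tonelli_sqnorm//.
under eq_integral => x _.
  have -> : (\int[mu1]_y sqnorm (fun y => Num.conj (f (x, y).2) * v (x, y).1)%R y =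
      (normc (v x) ^+ 2)%:E * \int[mu1]_y sqnorm f y)%E.
    rewrite -(ge0_integralZl_EFin mu1 measurableT (fun y _ => sqnorm_ge0 f y)
      (measurable_sqnorm mf) (sqr_ge0 _)).
    apply: eq_integral => y _ /=.
    by rewrite /sqnorm -EFinM Normc.normcM normc_conj exprMn mulrC.
  rewrite -hnorm_sqnorm muleC.
  over.
rewrite (ge0_integralZl_EFin mu2 measurableT (fun y _ => sqnorm_ge0 v y)
  (measurable_sqnorm mv) (sqr_ge0 _)).
by rewrite -/(sqnorm v) -hnorm_sqnorm -EFinM ltry.
Qed.

Lemma cmeasurable_inner_section K v : cmeasurable K ->
  cmeasurable (fun y => cintegral mu2 (fun x => K (x, y) * Num.conj (v x))).
Proof.
move=> mK.
apply: (cmeasurable_cintegral mu2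
  (H := fun z : T1 * T2 => kernel_swap K z * Num.conj (v z.2))).
apply: cmeasurableM; first exact: cmeasurable_swap.
exact/cmeasurable_conj/(cmeasurable_snd _ (cmeasurable_L2 v)).
Qed.

(** Fubini. The inner integral pairs K(., y) with v, so both the adjoint and the effect of an
    operator in x can be read off. *)
Lemma inner_integral_operator K f v : memL2 (mu2 \x mu1)%E K ->
  inner (integral_operator mu1 mu2 K f) v =
  cintegral mu1 (fun y => f y * cintegral mu2 (fun x => K (x, y) * Num.conj (v x))).
Proof.
move=> KL; have mK := KL.1; have KL' := memL2_swap KL.
have mf := cmeasurable_L2 f; have mv := cmeasurable_L2 v.
rewrite inner_toL2; last exact: memL2_integral_operator.
pose H := fun z : T2 * T1 => K z * (f z.2 * Num.conj (v z.1)).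
have iH : cintegrable (mu2 \x mu1)%E H.
  have := memL2_mul_conj KL (memL2_tensor f v).
  by under eq_fun do rewrite conj_mul conjCK.
have mH := cintegrable_measurable iH.
transitivity (cintegral mu2 (fun x => cintegral mu1 (fun y => H (x, y)))).
  apply: ae_eq_cintegral.
  - by apply: cmeasurable_mulL2; exact: cmeasurable_integral_operator.
  - exact: cmeasurable_cintegral.
  apply: filterS (ae_memL2_left KL) => x Kx _.
  rewrite mulrC -cintegralZ; last exact: cintegrable_mul Kx (L2memP f).
  by congr cintegral; apply/funext => y; rewrite /H mulrC -mulrA.
rewrite (cintegral_fubini iH); apply: ae_eq_cintegral.
- exact: (cmeasurable_cintegral mu2 (H := kernel_swap H) (cmeasurable_swap mH)).
- by apply: cmeasurableM => //; exact: cmeasurable_inner_section.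
apply: filterS (ae_memL2_left KL') => y Ky _.
rewrite -cintegralZ; last exact: memL2_mul_conj Ky (L2memP v).
by congr cintegral; apply/funext => x; rewrite /H mulrCA.
Qed.

End integral_operators_L2.

Section integral_operator_adjoint.
Context d1 d2 (T1 : measurableType d1) (T2 : measurableType d2) (R : realType).
Variables (mu1 : {sigma_finite_measure set T1 -> \bar R})
  (mu2 : {sigma_finite_measure set T2 -> \bar R}).
Implicit Types (K : T2 * T1 -> R[i]) (f : L2 mu1) (v : L2 mu2).

(** The integral operator with kernel conj(K(x, y)), variables exchanged, written through
    conjugations so that facts on [kernel_swap] apply. *)
Definition adjoint_integral_operator K (v : L2 mu2) : L2 mu1 :=
  conjL2 (integral_operator mu2 mu1 (kernel_swap K) (conjL2 v)).

Lemma integral_operatorP K : memL2 (mu2 \x mu1)%E K ->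
  is_adjoint (integral_operator mu1 mu2 K) (adjoint_integral_operator K).
Proof.
move=> KL f v; have KL' := memL2_swap KL.
rewrite inner_integral_operator// inner_conjr; apply: ae_eq_cintegral.
- by apply: cmeasurableM; [exact: cmeasurable_L2|exact: (cmeasurable_inner_section v KL.1)].
- by apply: cmeasurableM; exact: cmeasurable_L2.
have h := toL2E (memL2_integral_operator (conjL2 v) KL').
apply: filterS2 h (ae_memL2_left KL') => y /(_ I) -> Ky _; congr (_ * _).
by rewrite -inner_toL2// -inner_toL2_conj// conjL2K.
Qed.

Lemma adjoint_integral_operator_power_summing K : memL2 (mu2 \x mu1)%E K ->
  power_summing (adjoint_integral_operator K) 2 (fine (cL2norm (mu2 \x mu1)%E K)).
Proof.
move=> KL g og N; rewrite -cL2norm_swap//.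
under eq_bigr do rewrite (conjugation_hnorm (conjL2_conjugation mu1)).
exact: (integral_operator_power_summing (memL2_swap KL)
  (conjugation_orthoseq (conjL2_conjugation mu2) og) N).
Qed.

End integral_operator_adjoint.

(** * Factorization through the inverse operators *)

Section inverse_operators.
Context {R : realType} {H : preHilbertType R}.

Lemma uop_invP (E : unbounded_operator H) u : invertible E -> domain E u ->
  uop_inv E (E u) = u.
Proof.
move=> [[_ inj _] _] Du; apply: xget_unique => // w [Dw Ewu].
by apply: inj; rewrite ?inE.
Qed.

End inverse_operators.

Section kernel_factorization.
Context d1 d2 (T1 : measurableType d1) (T2 : measurableType d2) (R : realType).
Variables (mu1 : {sigma_finite_measure set T1 -> \bar R})
  (mu2 : {sigma_finite_measure set T2 -> \bar R}).
Implicit Types (K G : T2 * T1 -> R[i]).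

(** Paired with v, <K(., y), v> = <G(., y), S v> for almost every y: the inverse is moved to v
    instead of through the integral over y. *)
Lemma acts_x_integral_operator (E : unbounded_operator (L2 mu2)) S K G :
  invertible E -> is_adjoint (uop_inv E) S ->
  memL2 (mu2 \x mu1)%E K -> memL2 (mu2 \x mu1)%E G -> acts_x mu1 E K G ->
  integral_operator mu1 mu2 K = uop_inv E \o integral_operator mu1 mu2 G.
Proof.
move=> iE ES KL GL [_ KG]; apply/funext => f /=; apply: inner_ext => v.
rewrite ES (inner_integral_operator _ _ KL) (inner_integral_operator _ _ GL).
have meas K' w : memL2 (mu2 \x mu1)%E K' ->
    cmeasurable (fun y => f y *
      cintegral mu2 (fun x => K' (x, y) * Num.conj ((w : L2 mu2) x))).
  move=> KL'; apply: cmeasurableM; first exact: cmeasurable_L2.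
  exact: cmeasurable_inner_section w KL'.1.
apply: ae_eq_cintegral; [exact: meas|exact: meas|].
apply: filterS KG => y /= [Ky Gy DK EK] _; congr (_ * _).
by rewrite -!inner_toL2// -EK -ES uop_invP.
Qed.

(** The value at x is <K(x, .), conj f> = <G(x, .), S (conj f)>; writing the last vector as a
    conjugate produces the transpose of the inverse. *)
Lemma acts_y_integral_operator (E : unbounded_operator (L2 mu1)) S K G :
  invertible E -> is_adjoint (uop_inv E) S ->
  memL2 (mu2 \x mu1)%E K -> memL2 (mu2 \x mu1)%E G -> acts_y mu2 E K G ->
  integral_operator mu1 mu2 K =
  integral_operator mu1 mu2 G \o (@conjL2 _ _ _ mu1 \o S \o @conjL2 _ _ _ mu1).
Proof.
move=> iE ES KL GL [_ KG]; apply/funext => f /=.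
apply/eq_toL2; [exact: memL2_integral_operator|exact: memL2_integral_operator|].
apply: filterS KG => x /= [Kx Gx DK EK] _.
by rewrite -!inner_toL2_conj// conjL2K -ES -EK uop_invP.
Qed.

(* The intermediate kernel of part (i) is only assumed measurable. *)
Lemma acts_x_memL2 (E : unbounded_operator (L2 mu2)) K G : invertible E ->
  cmeasurable K -> memL2 (mu2 \x mu1)%E G -> acts_x mu1 E K G ->
  memL2 (mu2 \x mu1)%E K.
Proof.
move=> iE mK GL [mG KG].
have [M M0 EM] : exists2 M : R, 0 <= M & forall u, hnorm (uop_inv E u) <= M * hnorm u.
  have [_ [_ [M EM]]] := iE.
  (* The constant in [bounded_operator] is complex; comparing real parts leaves only its real
     part. *)
  exists `|complex.Re M| => // u; have := EM u; rewrite !hnormE lecE.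
  case: M EM => a b EM /= /andP[_]; rewrite !mulr0 subr0 => h.
  by apply: le_trans h _; rewrite ler_wpM2r// ler_norm.
apply/memL2_sqnorm => //; rewrite tonelli_sqnorm_swap//.
apply: (@le_lt_trans _ _ ((M ^+ 2)%:E * \int[mu2 \x mu1]_z sqnorm G z)%E); last first.
  by rewrite integral_sqnorm// -EFinM ltry.
have mS K' : cmeasurable K' -> measurable_fun [set: T1]
    (fun y => \int[mu2]_x sqnorm (fun x => K' (x, y)) x)%E.
  move=> mK'; exact: (measurable_fun_integral_section mu2 (h := sqnorm (kernel_swap K'))
    (measurable_sqnorm (cmeasurable_swap mK'))).
rewrite tonelli_sqnorm_swap// -(ge0_integralZl_EFin mu1 measurableT
  (fun y _ => integral_sqnorm_ge0 _ _) (mS _ mG) (sqr_ge0 _)).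
apply: ae_ge0_le_integral => //.
- by move=> y _; exact: integral_sqnorm_ge0.
- exact: mS.
- by move=> y _; rewrite mule_ge0 ?integral_sqnorm_ge0// lee_fin sqr_ge0.
- by apply: measurable_funeM; exact: mS.
apply: filterS KG => y /= [Ky Gy DK EK] _.
rewrite -!hnorm_toL2// -EFinM lee_fin -exprMn ler_pXn2r ?nnegrE ?mulr_ge0//.
by rewrite -EK -[in leLHS](uop_invP iE DK).
Qed.

End kernel_factorization.

(** * Schatten bounds for the three factorizations *)

Section L2_schatten.
Context (R : realType) (d1 d2 : measure_display)
  (T1 : measurableType d1) (T2 : measurableType d2)
  (mu1 : {sigma_finite_measure set T1 -> \bar R})
  (mu2 : {sigma_finite_measure set T2 -> \bar R})
  (E1 : unbounded_operator (L2 mu1)) (E2 : unbounded_operator (L2 mu2))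
  (p1 p2 : R).
Hypotheses (E1_inv : invertible E1) (E2_inv : invertible E2)
  (p1_gt0 : 0 < p1) (p2_gt0 : 0 < p2)
  (E1_schatten : schatten p1 (uop_inv E1)) (E2_schatten : schatten p2 (uop_inv E2)).
Implicit Types K G : T2 * T1 -> R[i].

Let cL1 : hcomplete (L2 mu1) := @L2_complete _ _ _ mu1.
Let cL2 : hcomplete (L2 mu2) := @L2_complete _ _ _ mu2.

Lemma cL2norm_fin G : memL2 (mu2 \x mu1)%E G ->
  ((fine (cL2norm (mu2 \x mu1)%E G))%:E = cL2norm (mu2 \x mu1)%E G)%E.
Proof. by move=> [_ nG]; rewrite fineK// ge0_fin_numE// Lnorm_ge0. Qed.

Let half_exponent_le2 (p r : R) : 0 < p -> r^-1 = p^-1 + 2^-1 -> 0 < r -> r <= 2.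
Proof.
move=> p0 rE r0; rewrite -lef_pV2 ?posrE// rE lerDr invr_ge0 ltW//.
Qed.

Lemma schatten_acts_x K G r : memL2 (mu2 \x mu1)%E K -> memL2 (mu2 \x mu1)%E G ->
  acts_x mu1 E2 K G -> 0 < r -> r^-1 = p2^-1 + 2^-1 ->
  schatten r (integral_operator mu1 mu2 K) /\
  (schatten_norm r (integral_operator mu1 mu2 K) <=
     schatten_norm p2 (uop_inv E2) * cL2norm (mu2 \x mu1) G)%E.
Proof.
move=> KL GL KG r0 rE.
have [S ES] := schatten_has_adjoint E2_schatten.
rewrite (acts_x_integral_operator E2_inv ES KL GL KG) -(cL2norm_fin GL).
apply: (schatten_comp_summing cL1 cL2 E2_schatten (integral_operatorP GL) _
  (adjoint_integral_operator_power_summing GL) _ p2_gt0 r0 _ rE) => //.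
  by rewrite fine_ge0// Lnorm_ge0.
exact: half_exponent_le2 rE r0.
Qed.

Let J1 := @conjL2 _ _ _ mu1.
Let cJ1 : conjugation J1 := conjL2_conjugation mu1.

(** The summing factor must stand on the right, so the inequality is applied to A^* B^*, where A^*
    is the conjugate of the inverse, and carried back to B A by [schatten_adjoint]. *)
Lemma schatten_acts_y K G r : memL2 (mu2 \x mu1)%E K -> memL2 (mu2 \x mu1)%E G ->
  acts_y mu2 E1 K G -> 0 < r -> r^-1 = p1^-1 + 2^-1 ->
  schatten r (integral_operator mu1 mu2 K) /\
  (schatten_norm r (integral_operator mu1 mu2 K) <=
     schatten_norm p1 (uop_inv E1) * cL2norm (mu2 \x mu1) G)%E.
Proof.
move=> KL GL KG r0 rE; have b0 : 0 <= fine (cL2norm (mu2 \x mu1)%E G).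
  by rewrite fine_ge0// Lnorm_ge0.
have [S ES] := schatten_has_adjoint E1_schatten.
rewrite (acts_y_integral_operator E1_inv ES KL GL KG) -(cL2norm_fin GL) -/J1.
have [sA nA] := conjugation_schatten cJ1 cJ1 cL1 E1_schatten.
have AA' := conjugation_adjoint cJ1 cJ1 (is_adjointC ES).
have BB' := integral_operatorP GL.
have [sT nT] := schatten_comp_summing cL2 cL1 sA (is_adjointC BB') b0
  (integral_operator_power_summing GL) (ltr0n _ 2) p1_gt0 r0
  (half_exponent_le2 p1_gt0 rE r0) rE.
have [sT' ->] := schatten_adjoint cL1 cL2 (is_adjoint_comp BB' AA') sT.
split; [exact: sT'|rewrite -nA; exact: nT].
Qed.

Lemma schatten_acts_xy K G1 G q r : memL2 (mu2 \x mu1)%E K -> memL2 (mu2 \x mu1)%E G ->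
  acts_y mu2 E1 K G1 -> acts_x mu1 E2 G1 G ->
  0 < q -> 0 < r -> q^-1 = p2^-1 + 2^-1 -> r^-1 = q^-1 + p1^-1 ->
  schatten r (integral_operator mu1 mu2 K) /\
  (schatten_norm r (integral_operator mu1 mu2 K) <=
     schatten_norm p1 (uop_inv E1) * schatten_norm p2 (uop_inv E2) *
     cL2norm (mu2 \x mu1) G)%E.
Proof.
move=> KL GL KG1 G1G q0 r0 qE rE.
have G1L := acts_x_memL2 E2_inv KG1.1 GL G1G.
have [sX nX] := schatten_acts_x G1L GL G1G q0 qE.
have [S ES] := schatten_has_adjoint E1_schatten.
rewrite (acts_y_integral_operator E1_inv ES KL G1L KG1) -/J1.
have [sA' nA'] := conjugation_schatten cJ1 cJ1 cL1 E1_schatten.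
(* The transpose is the adjoint of the conjugate of the inverse, so class and norm pass from
   [uop_inv E1] to it. *)
have [sA nA] := schatten_adjoint cL1 cL1 (conjugation_adjoint cJ1 cJ1 (is_adjointC ES)) sA'.
have [sT nT] := schatten_comp cL1 cL1 sX sA p1_gt0 q0 r0 (half_exponent_le2 p2_gt0 qE q0) rE.
split; first exact: sT.
apply: (le_trans nT); rewrite nA nA' muleC -muleA.
apply: lee_wpmul2l; [exact: schatten_norm_ge0|exact: nX].
Qed.

End L2_schatten.

(** Schatten norms decrease in the exponent, so only equality in the condition on 1/r has to be
    treated. *)
Lemma schatten_exponent_ge {R : realType} {H1 H2 : preHilbertType R} (T : H1 -> H2)
    (x : \bar R) (t r : R) : hcomplete H1 -> 0 < t -> 0 < r -> r^-1 <= t ->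
  schatten t^-1 T /\ (schatten_norm t^-1 T <= x)%E ->
  schatten r T /\ (schatten_norm r T <= x)%E.
Proof.
move=> cH t0 r0 rt [sT nT]; have tr : t^-1 <= r by rewrite -(invrK r) lef_pV2 ?posrE ?invr_gt0.
have ti : 0 < t^-1 by rewrite invr_gt0.
have [sT' nT'] := schatten_mono cH sT ti tr.
by split; [exact: sT'|exact: le_trans nT' nT].
Qed.

Local Close Scope complex_scope.
Unset Implicit Arguments.

Theorem theorem2p2 (R : realType) (d1 d2 : measure_display)
    (Omega1 : measurableType d1) (Omega2 : measurableType d2)
    (mu1 : {sigma_finite_measure set Omega1 -> \bar R})
    (mu2 : {sigma_finite_measure set Omega2 -> \bar R})
    (E1 : unbounded_operator (L2 mu1)) (E2 : unbounded_operator (L2 mu2))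
    (p1 p2 : R) (K : Omega2 * Omega1 -> R[i])
    (E1_inv : invertible E1) (E2_inv : invertible E2)
    (p1_gt0 : 0 < p1) (p2_gt0 : 0 < p2)
    (E1_schatten : schatten p1 (uop_inv E1))
    (E2_schatten : schatten p2 (uop_inv E2))
    (K_L2 : memL2 (mu2 \x mu1)%E K) :
  let T : L2 mu1 -> L2 mu2 := integral_operator mu1 mu2 K in
  [/\ forall G1 G : Omega2 * Omega1 -> R[i],
        acts_y mu2 E1 K G1 -> acts_x mu1 E2 G1 G ->
        memL2 (mu2 \x mu1)%E G ->
        forall r : R, 0 < r -> r^-1 <= 2^-1 + p1^-1 + p2^-1 ->
          schatten r T /\
          (schatten_norm r T <= schatten_norm p1 (uop_inv E1)
             * schatten_norm p2 (uop_inv E2) * cL2norm (mu2 \x mu1) G)%E,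
      forall G : Omega2 * Omega1 -> R[i],
        acts_x mu1 E2 K G -> memL2 (mu2 \x mu1)%E G ->
        forall r : R, 0 < r -> r^-1 <= 2^-1 + p2^-1 ->
          schatten r T /\
          (schatten_norm r T <=
             schatten_norm p2 (uop_inv E2) * cL2norm (mu2 \x mu1) G)%E
    & forall G : Omega2 * Omega1 -> R[i],
        acts_y mu2 E1 K G -> memL2 (mu2 \x mu1)%E G ->
        forall r : R, 0 < r -> r^-1 <= 2^-1 + p1^-1 ->
          schatten r T /\
          (schatten_norm r T <=
             schatten_norm p1 (uop_inv E1) * cL2norm (mu2 \x mu1) G)%E].
Proof.
move=> T; have cL1 : hcomplete (L2 mu1) by exact: L2_complete.
have p1V : 0 < p1^-1 by rewrite invr_gt0.
have p2V : 0 < p2^-1 by rewrite invr_gt0.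
have half : 0 < 2^-1 :> R by rewrite invr_gt0.
split.
- move=> G1 G KG1 G1G GL r r0 rle.
  have t0 : 0 < 2^-1 + p1^-1 + p2^-1 by rewrite !addr_gt0.
  apply: (schatten_exponent_ge cL1 t0 r0 rle).
  (* The exponent of C B, reached before A is multiplied in. *)
  have q0 : 0 < (p2^-1 + 2^-1)^-1 by rewrite invr_gt0 addr_gt0.
  apply: (schatten_acts_xy E1_inv E2_inv p1_gt0 p2_gt0 E1_schatten E2_schatten K_L2 GL
    KG1 G1G q0); rewrite ?invr_gt0 ?invrK//.
  by rewrite addrAC [2^-1 + _]addrC.
- move=> G KG GL r r0 rle.
  have t0 : 0 < 2^-1 + p2^-1 by rewrite addr_gt0.
  apply: (schatten_exponent_ge cL1 t0 r0 rle).
  by apply: (schatten_acts_x E2_inv p2_gt0 E2_schatten K_L2 GL KG);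
    rewrite ?invr_gt0 ?invrK// addrC.
- move=> G KG GL r r0 rle.
  have t0 : 0 < 2^-1 + p1^-1 by rewrite addr_gt0.
  apply: (schatten_exponent_ge cL1 t0 r0 rle).
  by apply: (schatten_acts_y E1_inv p1_gt0 E1_schatten K_L2 GL KG);
    rewrite ?invr_gt0 ?invrK// addrC.
Qed.
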